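(* Let $p$ be a prime number and let $E_p$ be the elliptic curve over $\mathbb{Q}$ given by $$E_p:\ Y^2=(X-p)^3+X^3+(X+p)^3 .$$ Then: (1) If $p=2$, $p=3$, or $p\equiv 7 \pmod{24}$, then $\operatorname{rank}(E_p(\mathbb{Q}))=0$. (2) If $p\equiv 5, 13, 17 \pmod{24}$, then $\operatorname{rank}(E_p(\mathbb{Q}))\leq 1$. (3) If $p\equiv 1 \pmod{24}$ and $\left(\frac{2}{p}\right)_4=1$, then $\operatorname{rank}(E_p(\mathbb{Q}))\leq 3$. (4) In all other cases, $\operatorname{rank}(E_p(\mathbb{Q}))\leq 2$.
   Context: $\operatorname{rank}(E_p(\mathbb{Q}))$ denotes the rank of the finitely generated abelian group $E_p(\mathbb{Q})$ (the Mordell-Weil group). For a prime $p\equiv 1\pmod 8$ (so that $2$ is a square mod $p$), $\left(\frac{2}{p}\right)_4$ denotes the rational quartic residue symbol: it equals $1$ if $2$ is a fourth power modulo $p$ and $-1$ otherwise. The change of variables $x=3X$, $y=3Y$ brings $E_p$ to the form $y^2=x^3+18p^2x$. *)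

(* Defs.v *)
From HB Require Import structures.
From mathcomp Require Import all_boot all_order all_algebra all_field.
From mathcomp Require Import ring lra zify.
Set Implicit Arguments.
Unset Strict Implicit.
Unset Printing Implicit Defensive.
Import Order.TTheory GRing.Theory Num.Theory.
Local Open Scope ring_scope.

(* The coordinate ring F[x, y] / (y^2 - f(x)); the pair (a, b) is a(x) + b(x) y. *)
Definition coord_ring_of (F : fieldType) (f : {poly F}) : Type :=
  ({poly F} * {poly F})%type.

Section CoordinateRing.
Variables (F : fieldType) (f : {poly F}).
Local Notation coord_ring := (coord_ring_of f).

HB.instance Definition _ := GRing.Zmodule.copy coord_ring ({poly F} * {poly F})%type.

Definition cr_one : coord_ring := (1, 0).
Definition cr_mul (u v : coord_ring) : coord_ring :=
  (u.1 * v.1 + u.2 * v.2 * f, u.1 * v.2 + u.2 * v.1).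

Fact cr_mulA : associative cr_mul.
Proof. by move=> [a b] [c d] [e g]; congr pair => /=; ring. Qed.
Fact cr_mulC : commutative cr_mul.
Proof. by move=> [a b] [c d]; congr pair => /=; ring. Qed.
Fact cr_mul1 : left_id cr_one cr_mul.
Proof. by move=> [a b]; congr pair => /=; ring. Qed.
Fact cr_mulDl : left_distributive cr_mul +%R.
Proof. by move=> [a b] [c d] [e g]; congr pair => /=; ring. Qed.
Fact cr_one_neq0 : cr_one != 0.
Proof. by rewrite -pair_eqE /= negb_and oner_eq0. Qed.
HB.instance Definition _ := GRing.Zmodule_isComNzRing.Build coord_ring
  cr_mulA cr_mulC cr_mul1 cr_mulDl cr_one_neq0.

Implicit Types (u v g t : coord_ring) (s : seq (option (F * F))).

Definition cr_poly (a : {poly F}) : coord_ring := (a, 0).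
Definition cr_y : coord_ring := (0, 1).
Definition cr_conj u : coord_ring := (u.1, - u.2).
Definition cr_norm u : {poly F} := u.1 ^+ 2 - u.2 ^+ 2 * f.

Lemma cr_pairM (a b c d : {poly F}) :
  ((a, b) : coord_ring) * (c, d) = (a * c + b * d * f, a * d + b * c).
Proof. by []. Qed.
Lemma cr_pairD (a b c d : {poly F}) :
  ((a, b) : coord_ring) + (c, d) = (a + c, b + d).
Proof. by []. Qed.
Lemma cr_pairN (a b : {poly F}) : - ((a, b) : coord_ring) = (- a, - b).
Proof. by []. Qed.
Definition crE := (cr_pairM, cr_pairD, cr_pairN).

Lemma cr_polyM a b : cr_poly (a * b) = cr_poly a * cr_poly b.
Proof. by rewrite /cr_poly crE; congr pair; ring. Qed.
Lemma cr_polyD a b : cr_poly (a + b) = cr_poly a + cr_poly b.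
Proof. by rewrite /cr_poly crE; congr pair; ring. Qed.
Lemma cr_polyN a : cr_poly (- a) = - cr_poly a.
Proof. by rewrite /cr_poly crE; congr pair; ring. Qed.
Lemma cr_poly1 : cr_poly 1 = 1. Proof. by []. Qed.
Lemma cr_yy : cr_y * cr_y = cr_poly f.
Proof. by congr pair => /=; ring. Qed.

Lemma cr_conjM u v : cr_conj (u * v) = cr_conj u * cr_conj v.
Proof. by case: u v => [a b] [c d]; congr pair => /=; ring. Qed.
Lemma cr_conjD u v : cr_conj (u + v) = cr_conj u + cr_conj v.
Proof. by case: u v => [a b] [c d]; congr pair => /=; ring. Qed.
Lemma cr_normM u v : cr_norm (u * v) = cr_norm u * cr_norm v.
Proof. by case: u v => [a b] [c d]; rewrite /cr_norm /=; ring. Qed.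
Lemma cr_normJ u : cr_norm (cr_conj u) = cr_norm u.
Proof. by rewrite /cr_norm /cr_conj /=; ring. Qed.
Lemma cr_norm_poly a : cr_norm (cr_poly a) = a ^+ 2.
Proof. by rewrite /cr_norm /cr_poly /=; ring. Qed.

Definition crX (a : F) : coord_ring := cr_poly ('X - a%:P).
Definition crY (b : F) : coord_ring := cr_y - cr_poly b%:P.

(* Membership in the product of the maximal ideals (x - a, y - b) attached to
   the points of s, the point at infinity contributing the unit ideal. *)
Fixpoint in_ideal s g : Prop :=
  match s with
  | [::] => True
  | None :: s' => in_ideal s' g
  | Some (a, b) :: s' => exists u v,
      [/\ in_ideal s' u, in_ideal s' v & g = crX a * u + crY b * v]
  end.

Lemma in_idealD s g h : in_ideal s g -> in_ideal s h -> in_ideal s (g + h).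
Proof.
elim: s g h => [//|[[a b]|] s IH] g h /=; last exact: IH.
move=> [u [v [Iu Iv ->]]] [u' [v' [Iu' Iv' ->]]].
exists (u + u'), (v + v'); split; [exact: IH|exact: IH|ring].
Qed.

Lemma in_idealM s t g : in_ideal s g -> in_ideal s (t * g).
Proof.
elim: s g t => [//|[[a b]|] s IH] g t /=; last exact: IH.
move=> [u [v [Iu Iv ->]]].
exists (t * u), (t * v); split; [exact: IH|exact: IH|ring].
Qed.

Lemma in_ideal0 s : in_ideal s 0.
Proof.
elim: s => [//|[[a b]|] s IH] //=.
by exists 0, 0; split=> //; ring.
Qed.

Lemma in_ideal_cons p s g : in_ideal (p :: s) g -> in_ideal s g.
Proof.
case: p => [[a b]|] //= [u [v [Iu Iv ->]]].
by apply: in_idealD; apply: in_idealM.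
Qed.

Lemma in_ideal_sub p s s' : (forall g, in_ideal s g -> in_ideal s' g) ->
  forall g, in_ideal (p :: s) g -> in_ideal (p :: s') g.
Proof.
move=> ss' g; case: p => [[a b]|] /=; last exact: ss'.
by move=> [u [v [Iu Iv ->]]]; exists u, v; split; auto.
Qed.

Lemma in_ideal_swap p q s g :
  in_ideal [:: p, q & s] g -> in_ideal [:: q, p & s] g.
Proof.
case: p q => [[a b]|] [[c d]|] //=.
move=> [_ [_ [[u [v [Iu Iv ->]]] [u' [v' [Iu' Iv' ->]]] ->]]].
exists (crX a * u + crY b * u'), (crX a * v + crY b * v').
by split; [exists u, u'|exists v, v'|ring].
Qed.

Lemma in_ideal_perm s s' g : perm_eq s s' -> in_ideal s g -> in_ideal s' g.
Proof.
have mv p s1 s2 : forall g, in_ideal (s1 ++ p :: s2) g -> in_ideal (p :: s1 ++ s2) g.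
  elim: s1 => [//|q s1 IH] h /= Ih.
  by apply: in_ideal_swap; apply: in_ideal_sub Ih.
have mv' p s1 s2 : forall g, in_ideal (p :: s1 ++ s2) g -> in_ideal (s1 ++ p :: s2) g.
  elim: s1 => [//|q s1 IH] h /= Ih.
  by apply: (in_ideal_sub IH); apply: in_ideal_swap.
elim: s s' g => [|p s IH] s' g.
  by rewrite perm_sym => /perm_nilP->.
move=> pss'; have ps' : p \in s' by rewrite -(perm_mem pss') mem_head.
case/splitPr: ps' pss' => s1 s2.
rewrite perm_sym (perm_catCA s1 [:: p] s2) /= perm_cons perm_sym => pss'.
move=> Ig; apply: mv'; apply: in_ideal_sub Ig => h; exact: IH.
Qed.

Lemma in_ideal_cat s s' g h :
  in_ideal s g -> in_ideal s' h -> in_ideal (s ++ s') (g * h).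
Proof.
elim: s g => [|[[a b]|] s IH] g /=; [|move=> [u [v [Iu Iv ->]]] Ih|exact: IH].
  by move=> _; apply: in_idealM.
exists (u * h), (v * h); split; [exact: IH|exact: IH|ring].
Qed.

Definition popp (p : option (F * F)) := omap (fun q => (q.1, - q.2)) p.

Lemma poppK : involutive popp.
Proof. by case=> [[a b]|] //=; rewrite opprK. Qed.

Lemma in_ideal_conj s g : in_ideal s g -> in_ideal (map popp s) (cr_conj g).
Proof.
elim: s g => [|[[a b]|] s IH] g //=; last exact: IH.
move=> [u [v [Iu Iv ->]]].
exists (cr_conj u), (- cr_conj v); split; first exact: IH.
  rewrite -mulN1r; apply: in_idealM; exact: IH.
rewrite cr_conjD !cr_conjM.
have -> : cr_conj (crX a) = crX a.
  by rewrite /crX /cr_poly /cr_conj /= oppr0.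
have -> : cr_conj (crY b) = - crY (- b).
  rewrite /crY /cr_y /cr_poly polyCN; congr pair => /=; ring.
ring.
Qed.

Definition oncurve (p : option (F * F)) : bool :=
  if p is Some (x, y) then y ^+ 2 == f.[x] else true.

Definition Xof (p : option (F * F)) : {poly F} :=
  if p is Some (x, _) then 'X - x%:P else 1.

Lemma fXx x y : oncurve (Some (x, y)) -> exists q,
   f = q * ('X - x%:P) + (y ^+ 2)%:P.
Proof.
move=> /= /eqP yf.
have : root (f - (y ^+ 2)%:P) x by rewrite rootE !hornerE yf subrr.
move=> /factor_theorem [q fq]; exists q.
by rewrite -fq subrK.
Qed.

Lemma crYY x y : oncurve (Some (x, y)) -> exists q,
  crY y * crY (- y) = crX x * cr_poly q.
Proof.
move=> /fXx [q fq]; exists q.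
rewrite /crY polyCN cr_polyN opprK -(mulrC (cr_poly q)).
rewrite -cr_polyM (_ : q * _ = f - (y ^+ 2)%:P); last by rewrite [in RHS]fq addrK.
rewrite cr_polyD cr_polyN -cr_yy expr2 polyCM cr_polyM; ring.
Qed.

Lemma in_ideal_opp p s g : oncurve p -> in_ideal [:: p, popp p & s] g ->
  exists2 h, in_ideal s h & g = cr_poly (Xof p) * h.
Proof.
case: p => [[x y]|] /=; last by move=> _; exists g; rewrite // cr_poly1 mul1r.
move=> /crYY [q qE] [_ [_ [[u [v [Iu Iv ->]]] [u' [v' [Iu' Iv' ->]]] ->]]].
exists (crX x * u + crY (- y) * v + crY y * u' + cr_poly q * v').
  by do 3?apply: in_idealD; apply: in_idealM.
rewrite -/(crX x).
transitivity (crX x * (crX x * u + crY (- y) * v + crY y * u')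
   + crY y * crY (- y) * v'); first by ring.
rewrite qE; ring.
Qed.

End CoordinateRing.

Section GroupLaw.
Variables (F : fieldType) (f : {poly F}).
Hypotheses (char2 : (2 : F) != 0) (szf : size f = 4) (sepf : separable_poly f).
Implicit Types (p q r : option (F * F)) (x y : F).
Local Notation R := (coord_ring_of f).
Local Notation a3 := f`_3.
Local Notation oncurve := (oncurve f).
Local Notation k c := (cr_poly f c%:P).

Definition slope x1 y1 x2 y2 : F :=
  if x1 == x2 then f^`().[x1] / (2 * y1) else (y2 - y1) / (x2 - x1).

(* If f = a3 x^3 + a2 x^2 + ..., the line of slope m through two points of
   y^2 = f(x) meets the curve again at x3 = (m^2 - a2) / a3 - x1 - x2. *)
Definition padd p q : option (F * F) :=
  match p, q with
  | None, _ => q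
  | _, None => p
  | Some (x1, y1), Some (x2, y2) =>
      if (x1 == x2) && (y1 == - y2) then None else
      let m := slope x1 y1 x2 y2 in
      let x3 := (m ^+ 2 - f`_2) / f`_3 - x1 - x2 in
      Some (x3, - (y1 + m * (x3 - x1)))
  end.

Lemma a3_neq0 : a3 != 0.
Proof. by have := lead_coef_eq0 f; rewrite lead_coefE szf -size_poly_eq0 szf => ->. Qed.

Lemma fE : f = a3 *: 'X^3 + f`_2 *: 'X^2 + f`_1 *: 'X + (f`_0)%:P.
Proof.
apply/polyP=> i; rewrite !coefE.
case: i => [|[|[|[|i]]]] /=; rewrite ?mulr1 ?mulr0 ?addr0 ?add0r //.
by rewrite nth_default ?szf.
Qed.

Lemma f_at x : f.[x] = a3 * x ^+ 3 + f`_2 * x ^+ 2 + f`_1 * x + f`_0.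
Proof. by rewrite {1}fE !hornerE. Qed.

Lemma df_at x : f^`().[x] = 3 * a3 * x ^+ 2 + 2 * f`_2 * x + f`_1.
Proof. rewrite {1}fE !derivE !hornerE /=; ring. Qed.

Lemma smooth x : f.[x] = 0 -> f^`().[x] != 0.
Proof.
move=> fx0; move: sepf; rewrite unlock => /coprimep_root; apply.
by rewrite rootE fx0.
Qed.

Definition line x1 y1 m : {poly F} := m *: ('X - x1%:P) + y1%:P.

Lemma line_at x1 y1 m x : (line x1 y1 m).[x] = y1 + m * (x - x1).
Proof. by rewrite !hornerE addrC. Qed.

Lemma chordP x1 y1 x2 y2 (m := slope x1 y1 x2 y2)
    (x3 := (m ^+ 2 - f`_2) / f`_3 - x1 - x2) (l := line x1 y1 m) :
  oncurve (Some (x1, y1)) -> oncurve (Some (x2, y2)) ->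
  ~~ ((x1 == x2) && (y1 == - y2)) ->
  f = l ^+ 2 + a3 *: (('X - x1%:P) * ('X - x2%:P) * ('X - x3%:P)) /\ y2 = l.[x2].
Proof.
move=> /= /eqP e1 /eqP e2; rewrite !f_at in e1 e2 => nopp.
have a30 := a3_neq0.
have y2E : y2 = y1 + m * (x2 - x1).
  rewrite /m /slope; case: eqVneq nopp e2 => [<- nopp e2|ne _ _] /=.
    have : (y1 - y2) * (y1 + y2) = 0 by rewrite -subr_sqr e1 e2 subrr.
    move/eqP; rewrite mulf_eq0 subr_eq0 addr_eq0 (negPf (nopp : y1 != - y2)) orbF => /eqP->.
    by rewrite subrr mulr0 addr0.
  by rewrite divfK ?subr_eq0 1?eq_sym // addrC subrK.
split; last by rewrite line_at.
have x3E : a3 * x3 = m ^+ 2 - f`_2 - a3 * (x1 + x2).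
  by rewrite /x3; field.
pose r1 := f`_1 - 2 * m * (y1 - m * x1) - a3 * (x1 * x2) - a3 * x3 * (x1 + x2).
pose r0 := f`_0 - (y1 - m * x1) ^+ 2 + a3 * x3 * (x1 * x2).
have z1 : r1 * x1 + r0 = 0.
  transitivity (a3 * x1 ^+ 3 + f`_2 * x1 ^+ 2 + f`_1 * x1 + f`_0 - y1 ^+ 2).
    by rewrite /r1 /r0 x3E; ring.
  by rewrite e1 subrr.
have z2 : r1 * x2 + r0 = 0.
  transitivity (a3 * x2 ^+ 3 + f`_2 * x2 ^+ 2 + f`_1 * x2 + f`_0 - y2 ^+ 2).
    by rewrite /r1 /r0 x3E y2E; ring.
  by rewrite e2 subrr.
have r1_0 : r1 = 0.
  case: (eqVneq x1 x2) => [xx|ne]; last first.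
    have : r1 * (x1 - x2) = 0 by rewrite -[RHS](subrr 0) -{1}z1 -z2; ring.
    by move/eqP; rewrite mulf_eq0 (subr_eq0 x1) (negPf ne) orbF => /eqP.
  have y10 : y1 != 0.
    apply: contraNneq nopp => y10; rewrite xx eqxx y10 /=.
    by rewrite y2E xx subrr y10 mulr0 addr0 oppr0.
  have : 2 * y1 * m = f^`().[x1].
    by rewrite /m /slope xx eqxx mulrC divfK // mulf_neq0.
  rewrite df_at => mE.
  transitivity (3 * a3 * x1 ^+ 2 + 2 * f`_2 * x1 + f`_1 - 2 * y1 * m).
    by rewrite /r1 x3E -xx; ring.
  by rewrite mE subrr.
have r0_0 : r0 = 0 by move: z1; rewrite r1_0 mul0r add0r.
have f1E : f`_1 = 2 * m * (y1 - m * x1) + a3 * (x1 * x2) + a3 * x3 * (x1 + x2).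
  by transitivity (f`_1 - r1); [rewrite r1_0 subr0|rewrite /r1; ring].
have f0E : f`_0 = (y1 - m * x1) ^+ 2 - a3 * x3 * (x1 * x2).
  by transitivity (f`_0 - r0); [rewrite r0_0 subr0|rewrite /r0; ring].
have f2E : f`_2 = m ^+ 2 - a3 * x3 - a3 * (x1 + x2) by rewrite x3E; ring.
rewrite [LHS]fE f1E f0E f2E /l /line -!mul_polyC.
ring.
Qed.

Lemma cr_polyX a b : crX f b = crX f a + k (a - b).
Proof. by rewrite /crX -cr_polyD polyCB; congr (cr_poly f _); ring. Qed.

Lemma smooth_double (l : {poly F}) a b :
  f = l ^+ 2 + a3 *: (('X - a%:P) * ('X - a%:P) * ('X - b%:P)) -> l.[a] != 0.
Proof.
move=> fl; apply/eqP => la0.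
have : f.[a] = 0 by rewrite fl !hornerE la0 subrr /=; ring.
move=> /smooth /eqP; apply.
rewrite fl expr2 !derivE !hornerE la0 /=; ring.
Qed.

Lemma kM (a b : F) : k (a * b) = k a * k b.
Proof. by rewrite polyCM cr_polyM. Qed.
Lemma k1 : k 1 = 1. Proof. by []. Qed.

Lemma in_ideal_const s (L : R) c : c != 0 -> in_ideal s (L * k c) -> in_ideal s L.
Proof.
move=> c0 /(in_idealM (k c^-1)).
by rewrite mulrC -mulrA -kM divff // mulr1.
Qed.

Lemma in_ideal_line x1 x2 x3 y1 m (l := line x1 y1 m) :
  f = l ^+ 2 + a3 *: (('X - x1%:P) * ('X - x2%:P) * ('X - x3%:P)) ->
  in_ideal [:: Some (x1, l.[x1]); Some (x2, l.[x2]); Some (x3, l.[x3])]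
    (cr_y f - cr_poly f l).
Proof.
move=> fl; set s := [:: _; _; _]; set L : R := _ - _.
have lE x : cr_poly f l = k m * crX f x + k l.[x].
  rewrite /crX -cr_polyM -cr_polyD; congr (cr_poly f _).
  rewrite /l line_at /line -mul_polyC; ring.
have XI x : in_ideal [:: Some (x, l.[x])] (crX f x) by exists 1, 0; split=> //; ring.
have LI x : in_ideal [:: Some (x, l.[x])] L.
  exists (- k m), 1; split=> //.
  by rewrite /L /crY (lE x); ring.
have I3 (u v w : R) : in_ideal [:: Some (x1, l.[x1])] u -> in_ideal [:: Some (x2, l.[x2])] v ->
    in_ideal [:: Some (x3, l.[x3])] w -> in_ideal s (u * (v * w)).
  by move=> Iu Iv Iw; apply: (in_ideal_cat Iu (in_ideal_cat Iv Iw)).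
pose X1 := crX f x1; pose X2 := crX f x2; pose X3 := crX f x3.
pose lp := cr_poly f l.
have a30 := a3_neq0.
have LL : L * (L + 2 * lp) = k a3 * (X1 * (X2 * X3)).
  transitivity (cr_y f * cr_y f - lp * lp); first by rewrite /L /lp; ring.
  rewrite cr_yy (congr1 (cr_poly f) fl) -mul_polyC cr_polyD expr2 !cr_polyM /lp /X1 /X2 /X3 /crX; ring.
pose J (t : R) := in_ideal s (L * t).
have JD (t u : R) : J t -> J u -> J (t + u) by rewrite /J mulrDr; apply: in_idealD.
have JM (c t : R) : J t -> J (c * t).
  by rewrite /J => /(in_idealM c); rewrite mulrCA.
have JN (t : R) : J t -> J (- t) by rewrite -mulN1r; apply: JM.
have JE (t u : R) : t = u -> J t -> J u by move=> ->.
have IE (t u : R) : t = u -> in_ideal s t -> in_ideal s u by move=> ->.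
have J12 : J (X1 * X2) by apply: (IE _ _ _ (I3 _ _ _ (XI x1) (XI x2) (LI x3))); rewrite /X1 /X2 /X3; ring.
have J13 : J (X1 * X3) by apply: (IE _ _ _ (I3 _ _ _ (XI x1) (LI x2) (XI x3))); rewrite /X1 /X2 /X3; ring.
have J23 : J (X2 * X3) by apply: (IE _ _ _ (I3 _ _ _ (LI x1) (XI x2) (XI x3))); rewrite /X1 /X2 /X3; ring.
have JL1 : J (L * X1) by apply: (IE _ _ _ (I3 _ _ _ (XI x1) (LI x2) (LI x3))); rewrite /X1 /X2 /X3; ring.
have JLL : J (L * L) by apply: (IE _ _ _ (I3 _ _ _ (LI x1) (LI x2) (LI x3))); rewrite /X1 /X2 /X3; ring.
have JLl : J (L + 2 * lp).
  by rewrite /J LL; apply: in_idealM; apply: I3 (XI x1) (XI x2) (XI x3).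
have Jll : J (4 * (lp * lp)).
  apply: JE (JD _ _ JLL (JN _ (JM (L - 2 * lp) _ JLl))); ring.
have Jl1 : J (2 * (lp * X1)).
  apply: JE (JD _ _ (JM X1 _ JLl) (JN _ JL1)); ring.
have char4 : (4 : F) != 0 by rewrite (_ : 4 = 2 * 2) ?mulf_neq0 //; ring.
have fin c : c != 0 -> J (k c) -> in_ideal s L by move=> c0; apply: in_ideal_const.
have Jc c (t : R) : c != 0 -> J (k c * t) -> J t.
  by move=> c0 /(JM (k c^-1)); rewrite mulrA -kM mulVf // k1 mul1r.
have k2 : k 2 = 2.
  by rewrite (_ : 2%:P = 2%:R) //; rewrite ?polyC_natr //; congr pair => /=; ring.
have k4 : k 4 = 4 by rewrite (_ : 4 = 2 * 2 :> F) ?kM ?k2; ring.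
have Jy x : l.[x] != 0 -> J (crX f x) -> in_ideal s L.
  move=> y0 Jx; apply: (fin (4 * (l.[x] * l.[x]))); first by rewrite !mulf_neq0.
  have := JD _ _ Jll (JN _ (JM (4 * (k m * k m * crX f x + 2 * (k m * k l.[x]))) _ Jx)).
  by apply: JE; rewrite /lp (lE x) !kM k4; ring.
case: (eqVneq x1 x2) => [xx|n12].
  have y10 : l.[x1] != 0 by apply: (@smooth_double l x1 x3); rewrite {1}fl -xx.
  apply: (Jy x1) => //; apply: (Jc (2 * l.[x1])); first by rewrite mulf_neq0.
  have J11 : J (X1 * X1) by move: J12; rewrite /X2 -xx.
  have := JD _ _ Jl1 (JN _ (JM (2 * k m) _ J11)).
  by apply: JE; rewrite /lp (lE x1) kM k2 /X1; ring.
have J3 : J X3.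
  apply: (Jc (x2 - x1)); first by rewrite subr_eq0 eq_sym.
  apply: JE (JD _ _ J13 (JN _ J23)).
  by rewrite /X1 (cr_polyX x2 x1) /X2; ring.
case: (eqVneq l.[x3] 0) => [y30|]; last by move/Jy; apply.
have n13 : x1 != x3.
  apply: contra_eq_neq y30 => x13; rewrite -x13; apply: (@smooth_double l x1 x2).
  by rewrite {1}fl -x13; congr (_ + _ *: _); ring.
have n23 : x2 != x3.
  apply: contra_eq_neq y30 => x23; rewrite -x23; apply: (@smooth_double l x2 x1).
  by rewrite {1}fl -x23; congr (_ + _ *: _); ring.
have J2 : J X2.
  apply: (Jc (x3 - x1)); first by rewrite subr_eq0 eq_sym.
  apply: JE (JD _ _ J12 (JN _ J23)).
  by rewrite /X1 (cr_polyX x3 x1) /X3; ring.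
apply: (fin (x3 - x2)); first by rewrite subr_eq0 eq_sym.
apply: JE (JD _ _ J2 (JN _ J3)).
by rewrite /X2 (cr_polyX x3 x2) /X3; ring.
Qed.

Lemma in_ideal_vert x y : oncurve (Some (x, y)) ->
  in_ideal [:: Some (x, y); Some (x, - y)] (crX f x).
Proof.
move=> on; have := on => /crYY [q qE].
have X' : in_ideal [:: Some (x, - y)] (crX f x) by exists 1, 0; split=> //; ring.
have Y' : in_ideal [:: Some (x, - y)] (crY f (- y)) by exists 0, 1; split=> //; ring.
case: (eqVneq y 0) => [y0|y0]; last first.
  apply: (@in_ideal_const _ _ (2 * y)); first by rewrite mulf_neq0.
  exists (crY f (- y)), (- crX f x); split=> //; first by rewrite -[- crX f x]mulN1r; apply: in_idealM.
  rewrite (_ : k _ = crY f (- y) - crY f y); first ring.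
  rewrite /crY; transitivity (k y - k (- y)); last ring.
  rewrite polyCN cr_polyN opprK -cr_polyD; congr (cr_poly f _).
  by rewrite -polyCD; congr polyC; ring.
have fq : f = q * ('X - x%:P).
  have [q' fq'] := fXx on.
  move: qE; rewrite y0 oppr0 /crY polyC0 (_ : cr_poly f 0 = 0) // subr0 cr_yy /crX -cr_polyM.
  by case=> ->; rewrite mulrC.
have qx : q.[x] != 0.
  have : f^`().[x] != 0 by apply: smooth; rewrite fq !hornerE; ring.
  by rewrite {1}fq derivM derivXsubC mulr1 hornerD hornerM hornerXsubC subrr mulr0 add0r.
have [qq qqE] : exists qq, q = qq * ('X - x%:P) + q.[x]%:P.
  have : root (q - q.[x]%:P) x by rewrite rootE !hornerE subrr.
  by move=> /factor_theorem [qq qqE]; exists qq; rewrite -qqE subrK.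
apply: (in_ideal_const qx).
exists (- cr_poly f qq * crX f x), (crY f (- y)); split=> //; first exact: in_idealM.
by rewrite qE (congr1 (cr_poly f) qqE) cr_polyD cr_polyM /crX; ring.
Qed.

Lemma oncurve_opp p : oncurve p -> oncurve (popp p).
Proof. by case: p => [[x y]|] //=; rewrite sqrrN. Qed.

Lemma Xof_opp p : Xof (popp p) = Xof p.
Proof. by case: p => [[x y]|]. Qed.

Lemma oncurve_add p q : oncurve p -> oncurve q -> oncurve (padd p q).
Proof.
case: p q => [[x1 y1]|] [[x2 y2]|] // on1 on2.
rewrite /padd; case: ifPn => // nopp.
have [fl _] := chordP on1 on2 nopp.
set m := slope _ _ _ _ in fl *; set x3 := _ - _ - _ in fl *.
have fx3 : f.[x3] = (line x1 y1 m).[x3] ^+ 2.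
  rewrite [in LHS]fl hornerD hornerZ !hornerM !hornerXsubC subrr !mulr0 addr0.
  by rewrite expr2.
by rewrite /= fx3 line_at sqrrN.
Qed.

Lemma divisor_add p q : oncurve p -> oncurve q -> exists (L : R) (c : F),
  [/\ c != 0, in_ideal [:: p; q; popp (padd p q)] L &
      cr_norm L = c *: (Xof p * Xof q * Xof (padd p q))].
Proof.
have vert r : oncurve r -> exists (L : R) (c : F),
    [/\ c != 0, in_ideal [:: r; popp r] L & cr_norm L = c *: (Xof r * Xof r)].
  case: r => [[x y]|] on; last first.
    by exists 1, 1; split=> //; rewrite ?oner_neq0 // -(cr_poly1 f) cr_norm_poly scale1r /= expr2.
  exists (crX f x), 1; split; rewrite ?oner_neq0 //; first exact: in_ideal_vert.
  by rewrite cr_norm_poly scale1r expr2.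
case: p q => [[x1 y1]|] [[x2 y2]|] on1 on2.
- rewrite /padd; case: ifPn => [/andP[/eqP xx /eqP yy]|nopp].
    have [L [c [c0 IL NL]]] := vert _ on1.
    exists L, c; split=> //; last by rewrite NL /= mulr1 xx.
    by move: IL; rewrite /popp /omap /obind /oapp /= yy opprK xx.
  have [fl y2E] := chordP on1 on2 nopp.
  set m := slope _ _ _ _ in fl y2E *; set x3 := _ - _ - _ in fl *.
  exists (cr_y f - cr_poly f (line x1 y1 m)), (- a3); split.
  + by rewrite oppr_eq0 a3_neq0.
  + have := in_ideal_line fl.
    by rewrite -y2E !line_at subrr mulr0 addr0 /= opprK.
  + transitivity (line x1 y1 m ^+ 2 - f).
      by rewrite /cr_norm /cr_y /cr_poly /=; ring.
    by rewrite [f in _ - f]fl opprD addrA subrr add0r scaleNr.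
- have [L [c [c0 IL NL]]] := vert _ on1.
  by exists L, c; split=> //; rewrite NL /= ?mulr1.
- have [L [c [c0 IL NL]]] := vert _ on2.
  by exists L, c; split=> //; rewrite NL /= mul1r.
- have [L [c [c0 IL NL]]] := vert None isT.
  by exists L, c; split=> //; rewrite NL /= ?mulr1.
Qed.

Lemma norm_size (u : R) : (size (cr_norm u) <= 3)%N -> u.2 = 0.
Proof.
move=> sz; apply/eqP; apply: contraTT sz => u2; rewrite -ltnNge.
have f0 : f != 0 by rewrite -size_poly_gt0 szf.
have s2 : size (u.2 ^+ 2 * f) = ((size u.2).*2 + 2)%N.
  rewrite size_mul ?expf_neq0 // szf expr2 size_mul // addnn -subn1.
  by have := u2; rewrite -size_poly_gt0; case: (size u.2) => // n _; rewrite doubleS /=; lia.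
have u2s : (0 < size u.2)%N by rewrite size_poly_gt0.
rewrite /cr_norm; case: (eqVneq u.1 0) => [->|u1].
  by rewrite expr0n sub0r size_polyN s2; lia.
have s1 : size (u.1 ^+ 2) = (size u.1).*2.-1 by rewrite expr2 size_mul // addnn.
have u1s : (0 < size u.1)%N by rewrite size_poly_gt0.
case: (ltngtP (size (u.1 ^+ 2)) (size (u.2 ^+ 2 * f))) => cmp.
- by rewrite addrC size_polyDl ?size_polyN // s2; lia.
- by rewrite size_polyDl ?size_polyN //; move: cmp; rewrite s2; lia.
- by move: cmp; rewrite s1 s2; lia.
Qed.

Lemma cr_poly_inj (a b : {poly F}) : cr_poly f a = cr_poly f b -> a = b.
Proof. by case. Qed.

Lemma crX_cancel (a : {poly F}) (u v : R) : a != 0 ->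
  cr_poly f a * u = cr_poly f a * v -> u = v.
Proof.
move=> a0; case: u v => [u1 u2] [v1 v2]; rewrite /cr_poly !crE !mul0r !addr0.
by case=> /(mulfI a0) -> /(mulfI a0) ->.
Qed.

Definition cr_eval x y (u : R) : F := u.1.[x] + u.2.[x] * y.

Lemma cr_evalM x y u v : oncurve (Some (x, y)) ->
  cr_eval x y (u * v) = cr_eval x y u * cr_eval x y v.
Proof.
move=> /eqP yf; case: u v => [u1 u2] [v1 v2].
rewrite /cr_eval crE /= !hornerD !hornerM -yf; ring.
Qed.

(* If I_(-T) I_T' contains a function of norm c X_T X_T' then T = T'. *)
Lemma divisor_inj p q (u : R) c : oncurve p -> oncurve q -> c != 0 ->
  in_ideal [:: popp p; q] u -> cr_norm u = c *: (Xof p * Xof q) -> p = q.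
Proof.
move=> on1 on2 c0 Iu Nu.
have u2 : u.2 = 0.
  apply: norm_size; rewrite Nu size_scale //.
  case: p q {on1 on2 Iu Nu} => [[x1 y1]|] [[x2 y2]|] /=;
   rewrite ?mul1r ?mulr1 ?size_XsubC ?size_poly1 //.
  by rewrite size_mul ?polyXsubC_eq0 // !size_XsubC.
have [a ua] : exists a, u = cr_poly f a by exists u.1; case: u u2 {Iu Nu} => [? ?] /= ->.
subst u; rewrite cr_norm_poly in Nu.
have odd x : a ^+ 2 <> c *: ('X - x%:P).
  move=> /(congr1 (size \o polyseq)) /=; rewrite size_scale // size_XsubC.
  have [->|a0] := eqVneq a 0; first by rewrite expr0n /= size_poly0.
  rewrite expr2 size_mul // addnn; lia.
case: p q on1 on2 Iu Nu => [[x1 y1]|] [[x2 y2]|] //= on1 on2 Iu;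
  rewrite ?mul1r ?mulr1; try by move/odd.
move=> Na.
have : root a x1.
  have : a.[x1] ^+ 2 == 0.
    by rewrite -horner_exp Na hornerZ hornerM hornerXsubC subrr mul0r mulr0.
  by rewrite expf_eq0 rootE.
move=> /factor_theorem [b ab]; subst a.
have X0 x : 'X - x%:P != 0 :> {poly F} by rewrite polyXsubC_eq0.
have Nb : b ^+ 2 * ('X - x1%:P) = c *: ('X - x2%:P).
  apply: (mulfI (X0 x1)).
  by rewrite -scalerAr -Na; ring.
have xx : x1 = x2.
  move: (congr1 (horner^~ x1) Nb); rewrite hornerM hornerXsubC subrr mulr0.
  rewrite hornerZ hornerXsubC => /esym/eqP; rewrite mulf_eq0 (negPf c0) subr_eq0.
  by move/eqP.
subst x2.
have b2 : b ^+ 2 = c%:P by apply: (mulIf (X0 x1)); rewrite Nb mul_polyC.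
have bx : b.[x1] != 0 by have := c0; rewrite -(hornerC c x1) -b2 horner_exp expf_eq0.
congr (Some (_, _)); apply/eqP; apply/negPn/negP => ne.
have yy : y2 = - y1.
  move: on1 on2 => /eqP e1 /eqP e2; have : (y1 - y2) * (y1 + y2) = 0.
    by rewrite -subr_sqr e1 e2 subrr.
  move/eqP; rewrite mulf_eq0 subr_eq0 (negPf ne) addrC addr_eq0 /= => /eqP; exact.
subst y2.
have y10 : y1 != 0 by apply: contraNneq ne => ->; rewrite oppr0.
set t := Some (x1, - y1) in Iu.
have ont : oncurve t by rewrite /= sqrrN.
have Yt : in_ideal [:: popp t] (crY f y1).
  by exists 0, 1; split=> //; rewrite opprK; ring.
have It : in_ideal [:: t; t] (cr_poly f (b * ('X - x1%:P))) by [].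
have := in_ideal_cat It (in_ideal_cat Yt Yt).
move=> /(in_ideal_sub (@in_ideal_swap _ _ t (popp t) [:: popp t])).
case/(in_ideal_opp ont) => h /(in_ideal_opp ont) [h' _ ->] /= e.
have {e} : cr_poly f b * (crY f y1 * crY f y1) = crX f x1 * h'.
  by apply: (crX_cancel (X0 x1)); rewrite -e cr_polyM; ring.
move=> /(congr1 (cr_eval x1 (- y1))); rewrite !cr_evalM //.
rewrite /cr_eval /= !hornerE /= subrr !mul0r => /eqP.
rewrite !mulf_eq0 (negPf bx) /= orbb.
by rewrite (_ : _ + _ = - (2 * y1)); [rewrite oppr_eq0 mulf_eq0 (negPf char2) (negPf y10)|ring].
Qed.

(* Associativity goes through divisor classes: each sum P + Q comes with a
   function L of norm c X_P X_Q X_(P+Q) lying in I_P I_Q I_(-(P+Q)); combining the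
   four functions for the two bracketings yields one in I_(-T) I_T', and
   divisor_inj gives T = T'. *)
Lemma perm12 p q r s u t t' :
  perm_eq (([:: p; q; popp s] ++ [:: s; r; popp t]) ++
           map (@popp F) ([:: q; r; popp u] ++ [:: p; u; popp t']))
    [:: p; popp p; q; popp q; r; popp r; s; popp s; u; popp u; popp t; t'].
Proof. by rewrite /= !poppK; apply/permP => a /=; ring. Qed.

Lemma paddA p q r : oncurve p -> oncurve q -> oncurve r ->
  padd p (padd q r) = padd (padd p q) r.
Proof.
move=> onp onq onr.
have ons := oncurve_add onp onq; have onu := oncurve_add onq onr.
have ont := oncurve_add ons onr; have ont' := oncurve_add onp onu.
have [L1 [c1 [c10 I1 N1]]] := divisor_add onp onq.
have [L2 [c2 [c20 I2 N2]]] := divisor_add ons onr.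
have [L3 [c3 [c30 I3 N3]]] := divisor_add onq onr.
have [L4 [c4 [c40 I4 N4]]] := divisor_add onp onu.
move: (padd p (padd q r)) (padd (padd p q) r) ont ont' I2 N2 I4 N4 => t' t ont ont' I2 N2 I4 N4.
move: (padd p q) (padd q r) ons onu I1 N1 I2 N2 I3 N3 I4 N4 => s u ons onu I1 N1 I2 N2 I3 N3 I4 N4.
pose G := L1 * L2 * cr_conj (L3 * L4).
have I : in_ideal [:: p; popp p; q; popp q; r; popp r; s; popp s; u; popp u; popp t; t'] G.
  apply: in_ideal_perm (in_ideal_cat (in_ideal_cat I1 I2) (in_ideal_conj (in_ideal_cat I3 I4))).
  exact: perm12.
have [k1 {}I e1] := in_ideal_opp onp I.
have [k2 {}I e2] := in_ideal_opp onq I.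
have [k3 {}I e3] := in_ideal_opp onr I.
have [k4 {}I e4] := in_ideal_opp ons I.
have [k5 {}I e5] := in_ideal_opp onu I.
apply/esym; apply: (divisor_inj (c := c1 * c2 * c3 * c4) ont ont' _ I).
  by rewrite !mulf_neq0.
have X0 a : Xof a != 0 :> {poly F}.
  by case: a => [[? ?]|] /=; rewrite ?polyXsubC_eq0 ?oner_eq0.
pose D : {poly F} := (Xof p * Xof q * Xof r * Xof s * Xof u) ^+ 2.
have D0 : D != 0 by rewrite expf_neq0 // !mulf_neq0.
apply: (mulfI D0).
transitivity (cr_norm G).
  rewrite e1 e2 e3 e4 e5 !cr_normM !cr_norm_poly /D; ring.
rewrite /G !cr_normM cr_normJ !cr_normM N1 N2 N3 N4 /D -!mul_polyC; ring.
Qed.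

Lemma slopeC x1 y1 x2 y2 : oncurve (Some (x1, y1)) -> oncurve (Some (x2, y2)) ->
  ~~ ((x1 == x2) && (y1 == - y2)) -> slope x1 y1 x2 y2 = slope x2 y2 x1 y1.
Proof.
move=> on1 on2 nopp; rewrite /slope [x2 == x1]eq_sym; case: eqVneq nopp => [xx|ne _] /=.
  subst x2 => nopp; suff -> : y1 = y2 by [].
  move: on1 on2 => /eqP e1 /eqP e2; have : (y1 - y2) * (y1 + y2) = 0.
    by rewrite -subr_sqr e1 e2 subrr.
  by move/eqP; rewrite mulf_eq0 subr_eq0 addr_eq0 (negPf nopp) orbF => /eqP.
by rewrite -[y1 - y2]opprB -[x1 - x2]opprB invrN mulrNN.
Qed.

Lemma paddC p q : oncurve p -> oncurve q -> padd p q = padd q p.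
Proof.
case: p q => [[x1 y1]|] [[x2 y2]|] // on1 on2.
have sym : (x1 == x2) && (y1 == - y2) = (x2 == x1) && (y2 == - y1).
  by rewrite eq_sym; congr andb; rewrite -eqr_oppLR eq_sym.
rewrite /padd -sym; case: ifPn => // nopp.
have [_] := chordP on1 on2 nopp; rewrite line_at -(slopeC on1 on2 nopp) => y2E.
set m := slope _ _ _ _ in y2E *.
congr (Some (_, _)); first by ring.
by rewrite y2E; ring.
Qed.

Lemma padd0 : left_id None padd. Proof. by []. Qed.

Lemma paddN p : padd (popp p) p = None.
Proof. by case: p => [[x y]|] //=; rewrite !eqxx. Qed.

End GroupLaw.

(* An elliptic curve Y^2 = f(X) over a field of characteristic other than 2,
   where f is a separable cubic, not necessarily monic. *)
Record cubic_curve (F : fieldType) := CubicCurve {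
  cc_poly :> {poly F};
  cc_char2 : (2 : F) != 0;
  cc_size : size cc_poly = 4;
  cc_sep : separable_poly cc_poly
}.

(* The group of rational points: None is the point at infinity. *)
Record ec_point (F : fieldType) (E : cubic_curve F) := EcPoint {
  ec_coord :> option (F * F);
  ec_on : oncurve E ec_coord
}.

Section Points.
Variables (F : fieldType) (E : cubic_curve F).

HB.instance Definition _ := [isSub for @ec_coord F E].
HB.instance Definition _ := [Choice of ec_point E by <:].

Definition ec_zero : ec_point E := @EcPoint F E None isT.
Definition ec_opp (P : ec_point E) : ec_point E := EcPoint (oncurve_opp (ec_on P)).
Definition ec_add (P Q : ec_point E) : ec_point E :=
  EcPoint (oncurve_add (cc_char2 E) (cc_size E) (ec_on P) (ec_on Q)).

Fact ec_addA : associative ec_add.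
Proof.
move=> P Q S; apply: val_inj => /=.
exact: (paddA (cc_char2 E) (cc_size E) (cc_sep E) (ec_on P) (ec_on Q) (ec_on S)).
Qed.
Fact ec_addC : commutative ec_add.
Proof.
move=> P Q; apply: val_inj => /=.
exact: (paddC (cc_char2 E) (cc_size E) (ec_on P) (ec_on Q)).
Qed.
Fact ec_add0 : left_id ec_zero ec_add.
Proof. by move=> P; apply: val_inj. Qed.
Fact ec_addN : left_inverse ec_zero ec_opp ec_add.
Proof. by move=> P; apply: val_inj; apply: paddN. Qed.

HB.instance Definition _ :=
  GRing.isZmodule.Build (ec_point E) ec_addA ec_addC ec_add0 ec_addN.

End Points.

Section Rank.
Variable V : zmodType.

Definition z_independent (r : nat) (P : 'I_r -> V) : Prop :=
  forall n : 'I_r -> int, \sum_(i < r) P i *~ n i = 0 -> forall i, n i = 0.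

(* The rank of V is r: the maximal number of Z-independent elements is r. *)
Definition has_rank (r : nat) : Prop :=
  (exists P : 'I_r -> V, z_independent P) /\
  (forall P : 'I_r.+1 -> V, ~ z_independent P).

Definition rank_le (n : nat) : Prop := exists2 r, (r <= n)%N & has_rank r.

Lemma z_independent_widen r s (P : 'I_s -> V) : (r <= s)%N ->
  z_independent P -> exists Q : 'I_r -> V, z_independent Q.
Proof.
move=> rs indP; exists (fun i => P (widen_ord rs i)) => n n0 i.
pose N (j : 'I_s) : int := if insub (val j) is Some k then n k else 0.
have NE k : N (widen_ord rs k) = n k by rewrite /N /= valK.
suff /indP/(_ (widen_ord rs i)) : \sum_(j < s) P j *~ N j = 0 by rewrite NE.
rewrite (bigID (fun j : 'I_s => (j < r)%N)) /= addrC big1 => [|j jr]; last first.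
  by rewrite /N insubN // mulr0z.
rewrite add0r (big_ord_narrow_cond (P := xpredT) rs) /= -[RHS]n0.
by apply: eq_bigr => k _; rewrite NE.
Qed.

Lemma has_rank_uniq r s : has_rank r -> has_rank s -> r = s.
Proof.
move=> [[P iP] mr] [[Q iQ] ms]; case: (ltngtP r s) => // lt.
  by have [Q' /mr] := z_independent_widen lt iQ.
by have [P' /ms] := z_independent_widen lt iP.
Qed.

End Rank.

Definition Ep_poly (p : nat) : {poly rat} :=
  ('X - p%:R%:P) ^+ 3 + 'X ^+ 3 + ('X + p%:R%:P) ^+ 3.

Lemma Ep_polyE p : Ep_poly p = 3 *: 'X^3 + (6 * p%:R ^+ 2) *: 'X.
Proof. by rewrite /Ep_poly -!mul_polyC; ring. Qed.

Fact Ep_size p : size (Ep_poly p) = 4.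
Proof.
have s3 : size (3 *: 'X^3 : {poly rat}) = 4 by rewrite size_scale ?size_polyXn.
rewrite Ep_polyE size_polyDl s3 //.
by apply: leq_ltn_trans (size_scale_leq _ _) _; rewrite size_polyX.
Qed.

Fact Ep_separable p : prime p -> separable_poly (Ep_poly p).
Proof.
move=> pp; rewrite unlock; apply/Bezout_coprimepP.
have p0 : p%:R != 0 :> rat by rewrite pnatr_eq0 -lt0n prime_gt0.
exists (- 27 *: 'X, (12 * p%:R ^+ 2)%:P + 9 *: 'X^2) => /=.
rewrite (_ : _ * Ep_poly p + _ = (72 * p%:R ^+ 4)%:P); last first.
  rewrite Ep_polyE !derivE -!mul_polyC -mulr_natl; ring.
by rewrite -alg_polyC eqp_scale ?eqpxx // mulf_neq0 // expf_neq0.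
Qed.

(* E_p : Y^2 = (X - p)^3 + X^3 + (X + p)^3 over the rationals. *)
Definition Ep (p : nat) (hp : prime p) : cubic_curve rat :=
  @CubicCurve rat (Ep_poly p) isT (Ep_size p) (Ep_separable hp).

(* The rational quartic residue symbol (2 / p)_4, meaningful for primes
   p = 1 mod 8. *)
Definition quartic_symbol2 (p : nat) : int :=
  if [exists x : 'I_p, x ^ 4 == 2 %[mod p]] then 1 else -1.

(* Main.v *)
(* Descent through the 2-isogeny between E : y^2 = a x^3 + b x and
   E' : y^2 = a x^3 - 4 b x, with a = 3 and b = 6 p^2.  The map P |-> a x(P) is a
   homomorphism from the points to the field modulo squares, whose kernel is the
   image of the isogeny from the other curve.  So the order of E(Q) / (2 E(Q) + <(0,0)>)
   is at most the product, over the two curves, of the number of classes d, taken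
   modulo the class B of (0,0), whose torsor n^2 = d m^4 + (B/d) e^4 has a primitive
   solution.  Here B = 18 p^2 for E and B = -72 p^2 for E', one may take d odd and
   squarefree, so that d divides 3 p, and congruences modulo 8, 3 and p rule out all
   but a few d.  Heights turn this into a bound for the rank: x |-> x + (b/a) / x is
   quadratic on heights, so every point is 2 P' + R with P' of smaller height and R
   in a finite set. *)
Require Import Defs.
From mathcomp Require Import all_boot all_order all_algebra all_solvable all_field.
From mathcomp Require Import ring lra zify.
From Stdlib Require Import Classical.
Set Implicit Arguments.
Unset Strict Implicit.
Unset Printing Implicit Defensive.
Import Order.TTheory GRing.Theory Num.Theory.
Local Open Scope ring_scope.

(** * Rank of an abelian group by descent *)

(** A bound on V / 2V alone says nothing about the rank: the additive group of the rationals is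
    2-divisible and has rank 1. Heights supply the missing finiteness, not as a finite generation
    theorem but as one integer D such that D v lies in the lattice of the given independent points
    for every v having some positive multiple in it. Without such a uniform D, halving could go on
    for ever; with it, halving acts on integer matrices and shrinks a nonzero determinant. Dividing
    out (0,0) makes the count sharp: each of the two curves has this torsion class, and keeping it
    would cost a factor 2 on each side. After division, k + 1 independent points require 2^(k+1)
    labels. Odd representatives exist because 18 p^2 and -72 p^2 both have odd 2-adic valuation, so
    multiplication by B exchanges classes of even and odd valuation at 2; it also follows that
    neither number is a square, so (0,0) has a nontrivial class on both curves. *)

Lemma rank_le_of_dependent (V : zmodType) (k : nat) :
  (forall P : 'I_k.+1 -> V, ~ z_independent P) -> rank_le V k.
Proof.
elim: k => [|k IH] dep; first by exists 0%N => //; split=> //; exists (fun=> 0) => n _ [].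
have [[P indP]|nind] := classic (exists P : 'I_k.+1 -> V, z_independent P).
  by exists k.+1 => //; split=> //; exists P.
by have [|r rk rankr] := IH _; [move=> P indP; apply: nind; exists P | exists r => //; apply: leqW].
Qed.

(** Over a finite index type choice is provable; [x0] is an arbitrary value at the indices without a
    witness. *)
Lemma choose_fin (I : finType) (T : Type) (R : I -> T -> Prop) (x0 : T) :
  exists f : I -> T, forall i x, R i x -> R i (f i).
Proof.
apply: (@fin_all_exists I (fun=> T) (fun i y => forall x, R i x -> R i y)) => i.
have [[x Rx]|nR] := classic (exists x, R i x); first by exists x.
by exists x0 => x Rx; case: nR; exists x.
Qed.

Section Descent.
Variables (V : zmodType) (h : V -> nat) (t : V) (I : finType) (L : V -> I -> Prop).
Hypothesis t2 : t *+ 2 = 0.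
Hypothesis L_total : forall v, exists i, L v i.
Hypothesis L_eq : forall v w i, L v i -> L w i ->
  exists r, v - w = r *+ 2 \/ v - w = r *+ 2 + t.
Hypothesis northcott : forall B, exists s : seq V, forall v, (h v <= B)%N -> v \in s.
(** The height is multiplicative: the exponents 2 and 4 encode the logarithmic bounds h(v - q) <= 2
    h(v) + O(1) and h(2v) >= 4 h(v) - O(1). *)
Hypothesis h_sub : forall q, exists C, forall v, (h (v - q)%R <= C * h v ^ 2)%N.
Hypothesis h_double : exists C, forall v, (h v ^ 4 <= C * h (v *+ 2)%R)%N.

Section Lattice.
Variables (n : nat) (P : 'I_n -> V).

Definition spanned v := exists x : 'I_n -> int, v = \sum_(i < n) P i *~ x i.
(** The saturation of the lattice spanned by [P], torsion included: it contains every point that has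
    a positive multiple in it, so halving never leaves it. *)
Definition commensurable v := exists2 N, (0 < N)%N & spanned (v *+ N).

Lemma spannedD v w : spanned v -> spanned w -> spanned (v + w).
Proof.
move=> [x ->] [y ->]; exists (fun i => x i + y i).
by rewrite -big_split; apply: eq_bigr => i _; rewrite mulrzDr.
Qed.

Lemma spannedMz v (k : int) : spanned v -> spanned (v *~ k).
Proof.
move=> [x ->]; exists (fun i => x i * k).
by rewrite mulrz_suml; apply: eq_bigr => i _; rewrite mulrzA.
Qed.

Lemma spannedMn v k : spanned v -> spanned (v *+ k).
Proof. by move=> /(spannedMz k). Qed.

Lemma spannedN v : spanned v -> spanned (- v).
Proof. by move=> /(spannedMz (-1)); rewrite mulrNz mulr1z. Qed.

Lemma common_multiple_seq (s : seq V) : exists2 D, (0 < D)%N &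
  forall v, v \in s -> commensurable v -> spanned (v *+ D).
Proof.
elim: s => [|w s [D D0 IH]]; first by exists 1%N.
have [[N N0 Nw]|ncomm] := classic (commensurable w).
  exists (N * D)%N; first by rewrite muln_gt0 N0.
  move=> v; rewrite inE => /predU1P[->|vs] cv; first by rewrite mulrnA; apply: spannedMn.
  by rewrite mulnC mulrnA; apply/spannedMn/IH.
by exists D => // v; rewrite inE => /predU1P[->|/IH].
Qed.

(* Descent: a commensurable point of large height is 2 w' + q with w' of smaller
   height and q among finitely many representatives. *)
Lemma common_multiple : exists2 D, (0 < D)%N &
  forall v, commensurable v -> spanned (v *+ D).
Proof.
have [q qP] := @choose_fin I V (fun i v => commensurable v /\ L v i) 0.
have [C0 C0P] := h_double.
have [C CP] : exists C : I -> nat, forall i v,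
    (h (v - q i)%R <= C i * h v ^ 2)%N /\ (h (v - (q i + t))%R <= C i * h v ^ 2)%N.
  apply: (@fin_all_exists I (fun=> nat)
     (fun i c => forall v, (h (v - q i)%R <= c * h v ^ 2)%N /\ (h (v - (q i + t))%R <= c * h v ^ 2)%N)) => i.
  have [c1 c1P] := h_sub (q i); have [c2 c2P] := h_sub (q i + t).
  exists (c1 + c2)%N => v; rewrite mulnDl; split.
    exact: leq_trans (c1P v) (leq_addr _ _).
  exact: leq_trans (c2P v) (leq_addl _ _).
(* Above this threshold the height drops: h(r)^4 <= C0 h(2r) <= B h(v)^2 < h(v)^3. *)
pose B := (C0 * \sum_i C i)%N.
have [s sP] := northcott B.
have [D D0 DP] := common_multiple_seq (s ++ [seq q i | i : I]).
exists (D * 2)%N; first by rewrite muln_gt0 D0.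
suff step m : forall v, (h v < m)%N -> commensurable v -> spanned (v *+ (D * 2)).
  by move=> v; apply: (step (h v).+1).
elim: m => // m IH v hv cv.
have [small|large] := leqP (h v) B.
  by rewrite mulrnA; apply/spannedMn/DP => //; rewrite mem_cat sP.
have [i Lvi] := L_total v.
have [cq Lq] : commensurable (q i) /\ L (q i) i by apply: (qP i v).
have [r rE] := L_eq Lvi Lq.
(* Doubling once more removes [t] in either alternative; the factor 2 next to [D] pays for it. *)
have r4 : r *+ 4 = v *+ 2 - q i *+ 2.
  rewrite -mulrnBl; case: rE => ->; first by rewrite -mulrnA.
  by rewrite mulrnDl t2 addr0 -mulrnA.
have hr : (h r < m)%N.
  have hr2 : (h (r *+ 2)%R <= (\sum_i C i) * h v ^ 2)%N.
    have Ci : (C i <= \sum_i C i)%N by rewrite (bigD1 i) //= leq_addr.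
    apply: leq_trans (leq_mul Ci (leqnn _)).
    have [h1 h2] := CP i v.
    case: rE => [rE|rE]; first by rewrite -rE.
    by rewrite (_ : r *+ 2 = v - (q i + t)) // opprD addrA rE addrK.
  have : (h r ^ 4 <= B * h v ^ 2)%N.
    by apply: leq_trans (C0P r) _; rewrite /B -mulnA leq_mul2l hr2 orbT.
  move=> hr4; rewrite -(ltn_exp2r _ _ (isT : (0 < 4)%N)).
  apply: leq_ltn_trans hr4 _.
  apply: leq_trans (_ : (h v * h v ^ 2 <= _)%N); first by rewrite ltn_pmul2r // expn_gt0;
    case: (h v) large.
  have v0 : (0 < h v)%N by case: (h v) large.
  apply: (@leq_trans (m * m ^ 2)%N); first by rewrite leq_mul // ?leq_exp2r.
  by rewrite -expnS leq_pexp2l //; lia.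
have cr : commensurable r.
  have [N N0 sN] := cv; have [N' N'0 sN'] := cq.
  exists (4 * (N * N'))%N; first by rewrite !muln_gt0 N0.
  rewrite mulrnA r4 mulrnBl -!mulrnA; apply: spannedD.
    by rewrite mulnCA mulrnA; apply: spannedMn.
  apply: spannedN.
  by rewrite mulnA mulnC mulrnA; apply: spannedMn.
have -> : v *+ (D * 2) = r *+ (D * 2) *+ 2 + q i *+ D *+ 2.
  rewrite mulnC mulrnA (_ : v *+ 2 = r *+ 4 + q i *+ 2); last by rewrite r4 subrK.
  by rewrite mulrnDl -!mulrnA; congr (_ *+ _ + _ *+ _); lia.
apply: spannedD; first by apply/spannedMn/IH.
by apply/spannedMn/DP => //; rewrite mem_cat orbC map_f ?mem_enum.
Qed.

Lemma z_independent_inj (x y : 'I_n -> int) : z_independent P ->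
  \sum_(i < n) P i *~ x i = \sum_(i < n) P i *~ y i -> x =1 y.
Proof.
move=> indP xy i; apply/eqP; rewrite -subr_eq0; apply/eqP.
apply: (indP (fun i => x i - y i)).
under eq_bigr do rewrite mulrzBr.
by rewrite sumrB xy subrr.
Qed.

(* Among tuples of commensurable points one minimises the absolute value of the
   determinant of the coordinates; a relation modulo 2V would halve it. *)
Lemma descent : (#|I| < 2 ^ n)%N -> ~ z_independent P.
Proof.
move=> cardI indP.
have [D D0 DP] := common_multiple.
suff min m : forall (Q : 'I_n -> V) (M : 'M[int]_n),
    (forall i, Q i *+ D = \sum_j P j *~ M i j) -> \det M != 0 -> ~ (`|\det M| <= m)%N.
  apply: (min _ P (D%:Z)%:M _ _ (leqnn _)); last by rewrite det_scalar expf_neq0 // -lt0n.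
  move=> i; rewrite (bigD1 i) //= big1 => [|j ji]; first by rewrite mxE eqxx addr0 pmulrn.
  by rewrite mxE eq_sym (negPf ji) mulr0z.
elim: m => [|m IH] Q M QM detM; first by rewrite leqn0 absz_eq0 (negPf detM).
move=> detm.
(* The 2^n subset sums of [Q] outnumber the labels, so two of them collide; their difference has
   coefficients in {-1, 0, 1}. *)
pose v (e : {ffun 'I_n -> bool}) := \sum_i Q i *~ (e i : nat).
have [lab labP] : exists lab : {ffun 'I_n -> bool} -> I, forall e, L (v e) (lab e).
  exact: (@fin_all_exists {ffun 'I_n -> bool} (fun=> I) (fun e i => L (v e) i)).
have /injectivePn [e [e' ee' labe]] : ~~ injectiveb lab.
  apply/negP => /injectiveP/leq_card; rewrite card_ffun card_bool card_ord.
  by rewrite leqNgt cardI.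
pose d i : int := (e i : nat)%:Z - (e' i : nat)%:Z.
have [i0 di0] : exists i0, d i0 != 0.
  apply/existsP; apply: contraNT ee' => /existsPn d0.
  apply/eqP/ffunP => i; have := d0 i; rewrite negbK subr_eq0.
  by case: (e i) (e' i) => [] [].
have vd : v e - v e' = \sum_i Q i *~ d i.
  by rewrite -sumrB; apply: eq_bigr => i _; rewrite mulrzBr.
have [r rE] : exists r, v e - v e' = r *+ 2 \/ v e - v e' = r *+ 2 + t.
  by apply: (L_eq (i := lab e)); rewrite // labe.
have r4 : r *+ 4 = (\sum_i Q i *~ d i) *+ 2.
  rewrite -vd; case: rE => ->; first by rewrite -mulrnA.
  by rewrite mulrnDl t2 addr0 -mulrnA.
have r4D : r *+ D *+ 4 = \sum_j P j *~ (2 * \sum_i d i * M i j).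
  rewrite -mulrnA mulnC mulrnA r4 -mulrnA pmulrn mulrz_suml.
  transitivity (\sum_i \sum_j P j *~ (2 * (d i * M i j))).
    apply: eq_bigr => i _; transitivity (Q i *+ D *~ (2 * d i)).
      by rewrite pmulrn -!mulrzA PoszM; congr (_ *~ _); ring.
    by rewrite QM mulrz_suml; apply: eq_bigr => j _; rewrite -mulrzA; congr (_ *~ _); ring.
  rewrite exchange_big; apply: eq_bigr => j _ /=.
  by rewrite mulr_sumr -mulrz_sumr.
(* As [D] serves every commensurable point, it also clears the denominators of the new point [r],
   and the matrix built from [x] stays integral. *)
have [x rx] : spanned (r *+ D).
  apply: DP; exists (D * 4)%N; first by rewrite muln_gt0 D0.
  by rewrite mulrnA r4D; exists (fun j => 2 * \sum_i d i * M i j).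
have xE j : x j * 2 = \sum_i d i * M i j.
  have : x j * 4 = 2 * \sum_i d i * M i j.
    apply: (z_independent_inj (x := fun j => x j * 4)
                              (y := fun j => 2 * \sum_i d i * M i j)) => //.
    rewrite -r4D rx pmulrn mulrz_suml; by apply: eq_bigr => k _; rewrite mulrzA.
  lia.
pose M' := \matrix_(i, j) if i == i0 then x j else M i j.
pose Q' i := if i == i0 then r else Q i.
(* Row [i0] of [M'] is half the combination of the rows of [M] with coefficients [d]; only the row
   [i0] of that combination contributes to the determinant. *)
have detM' : \det M' * 2 = d i0 * \det M.
  rewrite (expand_det_row _ i0) mulr_suml.
  transitivity ((\row_i d i *m M *m \adj M) 0 i0); last first.
    by rewrite -mulmxA mul_mx_adj -scalemx1 -scalemxAr mulmx1 !mxE mulrC.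
  rewrite mxE; apply: eq_bigr => j _; rewrite !mxE eqxx mulrAC xE.
  under [in RHS]eq_bigr do rewrite mxE.
  congr (_ * _); congr (_ * \det _).
  by apply/matrixP => k l; rewrite !mxE eq_sym (negPf (neq_lift _ _)).
apply: (IH Q' M').
- move=> i; rewrite /Q'; case: eqP => [->|ni].
    by rewrite rx; apply: eq_bigr => j _; rewrite mxE eqxx.
  by rewrite QM; apply: eq_bigr => j _; rewrite mxE; case: eqP.
- by apply: contra_neq (mulf_neq0 di0 detM) => M0; rewrite -detM' M0 mul0r.
have d1 : `|d i0|%N = 1%N.
  by move: di0; rewrite /d; case: (e i0); case: (e' i0).
have : (`|\det M'| * 2)%N = `|\det M|%N.
  by have := congr1 absz detM'; rewrite !abszM d1 mul1n.
have : (0 < `|\det M|)%N by rewrite absz_gt0.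
lia.
Qed.

End Lattice.
End Descent.

(** Since psi phi = 2, labels for V / psi V' and for V' / phi V combine into labels for V / 2V. The
    ambiguity by t' disappears because psi kills it; the one by t remains. A preimage u under psi is
    not canonical, hence a relation instead of a function. *)
Lemma labels_comp (V V' : zmodType) (phi : V -> V') (psi : V' -> V) (t : V) (t' : V')
    (I I' : finType) (L : V -> I -> Prop) (L' : V' -> I' -> Prop) :
  {morph psi : u v / u - v} -> (forall v, psi (phi v) = v *+ 2) -> psi t' = 0 ->
  t *+ 2 = 0 ->
  (forall v, exists i, L v i) -> (forall v, exists i, L' v i) ->
  (forall v w i, L v i -> L w i -> exists u, v - w = psi u \/ v - w = psi u + t) ->
  (forall v w i, L' v i -> L' w i -> exists u, v - w = phi u \/ v - w = phi u + t') ->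
  exists LL : V -> I * I' -> Prop, (forall v, exists i, LL v i) /\
    (forall v w i, LL v i -> LL w i ->
      exists r, v - w = r *+ 2 \/ v - w = r *+ 2 + t).
Proof.
move=> psiB psiphi psit t2 Ltot Ltot' Leq Leq'.
have [q qP] := @choose_fin I V (fun i v => L v i) 0.
exists (fun v i => exists u, L' u i.2 /\ (v - q i.1 = psi u \/ v - q i.1 = psi u + t)).
split=> [v|v w i [u [Lu vE]] [u' [Lu' wE]]].
  have [i Li] := Ltot v; have [u uE] := Leq _ _ _ Li (qP i v Li).
  by have [i' Li'] := Ltot' u; exists (i, i'), u.
have vwE : v - w = (v - q i.1) - (w - q i.1) by rewrite opprB addrA subrK.
have psiD a b : psi (a + b) = psi a + psi b.
  have psi0 : psi 0 = 0 by rewrite -(subrr 0) psiB subrr.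
  have psiN c : psi (- c) = - psi c by rewrite -sub0r psiB psi0 sub0r.
  by rewrite -[b]opprK psiB psiN !opprK.
have [r rE] := Leq' _ _ _ Lu Lu'.
have uu' : psi u - psi u' = r *+ 2.
  by rewrite -psiB; case: rE => ->; rewrite ?psiD psiphi ?psit ?addr0.
have tN : - t = t by apply/esym/eqP; rewrite -addr_eq0 -mulr2n t2.
exists r; rewrite vwE -uu'; case: vE wE => -> [] ->.
- by left.
- by right; rewrite opprD addrA tN.
- by right; rewrite addrAC.
- by left; rewrite opprD tN addrACA -mulr2n t2 addr0.
Qed.

(** * The curves y^2 = a x^3 + b x and their 2-isogenies *)

Lemma cubic_size (F : fieldType) (a b : F) : a != 0 -> size (a *: 'X^3 + b *: 'X) = 4.
Proof.
move=> a0; have s3 : size (a *: 'X^3) = 4 by rewrite size_scale // size_polyXn.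
rewrite size_polyDl s3 //; apply: leq_ltn_trans (size_scale_leq _ _) _.
by rewrite size_polyX.
Qed.

Lemma cubic_separable (F : fieldType) (a b : F) : (2 : F) != 0 -> b != 0 ->
  separable_poly (a *: 'X^3 + b *: 'X).
Proof.
move=> two b0; rewrite unlock; apply/Bezout_coprimepP.
exists (- 9 * a *: 'X, (2 * b)%:P + 3 * a *: 'X^2) => /=.
rewrite (_ : _ * (_ + _) + _ = (2 * b ^+ 2)%:P); last first.
  rewrite !derivE -!mul_polyC -mulr_natl; ring.
by rewrite -alg_polyC eqp_scale ?eqpxx // mulf_neq0 // expf_neq0.
Qed.

Section TwoTorsionCurve.
Variables (F : fieldType) (E : cubic_curve F) (a b : F).
Hypothesis fE : cc_poly E = a *: 'X^3 + b *: 'X.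
Implicit Types (P Q : ec_point E) (x y lam mu : F).
Local Notation f := (cc_poly E).
Let char2 := cc_char2 E.
Let szf := cc_size E.

Lemma cubic_coef3 : f`_3 = a.
Proof. by rewrite fE !coefE /= mulr1 mulr0 addr0. Qed.

Lemma cubic_coef2 : f`_2 = 0.
Proof. by rewrite fE !coefE /= !mulr0 addr0. Qed.

Lemma cubic_at x : f.[x] = a * x ^+ 3 + b * x.
Proof. by rewrite fE !hornerE. Qed.

Lemma cubic_deriv_at x : f^`().[x] = 3 * a * x ^+ 2 + b.
Proof. rewrite fE !derivE !hornerE /=; ring. Qed.

Lemma cubic_lead_neq0 : a != 0.
Proof. by rewrite -cubic_coef3 a3_neq0. Qed.
Let a0 := cubic_lead_neq0.

Lemma cubic_lin_neq0 : b != 0.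
Proof.
have : f^`().[0] != 0 by apply: smooth (cc_sep E) _ _; rewrite cubic_at; ring.
by rewrite cubic_deriv_at expr0n mulr0 add0r.
Qed.
Let b0 := cubic_lin_neq0.

(** Vieta's formulas for a x^3 + b x - (lam x + mu)^2 = a (x - x1)(x - x2)(x - x3). The condition is
    symmetric in the three points and includes tangents without a special case. *)
Definition collinear lam mu x1 y1 x2 y2 x3 y3 : Prop :=
  [/\ lam ^+ 2 = a * (x1 + x2 + x3),
      b = 2 * (lam * mu) + a * (x1 * x2 + x1 * x3 + x2 * x3),
      mu ^+ 2 = a * (x1 * x2 * x3) &
      [/\ y1 = lam * x1 + mu, y2 = lam * x2 + mu & y3 = lam * x3 + mu]].

Lemma collinear_cycle lam mu x1 y1 x2 y2 x3 y3 :
  collinear lam mu x1 y1 x2 y2 x3 y3 -> collinear lam mu x2 y2 x3 y3 x1 y1.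
Proof.
move=> [e1 e2 e3 [-> -> ->]]; split=> //; first by rewrite e1; ring.
  by rewrite [LHS]e2; ring.
by rewrite e3; ring.
Qed.

(** Points with equal abscissas lie on the line with equal ordinates. If they were also opposite,
    the ordinate would vanish and the double root would force f' to vanish there, against
    smoothness; otherwise lam is the chord or tangent slope. *)
Lemma collinear_padd lam mu x1 y1 x2 y2 x3 y3 :
  oncurve f (Some (x1, y1)) -> collinear lam mu x1 y1 x2 y2 x3 y3 ->
  padd f (Some (x1, y1)) (Some (x2, y2)) = Some (x3, - y3).
Proof.
move=> /eqP on1 [e1 bE e3 [y1E y2E y3E]].
have dbl : x1 = x2 -> f^`().[x1] = 2 * y1 * lam.
  move=> xx; rewrite cubic_deriv_at bE -xx y1E.
  transitivity (2 * x1 * (a * (x1 + x2 + x3)) + 2 * (lam * mu)); first by rewrite -xx; ring.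
  by rewrite -e1; ring.
rewrite /padd; case: ifPn => [/andP[/eqP xx /eqP yy]|nopp].
  have y10 : y1 = 0.
    have : 2 * y1 = 0 by rewrite mulr2n mulrDl !mul1r {2}yy y2E -xx -y1E subrr.
    by move/eqP; rewrite mulf_eq0 (negPf char2) => /eqP.
  have : f^`().[x1] != 0 by apply: smooth (cc_sep E) _ _; rewrite -on1 y10 expr0n.
  by rewrite dbl // y10 mulr0 mul0r eqxx.
have -> : slope f x1 y1 x2 y2 = lam.
  rewrite /slope; case: eqVneq nopp => [xx|xx] /= nopp.
    have y1y2 : y1 = y2 by rewrite y1E y2E xx.
    rewrite dbl // mulrC mulKf // mulf_neq0 //.
    by apply: contraNneq nopp => y10; rewrite -y1y2 y10 oppr0.
  rewrite y1E y2E (_ : _ - _ = lam * (x2 - x1)); last by ring.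
  by rewrite mulfK // subr_eq0 eq_sym.
rewrite cubic_coef3 cubic_coef2 subr0 e1.
have -> : a * (x1 + x2 + x3) / a - x1 - x2 = x3 by field.
by congr (Some (_, _)); rewrite y1E y3E; ring.
Qed.

Lemma padd_collinear x1 y1 x2 y2 :
  oncurve f (Some (x1, y1)) -> oncurve f (Some (x2, y2)) ->
  padd f (Some (x1, y1)) (Some (x2, y2)) <> None ->
  exists x3 y3 lam mu,
    padd f (Some (x1, y1)) (Some (x2, y2)) = Some (x3, - y3) /\
    collinear lam mu x1 y1 x2 y2 x3 y3.
Proof.
move=> on1 on2; rewrite /padd; case: ifPn => // nopp _.
have [fl y2E] := chordP char2 szf on1 on2 nopp.
move: fl y2E; set m := slope _ _ _ _ _; set x3 := _ - _ - _.
rewrite cubic_coef3 line_at => fl y2E.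
pose mu := y1 - m * x1.
exists x3, (y1 + m * (x3 - x1)), m, mu; split=> //.
have {}fl : a *: 'X^3 + b *: 'X = a *: 'X^3 + (m ^+ 2 - a * (x1 + x2 + x3)) *: 'X^2
    + (2 * m * mu + a * (x1 * x2 + x1 * x3 + x2 * x3)) *: 'X
    + (mu ^+ 2 - a * (x1 * x2 * x3))%:P.
  by rewrite -fE fl /line -!mul_polyC /mu; ring.
have c i := congr1 (fun q : {poly F} => q`_i) fl.
move: (c 0%N) (c 1%N) (c 2) => {c}; rewrite !coefE /= !(mulr0, mulr1, addr0, add0r).
move=> c0 c1 c2; split.
- by apply/eqP; rewrite -subr_eq0 -c2.
- by rewrite c1; ring.
- by apply/eqP; rewrite -subr_eq0 -c0.
by split; rewrite ?y2E /mu; ring.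
Qed.

Lemma ec_val_add P Q : val (P + Q) = padd f (val P) (val Q).
Proof. by []. Qed.

Lemma ec_val_opp P : val (- P) = popp (val P).
Proof. by []. Qed.

Lemma ec_zeroP P : reflect (P = 0) (val P == None).
Proof. by apply: (iffP eqP) => [vP|->] //; apply: val_inj. Qed.

Variant add_spec P Q : Prop :=
  | AddLeft0 of P = 0
  | AddRight0 of Q = 0
  | AddOpp of P = - Q
  | AddChord x1 y1 x2 y2 x3 y3 lam mu of val P = Some (x1, y1) & val Q = Some (x2, y2)
      & val (P + Q) = Some (x3, - y3) & collinear lam mu x1 y1 x2 y2 x3 y3.

Lemma addP P Q : add_spec P Q.
Proof.
have [/ec_zeroP|nP] := boolP (val P == None); first exact: AddLeft0.
have [/ec_zeroP|nQ] := boolP (val Q == None); first exact: AddRight0.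
have [PQ0|nPQ] := eqVneq (P + Q) 0.
  by apply: AddOpp; apply/eqP; rewrite -addr_eq0 PQ0.
have onP : oncurve f (val P) := ec_on P; have onQ : oncurve f (val Q) := ec_on Q.
have {}nPQ : val (P + Q) <> None by move=> /eqP/ec_zeroP/eqP; apply/negP.
move: nP nQ nPQ onP onQ; rewrite ec_val_add.
case vP : (val P) => [[x1 y1]|] //; case vQ : (val Q) => [[x2 y2]|] // _ _ nPQ on1 on2.
have [|x3 [y3 [lam [mu [e col]]]]] := padd_collinear on1 on2.
  by [].
by apply: (AddChord vP vQ _ col); rewrite ec_val_add vP vQ.
Qed.


Lemma collinear_x0 lam mu y1 x2 y2 x3 y3 :
  collinear lam mu 0 y1 x2 y2 x3 y3 -> mu = 0 /\ b = a * (x2 * x3).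
Proof.
move=> [_ bE mu2 _]; have mu0 : mu = 0.
  by apply/eqP; rewrite -sqrf_eq0 mu2 !mul0r mulr0.
by split=> //; rewrite [LHS]bE mu0; ring.
Qed.

(** (a x, a y) lies on the monic model Y^2 = X^3 + a b X, and X is the usual descent map there;
    (0,0) gets the value a b that makes the map multiplicative modulo squares. *)
Definition descent_map P : F :=
  if val P is Some (x, _) then if x == 0 then a * b else a * x else 1.

Lemma descent_map_neq0 P : descent_map P != 0.
Proof.
rewrite /descent_map; case: (val P) => [[x y]|]; last exact: oner_neq0.
by case: ifPn => [_|x0]; rewrite mulf_neq0.
Qed.

Lemma descent_mapN P : descent_map (- P) = descent_map P.
Proof. by rewrite /descent_map ec_val_opp; case: (val P) => [[x y]|]. Qed.

(** For collinear points the product of the a x_i is (a mu)^2. If one abscissa is 0, the other two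
    multiply to b / a, and the product of the three values is (a b)^2. *)
Lemma descent_mapD P Q :
  exists2 z, z != 0 & descent_map (P + Q) * (descent_map P * descent_map Q) = z ^+ 2.
Proof.
have [->|->|->|x1 y1 x2 y2 x3 y3 lam mu vP vQ vPQ col] := addP P Q.
- by exists (descent_map Q);
  rewrite ?descent_map_neq0 // add0r mulrCA [X in X * _]/descent_map mul1r expr2.
- by exists (descent_map P);
  rewrite ?descent_map_neq0 // addr0 mulrA [X in _ * X]/descent_map mulr1 expr2.
- by exists (descent_map Q);
  rewrite ?descent_map_neq0 // addNr descent_mapN [X in X * _]/descent_map mul1r expr2.
rewrite /descent_map vP vQ vPQ.
have pair x x' : b = a * (x * x') -> x != 0 /\ x' != 0.
  by move=> bE; have := b0; rewrite bE mulf_eq0 negb_or => /andP[_];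
    rewrite mulf_eq0 negb_or => /andP[].
have [x10|x10] := eqVneq x1 0.
  move: col; rewrite x10 => /collinear_x0 [_ bE]; have [x20 x30] := pair _ _ bE.
  rewrite (negPf x20) (negPf x30); exists (a * b); first by rewrite mulf_neq0.
  by rewrite [in RHS]bE; rewrite [in LHS]bE; ring.
have [x20|x20] := eqVneq x2 0.
  move: col => /collinear_cycle; rewrite x20 => /collinear_x0 [_ bE]; have [x30 _] := pair _ _ bE.
  rewrite (negPf x30); exists (a * b); first by rewrite mulf_neq0.
  by rewrite [in RHS]bE; rewrite [in LHS]bE; ring.
have [x30|x30] := eqVneq x3 0.
  move: col => /collinear_cycle/collinear_cycle; rewrite x30 => /collinear_x0 [_ bE].
  exists (a * b); first by rewrite mulf_neq0.
  by rewrite [in RHS]bE; rewrite [in LHS]bE; ring.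
have [_ _ mu2 _] := col.
exists (a * mu); last by rewrite exprMn mu2; ring.
by rewrite mulf_neq0 // -sqrf_eq0 mu2 !mulf_neq0.
Qed.

End TwoTorsionCurve.

(** * The 2-isogeny and its dual *)

Lemma isogeny_on (F : fieldType) (a b s x y : F) : a != 0 -> x != 0 ->
  y ^+ 2 = a * x ^+ 3 + b * x ->
  (s ^+ 3 * (y * (x ^+ 2 - b / a) / x ^+ 2)) ^+ 2 =
  a * (s ^+ 2 * (y ^+ 2 / (a * x ^+ 2))) ^+ 3
    + (- 4 * b * s ^+ 4) * (s ^+ 2 * (y ^+ 2 / (a * x ^+ 2))).
Proof.
move=> a0 x0 on; have -> : b = y ^+ 2 / x - a * x ^+ 2 by rewrite on; field.
by field; rewrite a0 x0.
Qed.

(* With u_i = 1 / x_i and v_i = y_i / x_i = lam + mu u_i, the image of the point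
   (x_i, y_i) has abscissa s^2 v_i^2 / a; all symmetric functions of the v_i are
   expressed through lam, mu, a, b. *)
Lemma isogeny_collinear (F : fieldType) (a b s lam mu x1 y1 x2 y2 x3 y3 : F)
    (X := fun x y => s ^+ 2 * (y ^+ 2 / (a * x ^+ 2)))
    (Y := fun x y => s ^+ 3 * (y * (x ^+ 2 - b / a) / x ^+ 2)) :
  a != 0 -> x1 != 0 -> x2 != 0 -> x3 != 0 ->
  y1 ^+ 2 = a * x1 ^+ 3 + b * x1 -> y2 ^+ 2 = a * x2 ^+ 3 + b * x2 ->
  y3 ^+ 2 = a * x3 ^+ 3 + b * x3 ->
  collinear a b lam mu x1 y1 x2 y2 x3 y3 ->
  collinear a (- 4 * b * s ^+ 4) (s * (lam - b / mu)) (s ^+ 3 * (mu + b * lam ^+ 2 / (a * mu)))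
    (X x1 y1) (Y x1 y1) (X x2 y2) (Y x2 y2) (X x3 y3) (Y x3 y3).
Proof.
move=> a0 x10 x20 x30 on1 on2 on3 [e1 e2 e3 [y1E y2E y3E]].
have mu0 : mu != 0 by rewrite -sqrf_eq0 e3 !mulf_neq0.
pose v x := lam + mu / x.
have xxx : x1 * x2 * x3 = mu ^+ 2 / a by rewrite e3; field.
have U1 : x1^-1 + x2^-1 + x3^-1 = (b - 2 * (lam * mu)) / mu ^+ 2.
  by rewrite [in RHS]e2 e3; field; rewrite ?a0 ?x10 ?x20 ?x30 ?mu0.
have U2 : (x1 * x2)^-1 + (x1 * x3)^-1 + (x2 * x3)^-1 = lam ^+ 2 / mu ^+ 2.
  by rewrite e1 e3; field; rewrite ?a0 ?x10 ?x20 ?x30 ?mu0.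
have U3 : (x1 * x2 * x3)^-1 = a / mu ^+ 2 by rewrite xxx invf_div.
pose s1 := v x1 + v x2 + v x3.
pose s2 := v x1 * v x2 + v x1 * v x3 + v x2 * v x3.
pose s3 := v x1 * v x2 * v x3.
have s1E : s1 = lam + b / mu.
  transitivity (3 * lam + mu * (x1^-1 + x2^-1 + x3^-1)); first by rewrite /s1 /v; ring.
  by rewrite U1; field.
have s2E : s2 = 2 * lam * b / mu.
  transitivity (3 * lam ^+ 2 + 2 * lam * mu * (x1^-1 + x2^-1 + x3^-1)
     + mu ^+ 2 * ((x1 * x2)^-1 + (x1 * x3)^-1 + (x2 * x3)^-1)).
    by rewrite /s2 /v !invfM; ring.
  by rewrite U1 U2; field.
have s3E : s3 = lam ^+ 2 * b / mu + a * mu.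
  transitivity (lam ^+ 3 + lam ^+ 2 * mu * (x1^-1 + x2^-1 + x3^-1)
     + lam * mu ^+ 2 * ((x1 * x2)^-1 + (x1 * x3)^-1 + (x2 * x3)^-1)
     + mu ^+ 3 * (x1 * x2 * x3)^-1).
    by rewrite /s3 /v !invfM; ring.
  by rewrite U1 U2 U3; field.
have XE x y : x != 0 -> y = lam * x + mu -> X x y = s ^+ 2 * v x ^+ 2 / a.
  by move=> x0 ->; rewrite /X /v; field; rewrite ?a0 ?mu0 ?x0.
have YE x y : x != 0 -> y = lam * x + mu -> y ^+ 2 = a * x ^+ 3 + b * x ->
    Y x y = s * (lam - b / mu) * X x y + s ^+ 3 * (mu + b * lam ^+ 2 / (a * mu)).
  move=> x0 yE on; rewrite (XE _ _ x0 yE) /Y yE /v.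
  have -> : b = (lam * x + mu) ^+ 2 / x - a * x ^+ 2 by rewrite -yE on; field.
  by field; rewrite ?a0 ?mu0 ?x0.
split; last by split; apply: YE.
- rewrite !XE //; transitivity (s ^+ 2 * (s1 ^+ 2 - 2 * s2)); last by rewrite /s1 /s2; field.
  by rewrite s1E s2E; field.
- rewrite !XE //; transitivity (2 * (s * (lam - b / mu) * (s ^+ 3 * (mu + b * lam ^+ 2 / (a * mu))))
    + s ^+ 4 / a * (s2 ^+ 2 - 2 * s1 * s3)); last by rewrite /s1 /s2 /s3; field;
      rewrite ?a0 ?mu0 ?x0.
  by rewrite s1E s2E s3E; field; rewrite ?a0 ?mu0 ?x0.
- rewrite !XE //; transitivity ((s ^+ 3 * s3 / a) ^+ 2); last by rewrite /s3; field.
  by rewrite s3E; field; rewrite ?a0 ?mu0 ?x0.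
Qed.

Section Isogeny.
Variables (F : fieldType) (E E' : cubic_curve F) (a b b' s : F).
Hypothesis fE : cc_poly E = a *: 'X^3 + b *: 'X.
Hypothesis fE' : cc_poly E' = a *: 'X^3 + b' *: 'X.
Hypothesis b'E : b' = - 4 * b * s ^+ 4.
Let a0 : a != 0 := cubic_lead_neq0 fE.
Let b0 : b != 0 := cubic_lin_neq0 fE.

Lemma isogeny_scale_neq0 : s != 0.
Proof.
have := cubic_lin_neq0 fE'; rewrite b'E mulf_eq0 negb_or => /andP[_].
by rewrite expf_eq0.
Qed.

(** The quotient by {0, (0,0)}, followed by the scaling (s^2, s^3). The scale lets one construction
    serve both directions: s = 1 leads from b to -4 b, and s = 1/2 leads back. *)
Definition isogeny_coord (p : option (F * F)) : option (F * F) :=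
  if p is Some (x, y) then
    if x == 0 then None
    else Some (s ^+ 2 * (y ^+ 2 / (a * x ^+ 2)), s ^+ 3 * (y * (x ^+ 2 - b / a) / x ^+ 2))
  else None.

Lemma isogeny_coord_on p : oncurve (cc_poly E) p -> oncurve (cc_poly E') (isogeny_coord p).
Proof.
case: p => [[x y]|] //= /eqP on; case: ifPn => //= x0.
by rewrite (cubic_at fE') b'E isogeny_on // on (cubic_at fE).
Qed.

Definition isogeny (P : ec_point E) : ec_point E' := EcPoint (isogeny_coord_on (ec_on P)).

Lemma isogenyN P : isogeny (- P) = - isogeny P.
Proof.
apply: val_inj; rewrite ec_val_opp /= -/(val P); case: (val P) => [[x y]|] //=.
by case: ifP => //= _; rewrite sqrrN !mulNr mulrN.
Qed.

(** Adding the kernel point does not change the image: on a line through (0,0) both points have y /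
    x = lam, hence the same image abscissa, and x2 x3 = b / a turns the ordinates into lam (x2 - x3)
    and lam (x3 - x2), up to the common scale. *)
Let isogeny_line0 x2 y2 x3 y3 lam mu y1 :
  collinear a b lam mu 0 y1 x2 y2 x3 y3 ->
  isogeny_coord (Some (x3, y3)) = popp (isogeny_coord (Some (x2, y2))).
Proof.
move=> col; have [mu0 bE] := collinear_x0 col.
case: col => _ _ _ [_ y2E y3E]; rewrite y2E y3E mu0 !addr0.
have := b0; rewrite bE mulf_eq0 negb_or => /andP[_]; rewrite mulf_eq0 negb_or => /andP[x20 x30].
rewrite /= (negPf x20) (negPf x30) /=; congr (Some (_, _)); first by field; rewrite a0 x30 x20.
by rewrite bE; field; rewrite ?a0 ?x30 ?x20.
Qed.

(** Collinear triples go to collinear triples, which is additivity; triples through the kernel point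
    (0,0) are treated apart. *)
Lemma isogenyD : {morph isogeny : P Q / P + Q}.
Proof.
move=> P Q; have [->|->|->|x1 y1 x2 y2 x3 y3 lam mu vP vQ vPQ col] := addP fE P Q.
- by rewrite add0r; apply: val_inj.
- by rewrite addr0; apply: val_inj; rewrite ec_val_add /=; case: isogeny_coord => [[? ?]|].
- by rewrite addNr isogenyN addNr; apply: val_inj.
have valE R : val (isogeny R) = isogeny_coord (val R) by [].
apply: val_inj; rewrite ec_val_add !valE vP vQ.
have -> : isogeny_coord (val (P + Q)) = popp (isogeny_coord (Some (x3, y3))).
  rewrite vPQ /=; case: ifP => //= _; rewrite sqrrN !mulNr mulrN //.
have on1 := ec_on P; have on2 := ec_on Q; have on3 := ec_on (- (P + Q)).
rewrite -!/(val _) ec_val_opp vP vQ vPQ /= opprK in on1 on2 on3.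
have [x10|x10] := eqVneq x1 0.
  have col' := col; rewrite x10 in col'.
  by rewrite (isogeny_line0 col') poppK x10 [isogeny_coord (Some (0, _))]/= eqxx.
have [x20|x20] := eqVneq x2 0.
  have col' := collinear_cycle col; rewrite x20 in col'.
  rewrite -(isogeny_line0 col') x20 [isogeny_coord (Some (0, _))]/= eqxx.
  by case: (isogeny_coord (Some (x1, y1))) => [[u w]|].
have [x30|x30] := eqVneq x3 0.
  have col' := collinear_cycle (collinear_cycle col); rewrite x30 in col'.
  rewrite (isogeny_line0 col') x30 [isogeny_coord (Some (0, _))]/= eqxx.
  by case: (isogeny_coord (Some (x1, y1))) => [[u w]|] //=; rewrite opprK !eqxx.
apply/esym; rewrite /= (negPf x10) (negPf x20) (negPf x30) /=.
move/eqP: on1 => on1; move/eqP: on2 => on2; move/eqP: on3 => on3;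
  rewrite !(cubic_at fE) in on1 on2 on3.
apply: (collinear_padd fE'); last by rewrite b'E; apply: isogeny_collinear col.
by rewrite /= (cubic_at fE') b'E isogeny_on.
Qed.

Lemma isogenyB : {morph isogeny : P Q / P - Q}.
Proof. by move=> P Q; rewrite isogenyD isogenyN. Qed.

Lemma isogeny_val0 P y : val P = Some (0, y) -> isogeny P = 0.
Proof. by move=> vP; apply: val_inj; rewrite /= -/(val P) vP /= eqxx. Qed.

(** A nonsquare a b' keeps (0,0) out of the trivial class, so a point Q of trivial class is either 0
    or has a nonzero abscissa, and then the isogeny can be inverted. *)
Lemma isogeny_surj (Q : ec_point E') z : ~ (exists z, a * b' = z ^+ 2) ->
  descent_map a b' Q = z ^+ 2 -> exists P, Q = isogeny P.
Proof.
move=> ab'; rewrite /descent_map; case vQ: (val Q) => [[x y]|]; last first.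
  by exists 0; apply: val_inj.
case: ifPn => [_ abz|x0 axz]; first by case: ab'; exists z.
have s0 := isogeny_scale_neq0.
have z0 : z != 0 by rewrite -sqrf_eq0 -axz mulf_neq0.
have on : y ^+ 2 = a * x ^+ 3 + b' * x.
  by have := ec_on Q; rewrite -/(val Q) vQ /= (cubic_at fE') => /eqP.
have xE : x = z ^+ 2 / a by rewrite -axz; field.
(* Equal abscissas force y' / x' = z / s. The curve equation and the ordinate then give x' + (b/a) /
   x' = x / s^2 and x' - (b/a) / x' = y / (s^2 z); half the sum is x'. *)
pose x' := (x + y / z) / (2 * s ^+ 2); pose y' := x' * (z / s).
have two : (2 : F) != 0 := cc_char2 E.
have four : (-4 : F) != 0 by rewrite (_ : -4 = - (2 * 2)) ?oppr_eq0 ?mulf_neq0 //; ring.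
have bE : b = (y ^+ 2 / z ^+ 2 - x ^+ 2) * a / (- 4 * s ^+ 4).
  by rewrite on b'E -axz; field; rewrite ?a0 ?x0 ?s0 four.
have x'0 : x' != 0.
  have : b != 0 := b0; apply: contraNneq => /eqP;
    rewrite mulf_eq0 invr_eq0 mulf_eq0 (negPf two) expf_eq0 (negPf s0) !orbF /= => /eqP xyz.
  have -> : b = (x + y / z) * ((y / z - x) * a / (- 4 * s ^+ 4)) by rewrite bE; field;
    rewrite ?s0 ?z0 four.
  by rewrite xyz mul0r.
have on' : oncurve (cc_poly E) (Some (x', y')).
  rewrite /= (cubic_at fE) bE /y' /x' xE; apply/eqP; field.
  by rewrite ?a0 ?s0 ?z0 two four.
exists (EcPoint on'); apply: val_inj; rewrite vQ /= (negPf x'0); congr (Some (_, _)).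
  by rewrite xE /y'; field; rewrite ?a0 ?x'0 ?s0.
have ba : b / a = x' * ((x - y / z) / (2 * s ^+ 2)).
  by rewrite bE /x'; field; rewrite ?a0 ?s0 ?z0 two four.
rewrite /y' ba; transitivity (s ^+ 3 * (z / s) * (x' - (x - y / z) / (2 * s ^+ 2))).
  by rewrite /x'; field; rewrite ?z0 ?s0 two.
move: x' x'0 {y' on' ba} => x' x'0; field.
by rewrite ?x'0 ?s0 ?z0 two.
Qed.

End Isogeny.

Lemma double_abscissa (F : fieldType) (a b s x y : F)
    (X := s ^+ 2 * (y ^+ 2 / (a * x ^+ 2)))
    (Y := s ^+ 3 * (y * (x ^+ 2 - b / a) / x ^+ 2))
    (m := (3 * a * x ^+ 2 + b) / (2 * y)) (x2 := m ^+ 2 / a - x - x) :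
  (2 : F) != 0 -> s != 0 -> a != 0 -> x != 0 -> y != 0 ->
  y ^+ 2 = a * x ^+ 3 + b * x ->
  x2 = (2 * s)^-1 ^+ 2 * (Y ^+ 2 / (a * X ^+ 2)) /\
  - (y + m * (x2 - x)) = (2 * s)^-1 ^+ 3 * (Y * (X ^+ 2 - - 4 * b * s ^+ 4 / a) / X ^+ 2).
Proof.
move=> two s0 a0 x0 y0 on.
have bE : b = y ^+ 2 / x - a * x ^+ 2 by rewrite on; field.
rewrite /x2 /m /X /Y bE; split; field; rewrite ?two ?s0 ?a0 ?x0 ?y0 //.
Qed.

Section DualIsogeny.
Variables (F : fieldType) (E E' : cubic_curve F) (a b b' s s' : F).
Hypothesis fE : cc_poly E = a *: 'X^3 + b *: 'X.
Hypothesis fE' : cc_poly E' = a *: 'X^3 + b' *: 'X.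
Hypothesis b'E : b' = - 4 * b * s ^+ 4.
Hypothesis bE : b = - 4 * b' * s' ^+ 4.
Hypothesis ss' : 2 * (s * s') = 1.

(** The relation 2 s s' = 1 settles a sign: replacing s' by its opposite respects the equation for b
    but yields -2P. *)
Lemma isogeny_dual (P : ec_point E) :
  isogeny fE' fE bE (isogeny fE fE' b'E P) = P *+ 2.
Proof.
have two := cc_char2 E; have s0 := isogeny_scale_neq0 fE' b'E.
have a0 := cubic_lead_neq0 fE.
have s'E : s' = (2 * s)^-1.
  by apply: (mulfI (mulf_neq0 two s0)); rewrite -mulrA ss' divff // mulf_neq0.
apply: val_inj; rewrite mulr2n ec_val_add /= -/(val P).
have := ec_on P; rewrite -/(val P); case: (val P) => [[x y]|] //=.
rewrite (cubic_at fE) => /eqP on; have [x0|x0] := eqVneq x 0.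
  have y0 : y = 0 by apply/eqP; rewrite -sqrf_eq0 on x0; apply/eqP; ring.
  by rewrite x0 y0 oppr0 /= !eqxx.
have [y0|y0] := eqVneq y 0.
  by rewrite y0 oppr0 !eqxx /= expr0n !mul0r mulr0 eqxx.
have -> : (y == - y) = false.
  by rewrite -subr_eq0 opprK -mulr2n -mulr_natl mulf_eq0 (negPf two) (negPf y0).
have X0 : s ^+ 2 * (y ^+ 2 / (a * x ^+ 2)) != 0.
  by rewrite mulf_neq0 ?expf_neq0 // mulf_neq0 ?expf_neq0 // invr_neq0 // mulf_neq0 // expf_neq0.
rewrite eqxx /= (negPf X0).
rewrite (cubic_coef3 fE) (cubic_coef2 fE) subr0 /slope eqxx (cubic_deriv_at fE).
have [xE yE] := double_abscissa two s0 a0 x0 y0 on.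
by rewrite -b'E -s'E in xE yE; rewrite -xE -yE.
Qed.

End DualIsogeny.

Section Origin.
Variables (F : fieldType) (E : cubic_curve F) (a b : F).
Hypothesis fE : cc_poly E = a *: 'X^3 + b *: 'X.

Fact origin_on : oncurve (cc_poly E) (Some (0, 0)).
Proof. by rewrite /= (cubic_at fE); apply/eqP; ring. Qed.

Definition origin : ec_point E := EcPoint origin_on.

Lemma origin2 : origin *+ 2 = 0.
Proof. by apply: val_inj; rewrite mulr2n ec_val_add /= eqxx oppr0 eqxx. Qed.

Lemma descent_map_origin : descent_map a b origin = a * b.
Proof. by rewrite /descent_map /= eqxx. Qed.

Lemma oppr_origin : - origin = origin.
Proof. by apply/eqP; rewrite eq_sym -addr_eq0 -mulr2n origin2. Qed.

Definition same_class (P : ec_point E) (d : F) : Prop := exists2 z, z != 0 &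
  descent_map a b P = d * z ^+ 2 \/ descent_map a b P = d * (a * b) * z ^+ 2.

End Origin.

(** The value at v - w is a square or a b' times a square. In the second case v - w + (0,0) has
    square value, and it is this point that comes from the isogeny. *)
Lemma same_class_isogeny (F : fieldType) (E E' : cubic_curve F) (a b b' s : F)
    (fE : cc_poly E = a *: 'X^3 + b *: 'X) (fE' : cc_poly E' = a *: 'X^3 + b' *: 'X)
    (b'E : b' = - 4 * b * s ^+ 4) (v w : ec_point E') d :
  ~ (exists z, a * b' = z ^+ 2) -> same_class a b' v d -> same_class a b' w d ->
  exists u, v - w = isogeny fE fE' b'E u \/ v - w = isogeny fE fE' b'E u + origin fE'.
Proof.
move=> nsq [z1 z10 vd] [z2 z20 wd].
have B0 : a * b' != 0 by rewrite mulf_neq0 ?(cubic_lead_neq0 fE') ?(cubic_lin_neq0 fE').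
have d0 : d != 0.
  have := descent_map_neq0 fE' v; case: vd => ->; rewrite -?mulrA mulf_eq0 negb_or => /andP[] //.
have [z z0] := descent_mapD fE' v (- w); rewrite descent_mapN => zE.
have [z' z'0] := descent_mapD fE' (v - w) (origin fE'); rewrite descent_map_origin => z'E.
set B := a * b' in B0 vd wd z'E nsq.
have close s0 : descent_map a b' (v - w) = s0 ^+ 2 ->
    exists u, v - w = isogeny fE fE' b'E u \/ v - w = isogeny fE fE' b'E u + origin fE'.
  by move=> /(isogeny_surj fE fE' b'E nsq) [u uE]; exists u; left.
have close' s0 : s0 != 0 -> descent_map a b' (v - w) * B = s0 ^+ 2 ->
    exists u, v - w = isogeny fE fE' b'E u \/ v - w = isogeny fE fE' b'E u + origin fE'.
  move=> s00 sE; rewrite sE in z'E.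
  have /(isogeny_surj fE fE' b'E nsq) [u uE] : descent_map a b' (v - w + origin fE') = (z' / s0) ^+ 2.
    by rewrite expr_div_n -z'E mulfK // expf_neq0.
  by exists u; right; rewrite -uE -addrA -mulr2n origin2 addr0.
case: vd wd zE => -> [] -> zE.
- apply: (close (z / (d * z1 * z2))).
  by rewrite expr_div_n -zE; field; rewrite ?d0 ?z10 ?z20 ?B0.
- apply: (close' (z / (d * z1 * z2))); first by rewrite !mulf_neq0 ?invr_eq0 ?mulf_neq0.
  by rewrite expr_div_n -zE; field; rewrite ?d0 ?z10 ?z20 ?B0.
- apply: (close' (z / (d * z1 * z2))); first by rewrite !mulf_neq0 ?invr_eq0 ?mulf_neq0.
  by rewrite expr_div_n -zE; field; rewrite ?d0 ?z10 ?z20 ?B0.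
apply: (close (z / (d * z1 * z2 * B))).
by rewrite expr_div_n -zE; field; rewrite ?d0 ?z10 ?z20 ?B0.
Qed.

(** * Heights *)

Definition qheight (x : rat) : nat := maxn `|numq x| `|denq x|.

Lemma qheight_gt0 x : (0 < qheight x)%N.
Proof. by rewrite leq_max [X in _ || X]absz_gt0 denq_neq0 orbT. Qed.

Lemma num_le_qheight x : `|numq x| <= qheight x :> int.
Proof. by rewrite -abszE lez_nat leq_maxl. Qed.

Lemma den_le_qheight x : `|denq x| <= qheight x :> int.
Proof. by rewrite -abszE lez_nat leq_maxr. Qed.

Lemma frac_lowest (x : rat) (u w : int) : w != 0 -> x * w%:~R = u%:~R ->
  exists k, u = numq x * k /\ w = denq x * k.
Proof.
move=> w0 xw.
have e : numq x * w = u * denq x.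
  by apply: (@intr_inj rat); rewrite !intrM numqE -xw; ring.
have : (denq x %| w)%Z.
  rewrite -(@Gauss_dvdzr _ (numq x)) ?e ?dvdz_mull //.
  by rewrite coprimezE coprime_sym coprime_num_den.
move=> /dvdzP [k wE]; exists k; split; last by rewrite wE mulrC.
by apply: (mulIf (denq_neq0 x)); rewrite -e wE; ring.
Qed.

Lemma rat_sqr_int (y : rat) (M : int) : y ^+ 2 = M%:~R -> exists N : int, y = N%:~R.
Proof.
move=> yM; exists (numq y).
have e : numq y * numq y = M * denq y * denq y.
  by apply: (@intr_inj rat); rewrite !intrM numqE -yM; ring.
have cop : coprimez (denq y) (numq y) by rewrite coprimezE coprime_sym coprime_num_den.
have : (denq y %| numq y * 1)%Z.
  by rewrite mulr1 -(Gauss_dvdzr _ cop) e dvdz_mull.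
rewrite (Gauss_dvdzr _ cop) dvdz1 => /eqP d1.
by rewrite -[LHS]divq_num_den -(gez0_abs (ltW (denq_gt0 y))) d1 divr1.
Qed.

Lemma qheight_frac (x : rat) (u w : int) : w != 0 -> x * w%:~R = u%:~R ->
  (qheight x <= maxn `|u| `|w|)%N.
Proof.
move=> w0 /(frac_lowest w0) [k [uE wE]].
have k0 : (0 < `|k|)%N by rewrite absz_gt0; apply: contraNneq w0 => k0; rewrite wE k0 mulr0.
by rewrite uE wE !abszM -maxnMl /qheight leq_pmulr.
Qed.

(** R and S are the absolute numerator and denominator of x, H the height of x + beta / x, and B =
    |beta|. If R <= S, then S^2 <= H B + R S <= 2 H B; otherwise R^2 <= H B + B R S <= H B + B^2
    H. *)
Lemma max_sqr_bound (R S B H M : int) : 0 <= R -> 0 <= S -> 1 <= B -> 0 <= H ->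
  R * S <= H * B -> R ^+ 2 <= H * B + B * S ^+ 2 -> S ^+ 2 <= H * B + R ^+ 2 ->
  M = Order.max R S -> M ^+ 2 <= (B + 1) * B * H.
Proof.
move=> R0 S0 B1 H0 RS R2 S2 ->; have B0 : 0 <= B by apply: le_trans B1.
have HB0 : 0 <= H * B := mulr_ge0 H0 B0.
case: (leP R S) => cmp.
  have : R * R <= R * S by rewrite ler_wpM2l.
  rewrite (_ : (B + 1) * B * H = H * B + B * (H * B)); last by ring.
  have : H * B <= B * (H * B) by rewrite ler_peMl.
  rewrite expr2 in S2 *; rewrite expr2 in S2; lra.
have : B * (S * S) <= B * (R * S) by rewrite ler_wpM2l // ler_wpM2r // ltW.
have : B * (R * S) <= B * (H * B) by rewrite ler_wpM2l.
rewrite (_ : (B + 1) * B * H = H * B + B * (H * B)); last by ring.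
rewrite !expr2 in R2 *; lra.
Qed.

(** With x = r / s, the new fraction is (r^2 + beta s^2) / (r s), and only a divisor of beta can
    cancel; up to a constant the height is therefore at least squared. *)
Lemma qheight_isogeny (beta : int) : beta != 0 -> exists C, forall x : rat, x != 0 ->
  (qheight x ^ 2 <= C * qheight (x + beta%:~R / x))%N.
Proof.
move=> b0; exists ((`|beta| + 1) * `|beta|)%N => x x0.
set x' := x + _; set r := numq x; set s := denq x.
have s0 : s != 0 := denq_neq0 x.
have r0 : r != 0 by rewrite numq_eq0.
have [k [NE ME]] : exists k, r ^+ 2 + beta * s ^+ 2 = numq x' * k /\ r * s = denq x' * k.
  apply: frac_lowest; first by rewrite mulf_neq0.
  rewrite intrD !intrM /r numqE; rewrite /x' -/s; field.
  by rewrite x0.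
have [u [v uv]] : exists u v : int, u * r + v * s = 1.
  have [u [v e]] := Bezoutz r s; exists u, v; rewrite e.
  by have := coprime_num_den x; rewrite /coprime => /eqP; rewrite /gcdz => ->.
(* k divides r (r^2 + beta s^2) - beta s (r s) = r^3, also r^2 s and r s^2, and s (r^2 + beta s^2) -
   r (r s) = beta s^3; hence it divides beta (u r + v s)^3 = beta. *)
have kb : (k %| beta)%Z.
  apply/dvdzP; exists (u ^+ 3 * beta * (r * numq x' - beta * s * denq x')
    + 3 * u ^+ 2 * v * beta * r * denq x' + 3 * u * v ^+ 2 * beta * s * denq x'
    + v ^+ 3 * (s * numq x' - r * denq x')).
  transitivity (beta * (u * r + v * s) ^+ 3); first by rewrite uv; ring.
  transitivity (u ^+ 3 * beta * (r * (numq x' * k) - beta * s * (denq x' * k))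
    + 3 * u ^+ 2 * v * beta * r * (denq x' * k) + 3 * u * v ^+ 2 * beta * s * (denq x' * k)
    + v ^+ 3 * (s * (numq x' * k) - r * (denq x' * k))); last by ring.
  by rewrite -NE -ME; ring.
have kle : `|k| <= `|beta|.
  by have := dvdn_leq _ kb; rewrite absz_gt0 b0 => /(_ isT); lia.
have n1 := num_le_qheight x'; have d1 := den_le_qheight x'.
set H' := qheight x' in n1 d1 *; set B : int := `|beta| in kle *.
have B1 : 1 <= B by rewrite -gtz0_ge1 normr_gt0.
have M1 : `|r| * `|s| <= H'%:Z * B.
  by rewrite -normrM ME normrM; apply: ler_pM.
have N1 : `|r ^+ 2 + beta * s ^+ 2| <= H'%:Z * B.
  by rewrite NE normrM; apply: ler_pM.
have N2 : `|r| ^+ 2 <= H'%:Z * B + B * `|s| ^+ 2.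
  rewrite -!normrX -normrM (_ : r ^+ 2 = (r ^+ 2 + beta * s ^+ 2) - beta * s ^+ 2); last by ring.
  by apply: le_trans (ler_normB _ _) _; rewrite lerD.
have N3 : `|s| ^+ 2 <= H'%:Z * B + `|r| ^+ 2.
  apply: (@le_trans _ _ (B * `|s| ^+ 2)); first by rewrite ler_peMl ?exprn_ge0.
  rewrite -!normrX -normrM (_ : beta * s ^+ 2 = (r ^+ 2 + beta * s ^+ 2) - r ^+ 2); last by ring.
  by apply: le_trans (ler_normB _ _) _; rewrite lerD.
have /= := max_sqr_bound (normr_ge0 r) (normr_ge0 s) B1 (isT : 0 <= H'%:Z) M1 N2 N3 (erefl _).
have -> : Order.max `|r| `|s| = (qheight x)%:Z.
  rewrite /qheight -/r -/s -!abszE; clear; lia.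
by rewrite -lez_nat -mulnn !PoszM PoszD abszE expr2.
Qed.

Lemma qheight_div (c : nat) (x : rat) : (0 < c)%N ->
  (qheight x <= c * qheight (x / c%:R))%N.
Proof.
move=> c0; set y := x / _.
have cr : (c%:R : rat) != 0 by rewrite pnatr_eq0 -lt0n.
apply: leq_trans (qheight_frac (u := c%:Z * numq y) (w := denq y) (denq_neq0 y) _) _.
  rewrite intrM numqE /y; field; exact: cr.
rewrite abszM /= geq_max leq_mul2l leq_maxl orbT /=.
by apply: leq_trans (leq_maxr _ _) (leq_pmull _ c0).
Qed.

Lemma finite_qheight B : exists s : seq rat, forall x, (qheight x <= B)%N -> x \in s.
Proof.
pose I := [seq (i%:Z - B%:Z)%:~R / j%:R | i <- iota 0 (B + B)%N.+1, j <- iota 0 B.+1] : seq rat.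
exists I => x; rewrite /qheight geq_max => /andP[nB dB].
apply/allpairsP; exists (`|(numq x + B%:Z)%R|%N, `|denq x|%N); split.
- by rewrite mem_iota add0n ltnS [_.1]/=; move: nB; clear; lia.
- by rewrite mem_iota add0n ltnS.
rewrite [_.1]/= [_.2]/=; have -> : `|(numq x + B%:Z)%R|%N%:Z - B%:Z = numq x by lia.
by rewrite -[LHS]divq_num_den -{1}(gez0_abs (ltW (denq_gt0 x))).
Qed.

(** * Heights of points *)

Section PointHeight.
Variables (E : cubic_curve rat) (alpha : int) (beta : int).
Local Notation a := (alpha%:~R : rat).
Local Notation b := (a * beta%:~R : rat).
Hypothesis fE : cc_poly E = a *: 'X^3 + b *: 'X.
Let a0 : a != 0 := cubic_lead_neq0 fE.
Definition pheight (P : ec_point E) : nat :=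
  if val P is Some (x, _) then qheight x else 1.

Lemma pheight_gt0 P : (0 < pheight P)%N.
Proof. by rewrite /pheight; case: (val P) => [[x y]|] //; apply: qheight_gt0. Qed.

Lemma same_abscissa (P Q : ec_point E) x y y' :
  val P = Some (x, y) -> val Q = Some (x, y') -> P = Q \/ P = - Q.
Proof.
move=> vP vQ; have onP := ec_on P; have onQ := ec_on Q.
rewrite -/(val P) vP /= in onP; rewrite -/(val Q) vQ /= -(eqP onP) eqf_sqr in onQ.
case/orP: onQ => /eqP yy; [left|right]; apply: val_inj.
  by rewrite vP vQ yy.
by rewrite ec_val_opp vP vQ /= yy opprK.
Qed.

(** Each of the finitely many abscissas carries at most two points, P0 and -P0. *)
Lemma northcott B : exists s : seq (ec_point E), forall P, (pheight P <= B)%N -> P \in s.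
Proof.
have [sx sxP] := finite_qheight B.
have [s sP] : exists s : seq (ec_point E), forall P x y,
    val P = Some (x, y) -> x \in sx -> P \in s.
  elim: sx {sxP} => [|x0 sx [s sP]]; first by exists [::].
  have [[P0 [y0 vP0]]|nP0] := classic (exists P0 y0, val (P0 : ec_point E) = Some (x0, y0)).
    exists [:: P0, - P0 & s] => P x y vP; rewrite inE => /predU1P[xx|xs].
      by subst x; rewrite !inE; have [->|->] := same_abscissa vP vP0; rewrite eqxx ?orbT.
    by rewrite !inE (sP _ _ _ vP xs) !orbT.
  exists s => P x y vP; rewrite inE => /predU1P[xx|]; last exact: sP vP.
  by case: nP0; exists P, y; rewrite -xx.
exists (0 :: s) => P; rewrite /pheight inE; case vP: (val P) => [[x y]|] hP.
  by rewrite (sP _ _ _ vP) ?orbT // sxP.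
by apply/orP; left; apply/eqP/val_inj.
Qed.

Let K : int := `|alpha| * (1 + `|beta|).

Let alpha_neq0 : alpha != 0.
Proof. by rewrite -(intr_eq0 rat). Qed.

Let alpha_ge1 : 1 <= `|alpha|.
Proof. by rewrite -gtz0_ge1 normr_gt0. Qed.

Let K_ge1 : 1 <= K.
Proof. by rewrite mulr_ege1 // lerDl. Qed.

Let alpha_leK : `|alpha| <= K.
Proof. by rewrite ler_peMr // lerDl. Qed.

(** With x = r / s, the square of y s^2 is the integer alpha s r (r^2 + beta s^2), of size at most K
    h^4. So y s^2 is itself an integer, without having to know that s is nearly a square. *)
Lemma ordinate_bound (P : ec_point E) x y : val P = Some (x, y) ->
  exists N : int, y * (denq x)%:~R ^+ 2 = N%:~R /\ `|N| <= K * (qheight x)%:Z ^+ 2.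
Proof.
move=> vP; have := ec_on P; rewrite -/(val P) vP /= (cubic_at fE) => /eqP on.
set r := numq x; set s := denq x; have s0 : s != 0 := denq_neq0 x.
pose M := s * (alpha * r ^+ 3 + alpha * beta * r * s ^+ 2).
have yM : (y * s%:~R ^+ 2) ^+ 2 = M%:~R.
  by rewrite exprMn on /M /r !(intrM, intrD, rmorphXn) /= !numqE -/s; ring.
have [N NE] := rat_sqr_int yM.
exists N; split=> //.
have N2 : N ^+ 2 = M by apply: (@intr_inj rat); rewrite rmorphXn /= -NE.
set h := (qheight x)%:Z.
have hr : `|r| <= h := num_le_qheight x.
have hs : `|s| <= h := den_le_qheight x.
have h1 : 1 <= h by rewrite /h lez_nat qheight_gt0.
have Mh : `|M| <= K * h ^+ 4.
  have -> : M = alpha * ((s * r) * (r ^+ 2 + beta * s ^+ 2)) by rewrite /M; ring.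
  rewrite !normrM; apply: (@le_trans _ _ (`|alpha| * (h * h * (h ^+ 2 + `|beta| * h ^+ 2))));
    last first.
    by rewrite le_eqVlt; apply/orP; left; apply/eqP; rewrite /K; ring.
  have h0 : 0 <= h by apply: le_trans h1.
  apply: ler_wpM2l => //; apply: ler_pM; rewrite ?mulr_ge0 //; first exact: ler_pM.
  apply: le_trans (ler_normD _ _) _; rewrite (normrM beta) !normrX; apply: lerD.
    by rewrite ler_pXn2r.
  by apply: ler_wpM2l => //; rewrite ler_pXn2r.
have : `|N| ^+ 2 <= (K * h ^+ 2) ^+ 2.
  rewrite -normrX N2; apply: le_trans Mh _; rewrite exprMn -exprM.
  apply: ler_wpM2r; first by rewrite exprn_ge0 // (le_trans _ h1).
  by rewrite expr2 ler_peMr // (le_trans _ K_ge1).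
have K0 : 0 <= K by apply: le_trans K_ge1.
by rewrite ler_pXn2r // nnegrE mulr_ge0 // exprn_ge0 // (le_trans _ h1).
Qed.

Let bnd (n : nat) : int := 4 * K ^+ 2 * n%:Z ^+ 2.

Lemma pheight_add Q : exists C, forall P, (pheight (P + Q)%R <= C * pheight P ^ 2)%N.
Proof.
(* The summands cover P = 0, then Q = 0 or P = -Q, then P = Q, and finally the proper chord. *)
pose C := (pheight Q + 1 + pheight (Q + Q)%R + `|bnd (pheight Q)|)%N.
exists C => P.
have step R m : (m <= C)%N -> (m <= C * pheight R ^ 2)%N.
  by move=> /leq_trans; apply; rewrite leq_pmulr // expn_gt0 pheight_gt0.
have [->|->|->|x1 y1 x2 y2 x3 y3 lam mu vP vQ vPQ col] := addP fE P Q.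
- by rewrite add0r; apply: step; rewrite /C; lia.
- rewrite addr0; apply: leq_trans (leq_pmull _ _); last by rewrite /C; lia.
  by rewrite -mulnn leq_pmull ?pheight_gt0.
- by rewrite addNr; apply: step; rewrite /C addn1 addSn.
have [x12|x12] := eqVneq x1 x2.
  have [_ _ _ [y1E y2E _]] := col.
  have -> : P = Q by apply: val_inj; rewrite vP vQ y1E y2E x12.
  by apply: step; rewrite /C; lia.
apply: leq_trans (_ : (`|bnd (pheight Q)| * pheight P ^ 2 <= _)%N); last first.
  by rewrite leq_mul2r /C leq_addl orbT.
have on1 := ec_on P; rewrite -/(val P) vP /= (cubic_at fE) in on1.
have on2 := ec_on Q; rewrite -/(val Q) vQ /= (cubic_at fE) in on2.
have [N1 [N1E N1h]] := ordinate_bound vP.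
have [N2 [N2E N2h]] := ordinate_bound vQ.
rewrite /pheight vP vQ vPQ; set h1 := qheight x1; set h2 := qheight x2.
set r := numq x1; set s := denq x1; set t := numq x2; set u := denq x2.
rewrite -/s in N1E; rewrite -/u in N2E.
pose d := r * u - t * s.
have s0 : s != 0 := denq_neq0 x1.
have u0 : u != 0 := denq_neq0 x2.
have rE : x1 * s%:~R = r%:~R by rewrite /r numqE.
have tE : x2 * u%:~R = t%:~R by rewrite /t numqE.
have dE : (x1 - x2) * (s * u)%:~R = d%:~R.
  by rewrite /d intrB !intrM -rE -tE; ring.
have d0 : d != 0.
  by rewrite -(intr_eq0 rat) -dE mulf_neq0 // ?subr_eq0 // intr_eq0 mulf_neq0.
pose W := alpha * d ^+ 2.
(* In the chord formula the cubes cancel, x1^3 + x2^3 - (x1 + x2)(x1 - x2)^2 = (x1 + x2) x1 x2, so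
   x3 is alpha (x1 + x2)(x1 x2 + beta) - 2 y1 y2 over alpha (x1 - x2)^2. Multiplying both by (s u)^2
   gives integers of degree 2 in the coordinates r, s of P. *)
pose U := alpha * (r * u + t * s) * (r * t + beta * (s * u)) - 2 * N1 * N2.
have x3E : x3 * W%:~R = U%:~R.
  have [e1 _ _ [y1E y2E _]] := col.
  have lamE : lam * (x1 - x2) = y1 - y2 by rewrite y1E y2E; ring.
  have : a * x3 * (x1 - x2) ^+ 2 = y1 ^+ 2 + y2 ^+ 2 - 2 * y1 * y2 - a * (x1 + x2) * (x1 - x2) ^+ 2.
    rewrite (_ : y1 ^+ 2 + _ - _ = (y1 - y2) ^+ 2); last by ring.
    by rewrite -lamE exprMn e1; ring.
  rewrite (eqP on1) (eqP on2) => x3E.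
  have -> : W%:~R = a * (x1 - x2) ^+ 2 * (s * u)%:~R ^+ 2 :> rat.
    by rewrite /W intrM rmorphXn /= -dE; ring.
  rewrite mulrA (_ : x3 * _ = a * x3 * (x1 - x2) ^+ 2); last by ring.
  rewrite x3E /U !(intrB, intrD, intrM) -rE -tE -N1E -N2E; ring.
have W0 : W != 0 by rewrite mulf_neq0 // expf_neq0.
apply: leq_trans (qheight_frac W0 x3E) _.
have hr : `|r| <= h1%:Z := num_le_qheight x1.
have hs : `|s| <= h1%:Z := den_le_qheight x1.
have ht : `|t| <= h2%:Z := num_le_qheight x2.
have hu : `|u| <= h2%:Z := den_le_qheight x2.
have m2 (v w : int) (i j : nat) : `|v| <= i%:Z -> `|w| <= j%:Z -> `|v * w| <= i%:Z * j%:Z.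
  by move=> vi wj; rewrite normrM ler_pM.
have H := mulr_ge0 (isT : 0 <= h1%:Z) (isT : 0 <= h2%:Z).
set h := h1%:Z * h2%:Z in H.
have hru : `|r * u| <= h := m2 _ _ _ _ hr hu.
have hts : `|t * s| <= h by rewrite mulrC; apply: m2.
have hrt : `|r * t| <= h := m2 _ _ _ _ hr ht.
have hsu : `|s * u| <= h := m2 _ _ _ _ hs hu.
have K0 : 0 <= K by apply: le_trans K_ge1.
have Uh : `|U| <= 4 * K ^+ 2 * h ^+ 2.
  apply: le_trans (ler_normB _ _) _.
  have -> : 4 * K ^+ 2 * h ^+ 2 = 2 * (K * h ^+ 2 * K) + 2 * ((K * h1%:Z ^+ 2) * (K * h2%:Z ^+ 2)).
    by rewrite /h; ring.
  apply: lerD.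
    apply: (@le_trans _ _ (2 * (K * h ^+ 2))); last first.
      by rewrite ler_wpM2l // ler_peMr // mulr_ge0 // exprn_ge0.
    have -> : 2 * (K * h ^+ 2) = `|alpha| * (h + h) * (h + `|beta| * h) by rewrite /K; ring.
    rewrite !normrM; apply: ler_pM; rewrite ?mulr_ge0 //.
      by apply: ler_wpM2l => //; apply: le_trans (ler_normD _ _) _; apply: lerD.
    apply: le_trans (ler_normD _ _) _; rewrite (normrM beta); apply: lerD => //.
    exact: ler_wpM2l.
  by rewrite -mulrA normrM; apply: ler_wpM2l => //; rewrite normrM; apply: ler_pM.
have Wh : `|W| <= 4 * K ^+ 2 * h ^+ 2.
  have dh : `|d| <= h + h by apply: le_trans (ler_normB _ _) _; apply: lerD.
  rewrite /W normrM normrX; apply: (@le_trans _ _ (K * (h + h) ^+ 2)).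
    by apply: ler_pM; rewrite ?exprn_ge0 // ler_pXn2r ?nnegrE // addr_ge0.
  rewrite (_ : K * _ = 4 * K * h ^+ 2); last by ring.
  apply: ler_wpM2r; first by rewrite exprn_ge0.
  by rewrite expr2 mulrA ler_peMr // mulr_ge0.
pose B := 4 * K ^+ 2 * h ^+ 2.
have -> : (`|bnd h2| * h1 ^ 2)%N = `|B|%N.
  have -> : B = bnd h2 * h1%:Z ^+ 2 by rewrite /B /bnd /h; ring.
  by rewrite abszM abszX.
have B0 : 0 <= B by rewrite !mulr_ge0 ?exprn_ge0.
by rewrite geq_max -!lez_nat !abszE (ger0_norm B0) Uh.
Qed.

Lemma pheight_sub Q : exists C, forall P, (pheight (P - Q)%R <= C * pheight P ^ 2)%N.
Proof. exact: pheight_add. Qed.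

End PointHeight.

(** Doubling factors through the isogenies, which act on abscissas by x -> x + beta / x and x' ->
    (x' - 4 beta / x') / 4; each step squares the height up to a constant. *)
Lemma pheight_double (E E' : cubic_curve rat) (alpha beta : int) (a := alpha%:~R : rat) :
  cc_poly E = a *: 'X^3 + (a * beta%:~R) *: 'X ->
  cc_poly E' = a *: 'X^3 + (- 4 * (a * beta%:~R)) *: 'X ->
  exists C, forall P : ec_point E, (pheight P ^ 4 <= C * pheight (P *+ 2)%R)%N.
Proof.
move=> fE fE'; have a0 : a != 0 := cubic_lead_neq0 fE.
have := cubic_lin_neq0 fE; rewrite mulf_eq0 negb_or => /andP[_]; rewrite intr_eq0 => beta0.
have [C CP] := qheight_isogeny beta0.
have [C' C'P] : exists C, forall x : rat, x != 0 ->
    (qheight x ^ 2 <= C * qheight (x + (- 4 * beta)%:~R / x)%R)%N.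
  by apply: qheight_isogeny; rewrite mulf_neq0.
have b'E : - 4 * (a * beta%:~R) = - 4 * (a * beta%:~R) * 1 ^+ 4 by rewrite expr1n mulr1.
have bE : a * beta%:~R = - 4 * (- 4 * (a * beta%:~R)) * (2^-1) ^+ 4 by field.
have ss' : 2 * (1 * 2^-1) = 1 :> rat by [].
(* The first 1 serves P = 0 and x = 0, where both heights are 1; C^2 serves x' = 0, where 2P = 0;
   C^2 (4 C') serves the generic case. *)
exists (1 + C ^ 2 * (1 + 4 * C'))%N => P.
rewrite -(isogeny_dual fE fE' b'E bE ss' P) /pheight.
have valE (F : fieldType) (A B : cubic_curve F) u v w s e1 e2 e3 (R : ec_point A) :
  val (@isogeny F A B u v w s e1 e2 e3 R) = isogeny_coord u v s (val R) by [].
rewrite !valE; have : oncurve (cc_poly E) (val P) := ec_on P.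
case: (val P) => [[x y]|] /=; last by rewrite exp1n muln1 leq_addr.
rewrite (cubic_at fE) => /eqP on.
have [->|x0] := eqVneq x 0; first by rewrite exp1n muln1 leq_addr.
have XE c (z w : rat) : z != 0 -> w ^+ 2 = a * z ^+ 3 + a * c * z -> w ^+ 2 / (a * z ^+ 2) = z + c / z.
  by move=> z0 ->; field; rewrite a0 z0.
rewrite expr1n mul1r (XE _ _ _ x0 on); have hx := CP _ x0.
set x' := x + _ in hx *.
have h4 : (qheight x ^ 4 <= C ^ 2 * qheight x' ^ 2)%N.
  by rewrite -[4%N]/(2 * 2)%N expnM -expnMn leq_exp2r.
apply: leq_trans h4 _; rewrite [isogeny_coord _ _ _ _]/=; case: ifPn => [/eqP x'0|x'0].
  rewrite x'0 /= exp1n !muln1; lia.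
have on' : (1 ^+ 3 * (y * (x ^+ 2 - a * beta%:~R / a) / x ^+ 2)) ^+ 2 =
    a * x' ^+ 3 + a * (- 4 * beta)%:~R * x'.
  have := isogeny_on 1 a0 x0 on; rewrite !expr1n !mul1r (XE _ _ _ x0 on) -/x' => ->.
  by rewrite intrM; ring.
rewrite (XE _ _ _ x'0 on').
have hx' := C'P _ x'0; set x'' := x' + _ in hx' *.
have := @qheight_div 4 x'' isT.
have -> : 2^-1 ^+ 2 * x'' = x'' / 4 by field.
move=> h''; apply: leq_trans (_ : (C ^ 2 * (C' * (4 * qheight (x'' / 4%:R))) <= _)%N).
  by rewrite leq_mul2l (leq_trans hx') ?orbT // leq_mul2l h'' orbT.
have -> (c c' q : nat) : (c * (c' * (4 * q)) = c * (4 * c') * q)%N by ring.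
by rewrite leq_mul2r mulnDr addnA leq_addl orbT.
Qed.

(** * The quartic torsors n^2 = d m^4 + c e^4 *)

(* The identity u d m + v e = 1 records that d m and e are coprime. *)
Definition torsor (d c : int) : Prop := exists m n e u v : int,
  u * (d * m) + v * e = 1 /\ n ^+ 2 = d * m ^+ 4 + c * e ^+ 4.

Lemma torsor1 c : torsor 1 c.
Proof. by exists 1, 1, 0, 1, 0; split; ring. Qed.

Lemma sqr_mod8 (n : int) : (exists k, n = 2 * k) \/
  (exists k, n ^+ 2 = 8 * k + 1 /\ n ^+ 4 = 16 * (4 * k ^+ 2 + k) + 1).
Proof.
have [k [kE|kE]] : exists k, n = 2 * k \/ n = 2 * k + 1.
  by exists (n %/ 2)%Z; lia.
  by left; exists k.
right; have [l [lE|lE]] : exists l, k = 2 * l \/ k = 2 * l + 1.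
  by exists (k %/ 2)%Z; lia.
  by exists (l * (2 * l + 1)); rewrite kE lE; split; ring.
by exists ((2 * l + 1) * (l + 1)); rewrite kE lE; split; ring.
Qed.

Lemma torsor_mod8 (d c kd kc : int) : d = 2 * kd + 1 -> c = 2 * kc + 1 ->
  torsor d (8 * c) -> exists k, d = 8 * k + 1.
Proof.
move=> dE cE [m [n [e [u [v [cop eqn]]]]]].
have [[k mE]|[k [_ m4]]] := sqr_mod8 m; have [[l nE]|[l [n2 _]]] := sqr_mod8 n.
- have [[h eE]|[h [_ e4]]] := sqr_mod8 e.
    have : u * (d * m) + v * e = 2 * (u * d * k + v * h) by rewrite mE eE; ring.
    by rewrite cop; lia.
  have {}eqn : l ^+ 2 = 4 * (d * k ^+ 4 + c * (8 * (4 * h ^+ 2 + h)) + kc) + 2.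
    have : 4 * l ^+ 2 = 16 * d * k ^+ 4 + 8 * c * (16 * (4 * h ^+ 2 + h) + 1).
      transitivity (n ^+ 2); first by rewrite nE; ring.
      by rewrite -e4 eqn mE; ring.
    by rewrite cE; clear; lia.
  have [[j lE]|[j [l2 _]]] := sqr_mod8 l; last by move: eqn; rewrite l2; lia.
  by move: eqn; rewrite lE exprMn; clear; lia.
- by move: eqn; rewrite n2 mE exprMn; lia.
- by move: eqn; rewrite m4 nE exprMn dE; lia.
by exists (l - 2 * d * (4 * k ^+ 2 + k) - c * e ^+ 4); move: eqn; rewrite m4 n2; clear; lia.
Qed.

(** Here c = d modulo 8, because d^2 = 1. An even m would make n even and e odd, and then 4 would
    divide 2 c e^4. So m and n are odd; an even e gives d = 1, and an odd e gives d + 2 c = 3 d = 1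
    modulo 8. *)
Lemma torsor_mod8_13 (d c kd k : int) : d = 2 * kd + 1 -> d * c = 8 * k + 1 ->
  torsor d (2 * c) -> exists k, d = 8 * k + 1 \/ d = 8 * k + 3.
Proof.
move=> dE dcE [m [n [e [u [v [cop eqn]]]]]].
have [g d2] : exists g, d ^+ 2 = 8 * g + 1.
  by have [[g gE]|[g [gE _]]] := sqr_mod8 d; [lia|exists g].
have cE : c = d + 8 * (d * k - c * g).
  have : c * d ^+ 2 = d * (8 * k + 1) by rewrite -dcE; ring.
  by rewrite d2; lia.
have [[h mE]|[h [_ m4]]] := sqr_mod8 m; have [[l nE]|[l [n2 _]]] := sqr_mod8 n.
- have [[j eE]|[j [_ e4]]] := sqr_mod8 e.
    have : u * (d * m) + v * e = 2 * (u * d * h + v * j) by rewrite mE eE; ring.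
    by rewrite cop; lia.
  by move: eqn; rewrite mE nE e4 !exprMn cE dE; lia.
- by move: eqn; rewrite n2 mE exprMn; lia.
- by move: eqn; rewrite m4 nE exprMn dE; lia.
have [[j eE]|[j [_ e4]]] := sqr_mod8 e.
  exists (l - 2 * d * (4 * h ^+ 2 + h) - 4 * c * j ^+ 4); left.
  by move: eqn; rewrite m4 n2 eE exprMn; lia.
have [i dc3] : exists i, 3 * d = 8 * i + 1.
  exists (l - 2 * d * (4 * h ^+ 2 + h) - 4 * c * (4 * j ^+ 2 + j) - 2 * (d * k - c * g)).
  by move: eqn cE; rewrite m4 n2 e4; clear; lra.
by exists (d %/ 8)%Z; right; move: dc3; clear; lia.
Qed.

Lemma sqr_mod3 (n : int) : (exists k, n = 3 * k) \/
  (exists k l, n ^+ 2 = 3 * k + 1 /\ n ^+ 4 = 3 * l + 1).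
Proof.
have [k] : exists k, n = 3 * k \/ n = 3 * k + 1 \/ n = 3 * k + 2.
  by exists (n %/ 3)%Z; lia.
case=> [kE|nE]; first by left; exists k.
right; have [h n2] : exists h, n ^+ 2 = 3 * h + 1.
  case: nE => ->; [exists (3 * k ^+ 2 + 2 * k)|exists (3 * k ^+ 2 + 4 * k + 1)]; ring.
exists h, (3 * h ^+ 2 + 2 * h); split=> //.
by rewrite (exprM n 2 2) n2; ring.
Qed.

(** If 3 does not divide m, then d is a nonzero square modulo 3. Otherwise 3 divides n, and dividing
    by 9 shows the same for c, hence for d. *)
Lemma torsor_mod3 (d c k : int) : d * c = 3 * k + 1 ->
  torsor d (9 * c) -> exists k, d = 3 * k + 1.
Proof.
move=> dcE [m [n [e [u [v [cop eqn]]]]]].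
have [[h mE]|[h [h' [m2 m4]]]] := sqr_mod3 m; have [[l nE]|[l [l' [n2 n4]]]] := sqr_mod3 n.
- have [[j eE]|[j [j' [e2 e4]]]] := sqr_mod3 e.
    have : u * (d * m) + v * e = 3 * (u * d * h + v * j) by rewrite mE eE; ring.
    by rewrite cop; lia.
  have {}eqn : l ^+ 2 = 9 * (d * h ^+ 4) + c * (3 * j' + 1).
    have : 9 * l ^+ 2 = 81 * (d * h ^+ 4) + 9 * c * (3 * j' + 1).
      transitivity (n ^+ 2); first by rewrite nE; ring.
      by rewrite -e4 eqn mE; ring.
    by clear; lra.
  have [[i lE]|[i [i' [l2 l4]]]] := sqr_mod3 l.
    have : d * l ^+ 2 = 9 * (d ^+ 2 * h ^+ 4) + d * c * (3 * j' + 1) by rewrite eqn; ring.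
    by rewrite lE dcE exprMn; clear; lia.
  exists (d * c * j' + k - d * i + 3 * d ^+ 2 * h ^+ 4).
  have : d * l ^+ 2 = 9 * (d ^+ 2 * h ^+ 4) + d * c * (3 * j' + 1) by rewrite eqn; ring.
  by rewrite l2 mulrDr dcE; clear; lra.
- by move: eqn; rewrite n2 mE exprMn; lia.
- have dE : d = 3 * (3 * l ^+ 2 - d * h' - 3 * c * e ^+ 4).
    by move: eqn; rewrite m4 nE exprMn; lia.
  by move: dcE; rewrite dE; lia.
by exists (l - d * h' - 3 * c * e ^+ 4); move: eqn; rewrite n2 m4; lia.
Qed.

(** 3 divides n but not e. Dividing by 3 and multiplying by d gives m^4 + e^4 = 0 modulo 3, whereas
    fourth powers are 0 or 1. *)
Lemma torsor_3mod3 (d c k : int) : d * c = 3 * k + 1 -> ~ torsor (3 * d) (3 * c).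
Proof.
move=> dcE [m [n [e [u [v [cop eqn]]]]]].
have [[l nE]|[l [l' [n2 _]]]] := sqr_mod3 n; last by move: eqn; rewrite n2; lia.
have [[j eE]|[j [j' [_ e4]]]] := sqr_mod3 e; first by move: cop; rewrite eE; lia.
have {}eqn : 3 * l ^+ 2 = d * m ^+ 4 + c * (3 * j' + 1).
  have : 9 * l ^+ 2 = 3 * (d * m ^+ 4) + 3 * c * (3 * j' + 1).
    transitivity (n ^+ 2); first by rewrite nE; ring.
    by rewrite -e4 eqn; ring.
  by clear; lra.
have [i [i' [d2 _]]] : exists k l, d ^+ 2 = 3 * k + 1 /\ d ^+ 4 = 3 * l + 1.
  by have [[i dE]|//] := sqr_mod3 d; move: dcE; rewrite dE; lia.
have : 3 * (d * l ^+ 2) = d ^+ 2 * m ^+ 4 + d * c * (3 * j' + 1).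
  by rewrite mulrCA eqn; ring.
have [[h mE]|[h [h' [_ m4]]]] := sqr_mod3 m.
  by rewrite mE dcE exprMn; lia.
by rewrite d2 m4 dcE; lia.
Qed.

(** A 3-adic descent: e is prime to 3, so 3 divides n, then m, then n / 3, and finally 9 would
    divide 6 e^4. *)
Lemma torsor_3_54 : ~ torsor 3 54.
Proof.
move=> [m [n [e [u [v [cop eqn]]]]]].
have [[j eE]|[j [j' [_ e4]]]] := sqr_mod3 e; first by move: cop; rewrite eE; lia.
have [[l nE]|[l [l' [n2 _]]]] := sqr_mod3 n; last by move: eqn; rewrite n2; lia.
have [[h mE]|[h [h' [_ m4]]]] := sqr_mod3 m; last first.
  by move: eqn; rewrite nE m4 exprMn; lia.
have {}eqn : l ^+ 2 = 27 * h ^+ 4 + 6 * (3 * j' + 1).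
  have : 9 * l ^+ 2 = 9 * (27 * h ^+ 4) + 54 * (3 * j' + 1).
    transitivity (n ^+ 2); first by rewrite nE; ring.
    by rewrite -e4 eqn mE; ring.
  by clear; lra.
have [[i lE]|[i [i' [l2 _]]]] := sqr_mod3 l; last by move: eqn; rewrite l2; lia.
by move: eqn; rewrite lE exprMn; lia.
Qed.

(** * Squarefree classes of rational points *)

Definition sqfree (n : nat) : Prop := forall k, (k ^ 2 %| n)%N -> k = 1%N.

Lemma sqfree_decomp n : (0 < n)%N -> exists d m, n = (d * m ^ 2)%N /\ sqfree d.
Proof.
elim: {n}_.+1 {-2}n (ltnSn n) => // N IH n nN n0.
have [[k [k1 kn]]|sqf] := classic (exists k, (1 < k)%N /\ (k ^ 2 %| n)%N).
  have /dvdnP [n' nE] := kn.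
  have n'0 : (0 < n')%N by move: n0; rewrite nE muln_gt0 => /andP[].
  have [|d [m [n'E sqd]]] := IH n' _ n'0.
    rewrite -ltnS; apply: leq_trans nN; rewrite ltnS nE ltn_Pmulr //.
    by apply: (leq_trans k1); rewrite -mulnn leq_pmulr // (ltnW k1).
  by exists d, (m * k)%N; rewrite nE n'E expnMn mulnA.
exists n, 1%N; split=> [|k kn]; first by rewrite muln1.
case: k kn => [|[|k]] kn //; first by move: kn; rewrite dvd0n; case: (n) n0.
by case: sqf; exists k.+2.
Qed.

Lemma sqfree_dvd_sqr d z : sqfree d -> (d %| z ^ 2)%N -> (d %| z)%N.
Proof.
move=> sqd dz2; have d0 : (0 < d)%N.
  by case: d sqd {dz2} => // sqd; have := sqd 0%N (dvdn0 _).
have g0 : (0 < gcdn d z)%N by rewrite gcdn_gt0 d0.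
have /dvdnP [d' dE] := dvdn_gcdl d z; have /dvdnP [z' zE] := dvdn_gcdr d z.
set g := gcdn d z in g0 dE zE.
have cop : coprime d' z'.
  rewrite /coprime -(eqn_pmul2r g0) mul1n.
  by rewrite muln_gcdl -dE -zE.
have gz : (g %| z)%N := dvdn_gcdr d z.
clearbody g; have : (d' %| g)%N.
  move: dz2; rewrite dE zE (_ : (z' * g) ^ 2 = z' ^ 2 * g * g)%N; last by ring.
  by rewrite dvdn_pmul2r // Gauss_dvdr // coprimeXr.
move=> d'g; have : (d' ^ 2 %| d)%N by rewrite dE -mulnn dvdn_mul.
by move/sqd => d'1; rewrite dE d'1 mul1n.
Qed.

Lemma coprime_sqr_factor w v z : (0 < w)%N -> coprime w v -> (w * v = z ^ 2)%N ->
  exists e, w = (e ^ 2)%N.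
Proof.
move=> w0 cop wv; have [d [m [wE sqd]]] := sqfree_decomp w0.
have m0 : (0 < m ^ 2)%N by move: w0; rewrite wE muln_gt0 => /andP[].
have d0 : (0 < d)%N by move: w0; rewrite wE muln_gt0 => /andP[].
have /dvdnP [z1 zE] : (m %| z)%N.
  by rewrite -(@dvdn_pexp2r _ _ 2) // -wv wE -mulnA dvdn_mull // dvdn_mulr.
have dv : (d * v = z1 ^ 2)%N.
  by apply/eqP; rewrite -(eqn_pmul2r m0) -expnMn -zE -wv wE; apply/eqP; ring.
have /dvdnP [z2 z1E] : (d %| z1)%N by apply: sqfree_dvd_sqr => //; rewrite -dv dvdn_mulr.
have dv' : (d %| v)%N.
  apply/dvdnP; exists (z2 ^ 2)%N.
  by apply/eqP; rewrite -(eqn_pmul2l d0) dv z1E; apply/eqP; ring.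
have : (d %| gcdn w v)%N by rewrite dvdn_gcd dv' wE dvdn_mulr.
by rewrite (eqP cop) dvdn1 => /eqP d1; exists m; rewrite wE d1 mul1n.
Qed.

Lemma dvdz_of_sqr (m Z : int) : (`|m| ^ 2 %| `|Z| ^ 2)%N -> exists k, Z = m * k.
Proof. by rewrite dvdn_pexp2r // => /(@dvdzP m Z) [k ->]; exists k; rewrite mulrC. Qed.

(** Write X = u / w in lowest terms. Then w is coprime to v = u (u^2 + B w^2) and w v is a square,
    so w = e^2. With d the signed squarefree part of u = d m^2, dividing the square root of v by m
    and by d leaves n. *)
Lemma descent_torsor (B : int) (X Y : rat) : X != 0 -> Y ^+ 2 = X ^+ 3 + B%:~R * X ->
  exists d c : int, [/\ torsor d c, B = d * c, sqfree `|d| &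
    exists2 z, z != 0 & X = d%:~R * z ^+ 2].
Proof.
move=> X0 on; set u := numq X; set w := denq X.
have w0 : w != 0 := denq_neq0 X.
have u0 : u != 0 by rewrite numq_eq0.
pose v := u * (u ^+ 2 + B * w ^+ 2).
have [Z ZE] : exists Z : int, Y * w%:~R ^+ 2 = Z%:~R.
  apply: (@rat_sqr_int _ (w * v)); rewrite exprMn on /v /u !(intrM, intrD, rmorphXn) /= numqE -/w.
  by ring.
have Z2 : w * v = Z ^+ 2.
  apply: (@intr_inj rat);
    rewrite rmorphXn /= -ZE exprMn on /v /u !(intrM, intrD, rmorphXn) /= numqE -/w.
  by ring.
have [U [V UV]] : exists U V : int, U * u + V * w = 1.
  have [U [V e]] := Bezoutz u w; exists U, V; rewrite e.
  by have := coprime_num_den X; rewrite /coprime => /eqP; rewrite /gcdz => ->.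
have cop : coprime `|w| `|v|.
  apply/(@coprimezP w v).
  (* Expand (U u + V w)^3 = 1 and replace u^3 by v - B u w^2. *)
  exists (3 * U ^+ 2 * u ^+ 2 * V + 3 * U * u * V ^+ 2 * w + V ^+ 3 * w ^+ 2
    - U ^+ 3 * B * w * u, U ^+ 3) => /=.
  by transitivity ((U * u + V * w) ^+ 3); [rewrite /v|rewrite UV]; ring.
have [e0 eE] : exists e, `|w|%N = (e ^ 2)%N.
  by apply: (coprime_sqr_factor _ cop (z := `|Z|%N)); rewrite ?absz_gt0 // -abszM Z2 abszX.
pose e : int := e0.
have wE : w = e ^+ 2.
  by rewrite -[w](gez0_abs (ltW (denq_gt0 X))) eE -mulnn PoszM expr2.
have e_neq0 : e != 0 by apply: contraNneq w0 => ez; rewrite wE ez.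
have [Z1 Z1E] : exists k, Z = e * k.
  by apply: dvdz_of_sqr; rewrite -!abszX -Z2 -wE abszM dvdn_mulr.
have vE : v = Z1 ^+ 2.
  by apply: (mulfI w0); rewrite Z2 Z1E exprMn wE.
have [d0 [m0 [uE sqd]]] : exists d m, `|u|%N = (d * m ^ 2)%N /\ sqfree d.
  by apply: sqfree_decomp; rewrite absz_gt0.
pose d : int := sgz u * d0; pose m : int := m0.
have {}uE : u = d * m ^+ 2.
  by rewrite [LHS]intEsg uE PoszM /d /m -mulrA; congr (_ * (_ * _)); rewrite -mulnn PoszM expr2.
have [d_neq0 m_neq0] : d != 0 /\ m != 0.
  by move: u0; rewrite uE mulf_eq0 expf_eq0 negb_or => /andP[].
have absd : `|d|%N = d0 by rewrite /d abszM; move: u0 {uE}; case: sgzP => // _ _; rewrite mul1n.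
have [Z2' Z2E] : exists k, Z1 = m * k.
  by apply: dvdz_of_sqr; rewrite -!abszX -vE /v abszM dvdn_mulr // uE abszM dvdn_mull.
have e1 : Z2' ^+ 2 = d * (d ^+ 2 * m ^+ 4 + B * e ^+ 4).
  apply: (mulfI (expf_neq0 2 m_neq0)); rewrite -exprMn -Z2E -vE /v uE wE; ring.
have [n nE] : exists n, Z2' = d * n.
  have : (d %| Z2')%Z.
    by rewrite dvdzE absd sqfree_dvd_sqr // -abszX e1 abszM absd dvdn_mulr.
  by move/dvdzP => [n ->]; exists n; rewrite mulrC.
have e2 : B * e ^+ 4 = d * (n ^+ 2 - d * m ^+ 4).
  apply: (mulfI d_neq0); have := e1; rewrite nE => e1'.
  transitivity (d * (d ^+ 2 * m ^+ 4 + B * e ^+ 4) - d ^+ 3 * m ^+ 4); first by ring.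
  by rewrite -e1'; ring.
have UV' : U * (d * m ^+ 2) + V * e ^+ 2 = 1 by rewrite -uE -wE.
(* Expanding B (U d m^2 + V e^2)^2 = B, every term contains d, or contains B e^4, which is d (n^2 -
   d m^4). *)
pose c := B * U * m ^+ 2 * (U * (d * m ^+ 2) + 2 * V * e ^+ 2) + V ^+ 2 * (n ^+ 2 - d * m ^+ 4).
have BE : B = d * c.
  transitivity (B * (U * (d * m ^+ 2) + V * e ^+ 2) ^+ 2); first by rewrite UV'; ring.
  transitivity (d * (B * U * m ^+ 2 * (U * (d * m ^+ 2) + 2 * V * e ^+ 2)) + V ^+ 2 * (B * e ^+ 4)).
    by ring.
  by rewrite e2 /c; ring.
exists d, c; split=> //; last first.
- exists (m%:~R / e%:~R); first by rewrite mulf_neq0 ?invr_eq0 ?intr_eq0.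
  rewrite -[X]divq_num_den -/u -/w uE wE !(intrM, rmorphXn) /=; field.
  by move: e_neq0; rewrite -(intr_eq0 rat).
- by rewrite absd.
exists m, n, e, (U * m), (V * e); split; first by rewrite -UV'; ring.
apply: (mulfI d_neq0); transitivity (d ^+ 2 * m ^+ 4 + d * c * e ^+ 4); last by ring.
by rewrite -BE e2; ring.
Qed.

Lemma odd_dvd_3p p d : prime p -> odd d -> sqfree d -> (d %| 6 * p)%N ->
  d \in [:: 1; 3; p; 3 * p]%N.
Proof.
move=> pp oddd sqd; rewrite -[6%N]/(2 * 3)%N -mulnA Gauss_dvdr ?coprimen2 // => d3p.
have dvd3 k : (k %| 3)%N -> (k == 1%N) || (k == 3).
  by move=> k3; have /primeP [_ /(_ _ k3)] : prime 3 by [].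
rewrite !inE; have [cop|ncop] := boolP (coprime d p).
  have /dvd3 : (d %| 3)%N by rewrite -(Gauss_dvdl _ cop).
  by case/orP => ->; rewrite ?orbT.
have /dvdnP [k dE] : (p %| d)%N by move: ncop; rewrite coprime_sym prime_coprime // negbK.
have /dvd3 : (k %| 3)%N by rewrite -(@dvdn_pmul2r p) ?prime_gt0 // -dE.
by case/orP => /eqP kE; rewrite dE kE ?mul1n eqxx ?orbT.
Qed.

Lemma rat_sqr_neq_2odd (z : rat) (N : int) : odd `|N| -> z ^+ 2 <> (2 * N)%:~R.
Proof.
move=> oddN zE; have [Z ZE] := rat_sqr_int zE.
have : Z ^+ 2 = 2 * N by apply: (@intr_inj rat); rewrite rmorphXn /= -ZE.
have [[k ->]|[k [-> _]]] := sqr_mod8 Z; last by lia.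
by rewrite exprMn; lia.
Qed.

Lemma sqfree_even_half (d : int) : sqfree `|d| -> ~~ odd `|d| ->
  exists2 h : int, d = 2 * h & odd `|h|.
Proof.
move=> sq ev; exists (d %/ 2)%Z; first by move: ev; clear; lia.
apply/negPn/negP => evh; have : (2 ^ 2 %| `|d|)%N by move: ev evh; clear; lia.
by move/sq.
Qed.

(* Replacing P by P + (0, 0) multiplies its class by B = 2 (2^k)^2 B', so the class
   of exactly one of them is represented by an odd squarefree integer. *)
Lemma odd_class (E : cubic_curve rat) (a b : rat) (B B' : int) (k : nat) (P : ec_point E) :
  cc_poly E = a *: 'X^3 + b *: 'X -> a * b = B%:~R -> B = 2 * (2 ^+ k) ^+ 2 * B' ->
  odd `|B'| -> exists d c : int,
  [/\ odd `|d|, sqfree `|d|, B = d * c, torsor d c & same_class a b P d%:~R].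
Proof.
move=> fE abE BE oddB'.
have B0 : B%:~R != 0 :> rat by rewrite -abE mulf_neq0 ?(cubic_lead_neq0 fE) ?(cubic_lin_neq0 fE).
have sq1 : sqfree 1 by move=> j; rewrite dvdn1 -mulnn muln_eq1 => /andP[/eqP].
have [P0|P0] := eqVneq P 0.
  exists 1, B; split; [by []|exact: sq1|by rewrite mul1r|exact: torsor1|].
  by exists 1; rewrite ?oner_neq0 // P0 /descent_map /= mul1r expr1n; left.
have [PT|PT] := eqVneq P (origin fE).
  exists 1, B; split; [by []|exact: sq1|by rewrite mul1r|exact: torsor1|].
  by exists 1; rewrite ?oner_neq0 // PT descent_map_origin; right; ring.
have class Q : Q != 0 -> Q != origin fE -> exists d c : int,
    [/\ torsor d c, B = d * c, sqfree `|d| & exists2 z, z != 0 & descent_map a b Q = d%:~R * z ^+ 2].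
  move=> Q0 QT; have : oncurve (cc_poly E) (val Q) := ec_on Q.
  rewrite /descent_map; case vQ: (val Q) => [[x y]|]; last first.
    by move: Q0; rewrite (_ : Q = 0) ?eqxx //; apply: val_inj.
  rewrite /= (cubic_at fE) => /eqP on.
  have x0 : x != 0.
    apply: contraNneq QT => x0; apply/eqP/val_inj; rewrite vQ x0 /=; congr (Some (_, _)).
    by apply/eqP; rewrite -sqrf_eq0 on x0; apply/eqP; ring.
  rewrite (negPf x0); apply: (@descent_torsor B (a * x) (a * y)).
    by rewrite mulf_neq0 ?(cubic_lead_neq0 fE).
  by rewrite -abE exprMn on; ring.
have [d [c [tor BdE sqd [z z0 PE]]]] := class P P0 PT.
have [oddd|evend] := boolP (odd `|d|).
  by exists d, c; split=> //; exists z => //; left.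
have [||d2 [c2 [tor2 BdE2 sqd2 [z2 z20 PE2]]]] := class (P + origin fE).
- by rewrite addr_eq0 oppr_origin.
- by rewrite -subr_eq0 addrK.
have [w w0] := descent_mapD fE P (origin fE); rewrite descent_map_origin PE PE2 abE => wE.
have d20 : d2%:~R != 0 :> rat.
  by have := descent_map_neq0 fE (P + origin fE); rewrite PE2 mulf_eq0 negb_or => /andP[].
have [oddd2|evend2] := boolP (odd `|d2|).
  exists d2, c2; split=> //; exists (w / (d2%:~R * z2 * B%:~R)).
    by rewrite !mulf_neq0 // invr_eq0 !mulf_neq0.
  right; rewrite abE expr_div_n -wE PE; field.
  by rewrite d20 z20 B0.
have [h dE oddh] := sqfree_even_half sqd evend; have [h2 d2E oddh2] := sqfree_even_half sqd2 evend2.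
have two : 2 ^+ k != 0 :> rat by rewrite expf_neq0.
(* Both representatives even: the product of the classes of P, (0,0) and P + (0,0) is a square, yet
   d d2 B would have odd 2-adic valuation. *)
case: (@rat_sqr_neq_2odd (w / (z * z2 * 2 * 2 ^+ k)) (h * h2 * B')).
  by rewrite !abszM !oddM oddh oddh2.
rewrite expr_div_n -wE BE dE d2E !(intrM, rmorphXn) /=; field.
by rewrite z0 z20 two.
Qed.

(** * Prime fields *)

Lemma finField_prim_root (F : finFieldType) n : (0 < n)%N -> (n %| #|F|.-1)%N ->
  exists z : F, n.-primitive_root z.
Proof.
move=> n0 nF; set N := #|F|.-1 in nF.
have N0 : (0 < N)%N by rewrite /N -subn1 subn_gt0 finNzRing_gt1.
pose rs := enum (predC1 (0 : F)).
have : has N.-primitive_root rs.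
  apply: has_prim_root => //.
  - apply/allP => x; rewrite mem_enum => x0; rewrite unity_rootE.
    apply/eqP/(mulfI x0); rewrite -exprS mulr1 /N prednK ?expf_card //.
    exact: ltnW (finNzRing_gt1 F).
  - exact: enum_uniq.
  - by rewrite -cardE cardC1.
case/hasP => z _ zN; exists (z ^+ (N %/ n)); exact: dvdn_prim_root.
Qed.

Section PrimeField.
Variable p : nat.
Hypothesis pp : prime p.
Local Notation F := 'F_p.

Lemma Fp_prim_root n : (0 < n)%N -> (n %| p.-1)%N -> exists z : F, n.-primitive_root z.
Proof. by move=> n0 np; apply: finField_prim_root; rewrite ?card_Fp. Qed.

Lemma prim_root8 (R : fieldType) (z : R) : 8.-primitive_root z -> z ^+ 4 = -1.
Proof.
move=> z8; have : (z ^+ 4 - 1) * (z ^+ 4 + 1) = 0.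
  by rewrite -subr_sqr expr1n -exprM (prim_expr_order z8) subrr.
move/eqP; rewrite mulf_eq0 subr_eq0 addr_eq0 => /orP[|/eqP //].
by rewrite -(prim_order_dvd z8).
Qed.

Lemma sqrt2_prim_root8 (R : fieldType) (z : R) : 8.-primitive_root z -> (z + z^-1) ^+ 2 = 2.
Proof.
move=> z8; have z4 := prim_root8 z8.
have z0 : z != 0 by rewrite (prim_root_eq0 z8).
have : z ^+ 2 * ((z + z^-1) ^+ 2 - 2) = z ^+ 4 + 1 by field.
rewrite z4 addNr => /eqP; rewrite mulf_eq0 expf_eq0 (negPf z0) andbF subr_eq0.
by move/eqP.
Qed.

Lemma sqr_m1 : p = 1 %[mod 4] -> exists i : F, i ^+ 2 = -1.
Proof.
move=> p1; have [|z z4] := @Fp_prim_root 4 isT; first by move: (prime_gt1 pp); lia.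
exists z; have : (z ^+ 2 - 1) * (z ^+ 2 + 1) = 0.
  by rewrite -subr_sqr expr1n -exprM (prim_expr_order z4) subrr.
move/eqP; rewrite mulf_eq0 subr_eq0 addr_eq0 => /orP[|/eqP //].
by rewrite -(prim_order_dvd z4).
Qed.

Lemma Fp_natr_eq0 n : (n%:R == 0 :> F) = (p %| n)%N.
Proof. by rewrite -(dvdn_pcharf (pchar_Fp pp)). Qed.

Lemma Fp_natr_neq0 n : (0 < n < p)%N -> n%:R != 0 :> F.
Proof. by move=> /andP[n0 np]; rewrite Fp_natr_eq0 gtnNdvd. Qed.

Lemma Fp_fermat (x : F) : x != 0 -> x ^+ p.-1 = 1.
Proof.
move=> x0; apply: (mulfI x0); rewrite -exprS prednK ?prime_gt0 // mulr1.
by have := expf_card x; rewrite (card_Fp pp).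
Qed.

Lemma nsqr_m1 : p = 3 %[mod 4] -> forall t : F, t ^+ 2 <> -1.
Proof.
move=> p3 t tE.
have t0 : t != 0 by apply/eqP => t0; move/eqP: tE; rewrite t0 expr0n eq_sym oppr_eq0 oner_eq0.
have tp := Fp_fermat t0.
have pE : p.-1 = (4 * (p %/ 4) + 2)%N by move: p3; lia.
have : (2%:R : F) == 0.
  move: tp; rewrite pE exprD exprM (exprM _ 2 2) tE sqrrN expr1n expr1n mul1r => m1.
  by rewrite -[2%N]/(1 + 1)%N natrD -{1}m1 addNr.
by rewrite (negPf (Fp_natr_neq0 _)) //; move: p3 (prime_gt1 pp); lia.
Qed.

Lemma sqr_m3 : p = 1 %[mod 3] -> exists t : F, t ^+ 2 = -3.
Proof.
move=> p1; have [|z z3] := @Fp_prim_root 3 isT; first by move: (prime_gt1 pp); lia.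
exists (2 * z + 1); have : (z - 1) * (z ^+ 2 + z + 1) = 0.
  by transitivity (z ^+ 3 - 1); [ring | rewrite (prim_expr_order z3) subrr].
move/eqP; rewrite mulf_eq0 => /orP[|/eqP z2].
  by rewrite subr_eq0 -(expr1 z) -(prim_order_dvd z3).
transitivity (4 * (z ^+ 2 + z + 1) - 3); first by ring.
by rewrite z2; ring.
Qed.

(** A square root t of -3 gives the cube root of unity (t - 1) / 2; as p - 1 = 1 modulo 3, Fermat
    makes it 1, and its equation w^2 + w + 1 = 0 becomes 3 = 0. *)
Lemma nsqr_m3 : (3 < p)%N -> p = 2 %[mod 3] -> forall t : F, t ^+ 2 <> -3.
Proof.
move=> p3 p2 t tE.
have two : (2 : F) != 0 by rewrite Fp_natr_neq0 //; lia.
have three : (3 : F) != 0 by rewrite Fp_natr_neq0 //; lia.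
pose w := (t - 1) / 2.
have w2 : w ^+ 2 + w + 1 = 0.
  transitivity ((t ^+ 2 + 3) / 4); last by rewrite tE addNr mul0r.
  have four : (4 : F) != 0 by rewrite (_ : 4 = 2 * 2) ?mulf_neq0 //; ring.
  by rewrite /w; field; rewrite four two.
have w3 : w ^+ 3 = 1.
  apply/eqP; rewrite -subr_eq0 (_ : _ - _ = (w - 1) * (w ^+ 2 + w + 1)); last by ring.
  by rewrite w2 mulr0.
have w0 : w != 0 by apply/eqP => w0; move/eqP: w3; rewrite w0 expr0n eq_sym oner_eq0.
have wp := Fp_fermat w0.
have pE : p.-1 = (3 * (p %/ 3) + 1)%N by move: p2; lia.
move: wp; rewrite pE exprD exprM w3 expr1n mul1r expr1 => w1.
by move/eqP: three; apply; rewrite -[RHS]w2 w1; ring.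
Qed.

Lemma sqr_2_mod1 : p = 1 %[mod 8] -> exists t : F, t ^+ 2 = 2.
Proof.
move=> p1; have [|z z8] := @Fp_prim_root 8 isT; first by move: (prime_gt1 pp); lia.
by exists (z + z^-1); apply: sqrt2_prim_root8.
Qed.

(* A square root w = z + 1/z of 2 in a field with p^2 elements, z a primitive 8th root
   of unity, is fixed by Frobenius, so 2^((p-1)/2) = 1. *)
Lemma sqr_2_mod7 : p = 7 %[mod 8] -> exists t : F, t ^+ 2 = 2.
Proof.
move=> p7; have [K pK cK] := PrimePowerField pp (isT : (0 < 2)%N).
have [|z z8] := @finField_prim_root K 8 isT.
  rewrite cK; have -> : p = (8 * (p %/ 8) + 7)%N by lia.
  rewrite (_ : (_ ^ 2).-1 = 8 * (8 * (p %/ 8) ^ 2 + 14 * (p %/ 8) + 6))%N ?dvdn_mulr //; lia.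
pose w := z + z^-1; have w2 : w ^+ 2 = 2 := sqrt2_prim_root8 z8.
have two : (2 : K) != 0.
  by rewrite -(dvdn_pcharf pK) gtnNdvd //; lia.
have w0 : w != 0 by rewrite -sqrf_eq0 w2.
have z0 : z != 0 by rewrite (prim_root_eq0 z8).
have zp : z ^+ p = z^-1.
  apply: (mulfI z0); rewrite divff // -exprS; apply/eqP; rewrite -(prim_order_dvd z8); lia.
have wp : w ^+ p = w.
  by rewrite -(pFrobenius_autE pK) rmorphD /= fmorphV /= pFrobenius_autE zp invrK addrC.
have : (2 : K) ^+ (p %/ 2) = 1.
  rewrite -w2 -exprM; apply: (mulfI w0); rewrite -exprS mulr1 -[RHS]wp; congr (_ ^+ _); lia.
move=> e; have : (2 : F) ^+ (p %/ 2) = 1.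
  apply/eqP; rewrite -subr_eq0 -natrX -(natrB _ (_ : 1 <= 2 ^ (p %/ 2))%N) ?expn_gt0 //.
  rewrite Fp_natr_eq0 (dvdn_pcharf pK) natrB ?expn_gt0 // natrX subr_eq0 e //.
move=> e'; exists (2 ^+ (p %/ 4).+1); rewrite -exprM.
by rewrite (_ : _ * 2 = (p %/ 2).+1)%N ?exprS ?e' ?mulr1 //; lia.
Qed.

(** Exactly one of -1 and -3 is a square: -3 when p = 7, and -1 when p = 17 modulo 24. Their product
    is 3. *)
Lemma nsqr_3 : p = 7 %[mod 24] \/ p = 17 %[mod 24] -> forall t : F, t ^+ 2 <> 3.
Proof.
move=> p24 t tE; case: p24 => p24.
  have [|u uE] := sqr_m3; first by lia.
  have t0 : t != 0.
    by rewrite -sqrf_eq0 tE Fp_natr_neq0 //; lia.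
  have [|] := @nsqr_m1 _ (u / t); first by lia.
  by rewrite exprMn exprVn uE tE; field; rewrite Fp_natr_neq0 //; lia.
have [|i iE] := sqr_m1; first by lia.
have [||] := @nsqr_m3 _ _ (i * t); [lia|lia|].
by rewrite exprMn iE tE; ring.
Qed.

Lemma nsqr_6 : p = 7 %[mod 24] \/ p = 17 %[mod 24] -> forall t : F, t ^+ 2 <> 6.
Proof.
move=> p24 t tE.
have [s sE] : exists s : F, s ^+ 2 = 2.
  by case: p24 => p24; [apply: sqr_2_mod7|apply: sqr_2_mod1]; lia.
apply: (nsqr_3 p24 (t := t / s)); rewrite exprMn exprVn sE tE.
by field; rewrite Fp_natr_neq0 //; lia.
Qed.

(** The ratio would give (t / s)^4 = 9, so 3 or -3 would be a square; for p = 17 modulo 24 neither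
    is, since -1 is a square and 3 is not. *)
Lemma not_both_quartic : p = 17 %[mod 24] ->
  forall t s : F, t ^+ 4 = - 18 -> s ^+ 4 = - 2 -> False.
Proof.
move=> p24 t s tE sE.
have two : (2 : F) != 0 by rewrite Fp_natr_neq0 //; lia.
have : ((t / s) ^+ 2 - 3) * ((t / s) ^+ 2 + 3) = 0.
  transitivity (t ^+ 4 / s ^+ 4 - 9); first by rewrite -exprVn; ring.
  by rewrite tE sE; field; rewrite oppr_eq0.
move/eqP; rewrite mulf_eq0 subr_eq0 addr_eq0 => /orP[] /eqP ts.
  by apply: (nsqr_3 _ (t := t / s)) => //; right.
have [|i iE] := sqr_m1; first by lia.
apply: (nsqr_3 _ (t := i * (t / s))); first by right.
by rewrite exprMn iE ts; ring.
Qed.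

(** Both -1 and 9 are fourth powers here: -1 = z^4 for a primitive 8th root of unity z, and 9 = (i
    u)^4 with i^2 = -1 and u^2 = -3. *)
Lemma quartic_2 : p = 1 %[mod 24] ->
  (exists t : F, t ^+ 4 = - 18) \/ (exists t : F, t ^+ 4 = - 2) ->
  exists t : F, t ^+ 4 = 2.
Proof.
move=> p24.
have [|z z8] := @Fp_prim_root 8 isT; first by lia.
have z4 := prim_root8 z8.
have nine : (9 : F) != 0.
  by rewrite Fp_natr_eq0 (Euclid_dvdX 3 2 pp) andbT gtnNdvd //; move: (prime_gt1 pp); lia.
case=> [] [t tE]; last by exists (z * t); rewrite exprMn z4 tE; ring.
have [|i iE] := sqr_m1; first by lia.
have [|u uE] := sqr_m3; first by lia.
exists (z * t / (i * u)).
rewrite !exprMn exprVn !exprMn z4 tE (exprM i 2 2) (exprM u 2 2) iE uE.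
by field; rewrite nine.
Qed.

Lemma quartic_symbolP : reflect (exists t : F, t ^+ 4 = 2) (quartic_symbol2 p == 1).
Proof.
have -> : (quartic_symbol2 p == 1) = [exists x : 'I_p, x ^ 4 == 2 %[mod p]].
  by rewrite /quartic_symbol2; case: ifP.
have modE (m n : nat) : (m == n %[mod p]) = (m%:R == n%:R :> F).
  by rewrite -(inj_eq (@ord_inj _)) !(val_Fp_nat pp).
apply: (iffP existsP) => [[x]|[t tE]].
  by rewrite modE natrX => /eqP; exists x%:R.
have tp : (t < p)%N by rewrite -[X in (_ < X)%N](Fp_cast pp) ltn_ord.
by exists (Ordinal tp); rewrite modE natrX /= natr_Zp tE.
Qed.

End PrimeField.

(** * Torsors modulo p *)

Section TorsorModp.
Variable p : nat.
Hypothesis pp : prime p.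
Local Notation F := 'F_p.

Lemma Fp_intr_eq0 (n : int) : n%:~R = 0 :> F -> exists k, n = p%:Z * k.
Proof.
move=> n0; have : (p %| `|n|)%N.
  rewrite -(Fp_natr_eq0 pp); case: n n0 => n /= n0; first by rewrite -n0.
  by rewrite -oppr_eq0 -n0 NegzE mulrNz.
by move=> /(@dvdzP p n) [k ->]; exists k; rewrite mulrC.
Qed.

Lemma Fp_intr_p : (p%:Z)%:~R = 0 :> F.
Proof. by apply/eqP; rewrite (Fp_natr_eq0 pp). Qed.

(** p divides n but, by coprimality, not e. Dividing the equation by p and reducing leaves k (m^4 +
    c e^4) = 0. *)
Lemma torsor_p (c k : nat) : k%:R != 0 :> F ->
  torsor (p%:Z * k%:Z) (p%:Z * (k%:Z * c%:Z)) -> exists t : F, t ^+ 4 = - c%:R.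
Proof.
rewrite !pmulrn => k0 [m [n [e [u [v [cop eqn]]]]]].
have p0 := Fp_intr_p.
have p_neq0 : p%:Z != 0 by rewrite -lt0n prime_gt0.
have [n' nE] : exists n', n = p%:Z * n'.
  apply: Fp_intr_eq0; apply/eqP; rewrite -sqrf_eq0 -rmorphXn /= eqn.
  by rewrite !(intrD, intrM) p0; apply/eqP; ring.
have e0 : e%:~R != 0 :> F.
  apply/eqP => e0; have := congr1 (fun x : int => x%:~R : F) cop.
  rewrite !(intrD, intrM) p0 e0 !mul0r !mulr0 addr0 => /eqP.
  by rewrite eq_sym oner_eq0.
have {}eqn : p%:Z * n' ^+ 2 = k%:Z * m ^+ 4 + k%:Z * c%:Z * e ^+ 4.
  by apply: (mulfI p_neq0); transitivity (n ^+ 2); [rewrite nE|rewrite eqn]; ring.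
exists (m%:~R / e%:~R); have := congr1 (fun x : int => x%:~R : F) eqn.
rewrite !(rmorphXn, intrD, intrM) /= p0 mul0r => meE.
have mE : m%:~R ^+ 4 = - c%:Z%:~R * e%:~R ^+ 4 :> F.
  apply: (mulfI k0); apply/eqP; rewrite -subr_eq0; apply/eqP.
  by rewrite [RHS]meE; ring.
by rewrite expr_div_n mE mulfK // expf_neq0.
Qed.

(** If p does not divide m, the equation reduces to n^2 = 3 m^4. Otherwise p divides n, and dividing
    by p^2 gives a square root of c. *)
Lemma torsor_3_modp (c : nat) : torsor 3 (c%:Z * (p%:Z ^+ 2)) ->
  exists t : F, t ^+ 2 = 3 \/ t ^+ 2 = c%:R.
Proof.
rewrite pmulrn => -[m [n [e [u [v [cop eqn]]]]]].
have p0 := Fp_intr_p.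
have p_neq0 : p%:Z != 0 by rewrite -lt0n prime_gt0.
have [m0|m0] := eqVneq (m%:~R : F) 0; last first.
  exists (n%:~R / m%:~R ^+ 2); left.
  have := congr1 (fun x : int => x%:~R : F) eqn.
  rewrite !(rmorphXn, intrD, intrM) /= p0 expr_div_n => ->.
  by field.
have e0 : e%:~R != 0 :> F.
  apply/eqP => e0; have := congr1 (fun x : int => x%:~R : F) cop.
  rewrite !(intrD, intrM) m0 e0 !mulr0 addr0 => /eqP.
  by rewrite eq_sym oner_eq0.
have [n' nE] : exists n', n = p%:Z * n'.
  apply: Fp_intr_eq0; apply/eqP; rewrite -sqrf_eq0 -rmorphXn /= eqn.
  by rewrite !(rmorphXn, intrD, intrM) /= p0 m0; apply/eqP; ring.
have [m' mE] := Fp_intr_eq0 m0.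
have {}eqn : n' ^+ 2 = 3 * p%:Z ^+ 2 * m' ^+ 4 + c%:Z * e ^+ 4.
  apply: (mulfI (expf_neq0 2 p_neq0)).
  by transitivity (n ^+ 2); [rewrite nE|rewrite eqn mE]; ring.
exists (n'%:~R / e%:~R ^+ 2); right.
have := congr1 (fun x : int => x%:~R : F) eqn.
rewrite !(rmorphXn, intrD, intrM) /= p0 expr_div_n => ->.
by field.
Qed.

End TorsorModp.

(** * Selmer classes and the rank bounds *)

Section Classes.
Variables (p : nat).
Hypothesis pp : prime p.
Implicit Types d c k : int.

Lemma int_odd d : odd `|d| -> exists k, d = 2 * k + 1.
Proof. by move=> oddd; exists (d %/ 2)%Z; move: oddd; clear; lia. Qed.

Lemma odd_cofactor8 d c N : odd `|d| -> 8 * N = d * c -> exists c', c = 8 * c' /\ N = d * c'.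
Proof.
move=> /int_odd [k dE] Nd; have [g d2] : exists g, d ^+ 2 = 8 * g + 1.
  by have [[g gE]|[g [gE _]]] := sqr_mod8 d; [move: gE; rewrite dE; clear; lia|exists g].
have cE : c = 8 * (d * N - g * c).
  have : c * d ^+ 2 = 8 * (d * N) by rewrite [RHS]mulrCA Nd; ring.
  by rewrite d2; clear; lra.
exists (d * N - g * c); split=> //.
have eight : (8 : int) != 0 by [].
by apply: (mulfI eight); rewrite Nd {1}cE; ring.
Qed.

Lemma odd_cofactor2 d c N : odd `|d| -> 2 * N = d * c -> exists c', c = 2 * c' /\ N = d * c'.
Proof.
move=> /int_odd [k dE] Nd; have cE : c = 2 * (N - k * c).
  by move: Nd; rewrite dE; clear; lra.
exists (N - k * c); split=> //.
have two : (2 : int) != 0 by [].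
by apply: (mulfI two); rewrite Nd {1}cE; ring.
Qed.

Lemma cofactor3 d c N : (exists k, d ^+ 2 = 3 * k + 1) -> 3 * N = d * c ->
  exists c', c = 3 * c' /\ N = d * c'.
Proof.
move=> [k d2] Nd; have cE : c = 3 * (d * N - k * c).
  have : c * d ^+ 2 = 3 * (d * N) by rewrite [RHS]mulrCA Nd; ring.
  by rewrite d2; clear; lra.
exists (d * N - k * c); split=> //.
have three : (3 : int) != 0 by [].
by apply: (mulfI three); rewrite Nd {1}cE; ring.
Qed.

Lemma torsor_pos d c : 0 < d * c -> torsor d c -> 0 < d.
Proof.
move=> dc [m [n [e [u [v [cop eqn]]]]]].
rewrite ltNge; apply/negP => d0.
have c0 : c <= 0 by move: dc d0; clear; nia.
have d1 : d < 0 by rewrite lt_neqAle d0 andbT; apply: contraTneq dc => ->; rewrite mul0r.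
have c1 : c < 0 by rewrite lt_neqAle c0 andbT; apply: contraTneq dc => ->; rewrite mulr0.
have m4 : 0 <= m ^+ 4 by rewrite (exprM m 2 2) sqr_ge0.
have e4 : 0 <= e ^+ 4 by rewrite (exprM e 2 2) sqr_ge0.
have n2 := sqr_ge0 n.
have dm : d * m ^+ 4 <= 0 by rewrite nmulr_rle0.
have ce : c * e ^+ 4 <= 0 by rewrite nmulr_rle0.
have dm0 : d * m ^+ 4 = 0 by move: n2; rewrite eqn; move: dm ce; clear; lra.
have ce0 : c * e ^+ 4 = 0 by move: n2; rewrite eqn; move: dm ce; clear; lra.
have m0 : m = 0.
  by apply/eqP; move/eqP: dm0; rewrite mulf_eq0 (lt_eqF d1) expf_eq0.
have e0 : e = 0.
  by apply/eqP; move/eqP: ce0; rewrite mulf_eq0 (lt_eqF c1) expf_eq0.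
by move: cop; rewrite m0 e0 !mulr0.
Qed.

(** Both 18 and 72 divide 6^4, though 72 does not divide 6^2; so d divides (6p)^4, and
    squarefreeness is used twice to reach 6p. *)
Lemma abs_class d c N : odd `|d| -> sqfree `|d| -> `|d * c|%R = (N * p ^ 2)%N ->
  (N %| 6 ^ 4)%N -> `|d|%N \in [:: 1; 3; p; 3 * p]%N.
Proof.
move=> oddd sqd dc N6; apply: (odd_dvd_3p pp oddd sqd).
apply: (sqfree_dvd_sqr sqd); apply: (sqfree_dvd_sqr sqd).
have -> : (((6 * p) ^ 2) ^ 2 = 6 ^ 4 * p ^ 2 * p ^ 2)%N by ring.
rewrite dvdn_mulr //; apply: (@dvdn_trans (N * p ^ 2)); last by rewrite dvdn_mul.
have : (`|d| %| `|d| * `|c|)%N by rewrite dvdn_mulr.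
by rewrite -abszM; move: dc; rewrite -abszE => -[->].
Qed.

Lemma class_bound d c : odd `|d| -> sqfree `|d| -> 18 * p%:Z ^+ 2 = d * c -> torsor d c ->
  d \in [:: 1; 3; p%:Z; 3 * p%:Z].
Proof.
move=> oddd sqd dc tor; have p0 : 0 < p%:Z by rewrite ltz_nat prime_gt0.
have d0 : 0 < d by apply: torsor_pos tor; rewrite -dc mulr_gt0 ?exprn_gt0.
have absdc : `|d * c| = (18 * p ^ 2)%N by rewrite -dc -abszE abszM abszX.
have := abs_class oddd sqd absdc isT.
rewrite -[d in X in _ -> X](gez0_abs (ltW d0)) !inE -!eqz_nat PoszM.
by case/or4P => ->; rewrite ?orbT.
Qed.

Lemma class_mod8 d c : odd p -> odd `|d| -> 18 * p%:Z ^+ 2 = d * c -> torsor d c ->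
  exists k, d = 8 * k + 1 \/ d = 8 * k + 3.
Proof.
move=> oddp oddd dc; have [k dE] := int_odd oddd.
have [|c' [-> NE]] := @odd_cofactor2 d c (9 * p%:Z ^+ 2) oddd; first by rewrite -dc; ring.
have [[g pE]|[g [p2 _]]] := sqr_mod8 p%:Z; first by move: oddp pE; clear; lia.
by apply: (torsor_mod8_13 dE (k := 9 * g + 1)); rewrite -NE p2; ring.
Qed.

Lemma dual_class_mod8 d c : odd p -> odd `|d| -> - 72 * p%:Z ^+ 2 = d * c -> torsor d c ->
  exists k, d = 8 * k + 1.
Proof.
move=> oddp oddd dc; have [k dE] := int_odd oddd.
have [|c' [-> NE]] := @odd_cofactor8 d c (- 9 * p%:Z ^+ 2) oddd; first by rewrite -dc; ring.
have oddc' : odd `|c'|.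
  have : odd `|d * c'| by rewrite -NE abszM abszX oddM oddX oddp.
  by rewrite abszM oddM => /andP[].
have [kc cE] := int_odd oddc'.
exact: torsor_mod8 dE cE.
Qed.

(** The factor 9 of 72 lies wholly in c, or is shared equally as d is squarefree. The remaining
    cofactors multiply to -8 p^2 = 1 modulo 3, and the shared case has no solution. *)
Lemma dual_class_mod3 d c : p != 3 -> sqfree `|d| -> - 72 * p%:Z ^+ 2 = d * c -> torsor d c ->
  exists k, d = 3 * k + 1.
Proof.
move=> p3 sqd dc tor.
have [g p2] : exists g, p%:Z ^+ 2 = 3 * g + 1.
  have [[g gE]|[g [_ [gE _]]]] := sqr_mod3 p%:Z; last by exists g.
  have : (3 %| p)%N by move: gE; clear; lia.
  by rewrite dvdn_prime2 // eq_sym (negPf p3).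
have NE : - 8 * p%:Z ^+ 2 = 3 * (- 8 * g - 3) + 1 by rewrite p2; ring.
have three : (3 : int) != 0 by [].
have [[k dE]|[k [_ [d2 _]]]] := sqr_mod3 d; last first.
  have [||c1 [c1E N1]] := @cofactor3 d c (- 24 * p%:Z ^+ 2); [by exists k|by rewrite -dc; ring|].
  have [||c2 [c2E N2]] := @cofactor3 d c1 (- 8 * p%:Z ^+ 2); [by exists k|by rewrite -N1; ring|].
  apply: (@torsor_mod3 d c2 (- 8 * g - 3)); first by rewrite -N2.
  by move: tor; rewrite c1E c2E mulrA.
have k2 : exists g, k ^+ 2 = 3 * g + 1.
  have [[h hE]|[h [_ [hE _]]]] := sqr_mod3 k; last by exists h.
  have : (3 ^ 2 %| `|d|)%N by rewrite dE hE !abszM mulnA dvdn_mulr.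
  by move/sqd.
have kc : k * c = - 24 * p%:Z ^+ 2.
  by apply: (mulfI three); transitivity (d * c); [rewrite dE|rewrite -dc]; ring.
have [|c' [c'E N1]] := @cofactor3 k c (- 8 * p%:Z ^+ 2) k2; first by rewrite kc; ring.
case: (@torsor_3mod3 k c' (- 8 * g - 3)); first by rewrite -N1.
by rewrite -dE -c'E.
Qed.

Lemma class_small d c : (p == 2%N) || (p == 3%N) -> odd `|d| -> sqfree `|d| ->
  18 * p%:Z ^+ 2 = d * c -> torsor d c -> d \in [:: 1].
Proof.
move=> p23 oddd sqd dc tor; have := class_bound oddd sqd dc tor.
have three : (3 : int) != 0 by [].
case/orP: p23 => /eqP pE; rewrite pE !inE => /or4P[] /eqP dE;
  rewrite dE ?eqxx // in oddd sqd dc tor *.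
- have cE : c = 8 * 3 by apply: (mulfI three); rewrite -dc pE.
  have [k] : exists k : int, 3 = 8 * k + 1 by apply: (@torsor_mod8 3 3 1 1); rewrite -?cE.
  by lia.
- have cE : c = 54 by apply: (mulfI three); rewrite -dc pE.
  by case: torsor_3_54; rewrite -cE.
- have cE : c = 54 by apply: (mulfI three); rewrite -dc pE.
  by case: torsor_3_54; rewrite -cE.
by have := sqd 3%N isT.
Qed.

(** The obstruction at the other prime decides: modulo 3 when p = 2, and modulo 8 when p = 3, where
    9 passes the congruence but is not squarefree. *)
Lemma dual_class_small d c : (p == 2%N) || (p == 3%N) -> odd `|d| -> sqfree `|d| ->
  - 72 * p%:Z ^+ 2 = d * c -> torsor d c -> d \in [:: 1].
Proof.
move=> p23 oddd sqd dc tor.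
have absdc : `|d * c| = (72 * p ^ 2)%N by rewrite -dc -abszE abszM abszX.
have := abs_class oddd sqd absdc isT.
case/orP: p23 => /eqP pE.
  have [|k dE] := dual_class_mod3 _ sqd dc tor; first by rewrite pE.
  by rewrite pE !inE; move: oddd; rewrite dE; clear; lia.
have [|k dE] := dual_class_mod8 _ oddd dc tor; first by rewrite pE.
have nsq9 : `|d|%N != 9%N by apply/eqP => d9; have := sqd 3%N; rewrite d9 => /(_ isT).
by rewrite pE !inE; move: nsq9; rewrite dE; clear; lia.
Qed.

Lemma dual_class_bound d c : (3 < p)%N -> odd `|d| -> sqfree `|d| ->
  - 72 * p%:Z ^+ 2 = d * c -> torsor d c ->
  [\/ d = 1, d = p%:Z /\ p = 1 %[mod 24] | d = - p%:Z /\ p = 23 %[mod 24]].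
Proof.
move=> p3 oddd sqd dc tor.
have oddp : odd p by case: (even_prime pp) p3 => // ->.
have absdc : `|d * c| = (72 * p ^ 2)%N by rewrite -dc -abszE abszM abszX.
have := abs_class oddd sqd absdc isT.
have [|k dE] := dual_class_mod3 _ sqd dc tor; first by move: p3; clear; lia.
have [k' dE'] := dual_class_mod8 oddp oddd dc tor.
rewrite !inE => /or4P[] /eqP absd.
- by constructor 1; move: absd; rewrite dE; clear; lia.
- by exfalso; move: absd; rewrite dE; clear; lia.
- have [dp|dp] : d = p%:Z \/ d = - p%:Z by move: absd; clear; lia.
    by constructor 2; split=> //; move: dE dE'; rewrite dp; clear; lia.
  by constructor 3; split=> //; move: dE dE'; rewrite dp; clear; lia.
by exfalso; move: absd; rewrite dE; clear; lia.
Qed.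

End Classes.

Lemma prime_sqr_pow4 p : prime p -> exists j (q : int),
  p%:Z ^+ 2 = (2 ^+ j) ^+ 2 * q /\ odd `|q|.
Proof.
case/even_prime => [->|oddp]; first by exists 1%N, 1.
by exists 0%N, (p%:Z ^+ 2); split; [ring|rewrite abszX oddX oddp].
Qed.

(** [S] and [S'] contain the odd classes for the two curves. A label is a position in each list, so
    there are fewer labels than the 2^(k+1) subset sums of k + 1 points. *)
Lemma rank_bound p (hp : prime p) (S S' : seq int) k :
  (forall d c, odd `|d| -> sqfree `|d| -> 18 * p%:Z ^+ 2 = d * c -> torsor d c -> d \in S) ->
  (forall d c, odd `|d| -> sqfree `|d| -> - 72 * p%:Z ^+ 2 = d * c -> torsor d c -> d \in S') ->
  (size S * size S' < 2 ^ k.+1)%N -> rank_le (ec_point (Ep hp)) k.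
Proof.
move=> SP SP' card; apply: rank_le_of_dependent => P.
pose a : rat := 3%:~R; pose beta : int := 2 * p%:Z ^+ 2.
pose b := a * beta%:~R; pose b' := - 4 * b.
have p0 : p%:Z != 0 by rewrite -lt0n prime_gt0.
have pq0 : (p%:Z%:~R : rat) != 0 by rewrite intr_eq0.
have a0 : a != 0 by [].
have b0 : b != 0 by rewrite mulf_neq0 // intr_eq0 mulf_neq0 // expf_neq0.
have b'0 : b' != 0 by rewrite mulf_neq0.
have fE : cc_poly (Ep hp) = a *: 'X^3 + b *: 'X.
  rewrite /= Ep_polyE; congr (_ + _ *: _).
  by rewrite /b /a /beta intrM rmorphXn /=; ring.
pose E' := @CubicCurve rat _ isT (cubic_size b' a0) (cubic_separable a (isT : (2 : rat) != 0) b'0).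
have fE' : cc_poly E' = a *: 'X^3 + b' *: 'X by [].
have b'E : b' = - 4 * b * 1 ^+ 4 by rewrite expr1n mulr1.
have bE : b = - 4 * b' * (2^-1) ^+ 4 by rewrite /b'; field.
have ss' : 2 * (1 * 2^-1) = 1 :> rat by [].
have BE : a * b = (18 * p%:Z ^+ 2)%:~R.
  by rewrite /b /a /beta !(rmorphXn, intrM) /=; ring.
have BE' : a * b' = (- 72 * p%:Z ^+ 2)%:~R.
  by rewrite /b' /b /a /beta !(rmorphXn, intrM) /=; ring.
(* 18 p^2 is 2 (3p)^2, while -72 p^2 below is negative. *)
have nsq : ~ (exists z, a * b = z ^+ 2).
  case=> z zE; apply: (@rat_sqr_neq_2odd (z / (3 * p%:Z%:~R)) 1) => //.
  by rewrite expr_div_n -zE BE !(rmorphXn, intrM) /=; field.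
have nsq' : ~ (exists z, a * b' = z ^+ 2).
  case=> z zE; have := sqr_ge0 z; rewrite -zE BE' ler0z leNgt => /negP; apply.
  by rewrite nmulr_rlt0 // exprn_gt0 // ltz_nat prime_gt0.
(* The power of 4 in p^2 must be split off because p may be 2. *)
have [j [q [pE oddq]]] := prime_sqr_pow4 hp.
pose L (v : ec_point (Ep hp)) (i : 'I_(size S)) := same_class a b v (S`_i)%:~R.
pose L' (v : ec_point E') (i : 'I_(size S')) := same_class a b' v (S'`_i)%:~R.
have Ltot v : exists i, L v i.
  have [||d [c [oddd sqd dc tor cls]]] := @odd_class _ a b (18 * p%:Z ^+ 2) (9 * q) j v fE BE.
  - by rewrite pE; ring.
  - by rewrite abszM oddM oddq.
  have dS := SP _ _ oddd sqd dc tor.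
  have iS : (index d S < size S)%N by rewrite index_mem.
  by exists (Ordinal iS); rewrite /L /= nth_index.
have Ltot' v : exists i, L' v i.
  have [||d [c [oddd sqd dc tor cls]]] := @odd_class _ a b' (- 72 * p%:Z ^+ 2) (- 9 * q) j.+1 v fE' BE'.
  - by rewrite pE (exprS 2 j); ring.
  - by rewrite abszM oddM oddq.
  have dS := SP' _ _ oddd sqd dc tor.
  have iS : (index d S' < size S')%N by rewrite index_mem.
  by exists (Ordinal iS); rewrite /L' /= nth_index.
have [LL [LLtot LLeq]] := labels_comp (isogenyB fE' fE bE) (isogeny_dual fE fE' b'E bE ss')
  (isogeny_val0 fE' fE bE (erefl (val (origin fE')))) (origin2 fE) Ltot Ltot'
  (fun v w i => @same_class_isogeny _ _ _ _ _ _ _ fE' fE bE v w _ nsq)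
  (fun v w i => @same_class_isogeny _ _ _ _ _ _ _ fE fE' b'E v w _ nsq').
apply: (descent (origin2 fE) LLtot LLeq (@northcott _) (pheight_sub fE) (pheight_double fE fE')).
by rewrite card_prod !card_ord.
Qed.

(** * Rank bounds by residue class modulo 24 *)

Section Bounds.
Variables (p : nat).
Hypothesis hp : prime p.
Local Notation EpQ := (ec_point (Ep hp)).

Lemma rank_bound_small : (p == 2%N) || (p == 3%N) -> rank_le EpQ 0.
Proof.
move=> p23; apply: (@rank_bound p hp [:: 1] [:: 1]) => // d c oddd sqd dc tor.
  exact: (class_small hp p23 oddd sqd dc tor).
exact: (dual_class_small hp p23 oddd sqd dc tor).
Qed.

Hypothesis p3 : (3 < p)%N.

Let p_odd : odd p.
Proof. by case: (even_prime hp) p3 => // ->. Qed.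

Let p_neq0 : p%:Z != 0.
Proof. by rewrite -lt0n prime_gt0. Qed.

Lemma class_generic d c : odd `|d| -> sqfree `|d| -> 18 * p%:Z ^+ 2 = d * c -> torsor d c ->
  [\/ d = 1,
      d = 3 /\ torsor 3 (6 * p%:Z ^+ 2),
      [/\ d = p%:Z, p = 1 %[mod 8] \/ p = 3 %[mod 8] & exists t : 'F_p, t ^+ 4 = - 18] |
      [/\ d = 3 * p%:Z, p = 1 %[mod 8] \/ p = 3 %[mod 8] & exists t : 'F_p, t ^+ 4 = - 2]].
Proof.
move=> oddd sqd dc tor; have := class_bound hp oddd sqd dc tor.
have [k dE] := class_mod8 p_odd oddd dc tor.
have three : (3 : int) != 0 by [].
rewrite !inE => /or4P[] /eqP dp; rewrite dp in dc tor.
- by constructor 1.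
- constructor 2; split=> //; rewrite (_ : 6 * _ = c) //.
  by apply: (mulfI three); rewrite -dc; ring.
- constructor 3; split=> //; first by move: dE; rewrite dp; clear; lia.
  have cE : c = p%:Z * (1%:Z * 18%:Z) by apply: (mulfI p_neq0); rewrite -dc; ring.
  have [||t tE] := @torsor_p p hp 18 1; first exact: oner_neq0.
    by rewrite -cE mulr1.
  by exists t.
constructor 4; split=> //; first by move: dE; rewrite dp; clear; lia.
have cE : c = p%:Z * (3%:Z * 2%:Z).
  by apply: (mulfI (mulf_neq0 three p_neq0)); rewrite -dc; ring.
have [||t tE] := @torsor_p p hp 2 3.
- by rewrite Fp_natr_neq0.
- by rewrite -cE mulrC.
by exists t.
Qed.

Lemma no_class3 : p = 7 %[mod 24] \/ p = 17 %[mod 24] -> ~ torsor 3 (6 * p%:Z ^+ 2).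
Proof.
move=> p24 /(torsor_3_modp hp) [t []]; first exact: nsqr_3.
exact: nsqr_6.
Qed.

Lemma dual_class_trivial : p <> 1 %[mod 24] -> p <> 23 %[mod 24] ->
  forall d c, odd `|d| -> sqfree `|d| -> - 72 * p%:Z ^+ 2 = d * c -> torsor d c ->
  d \in [:: 1].
Proof.
move=> p1 p23 d c oddd sqd dc tor.
by case: (dual_class_bound hp p3 oddd sqd dc tor) => [->|[_ /p1]|[_ /p23]].
Qed.

Lemma rank_bound_7 : p = 7 %[mod 24] -> rank_le EpQ 0.
Proof.
move=> p7; apply: (@rank_bound p hp [:: 1] [:: 1]) => // d c oddd sqd dc tor; last first.
  by apply: (dual_class_trivial _ _ oddd sqd dc tor); rewrite p7.
case: (class_generic oddd sqd dc tor) => [->|[_ t3]|[_ p8 _]|[_ p8 _]] //.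
- by have [] := no_class3 (or_introl p7) t3.
- by move: p7 p8; clear; lia.
- by move: p7 p8; clear; lia.
Qed.

Lemma rank_bound_5_13 : p = 5 %[mod 24] \/ p = 13 %[mod 24] -> rank_le EpQ 1.
Proof.
move=> p24; apply: (@rank_bound p hp [:: 1; 3] [:: 1]) => // d c oddd sqd dc tor; last first.
  by apply: (dual_class_trivial _ _ oddd sqd dc tor); case: p24 => ->.
case: (class_generic oddd sqd dc tor) => [->|[-> _]|[_ p8 _]|[_ p8 _]] //.
- by move: p24 p8; clear; lia.
- by move: p24 p8; clear; lia.
Qed.

(** The class 3 is excluded since neither 3 nor 6 is a square modulo p. Classes p and 3p need -18
    and -2 to be fourth powers, which cannot both hold; a case split on -18 leaves one of them in
    the list. *)
Lemma rank_bound_17 : p = 17 %[mod 24] -> rank_le EpQ 1.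
Proof.
move=> p17.
have dual : forall d c, odd `|d| -> sqfree `|d| -> - 72 * p%:Z ^+ 2 = d * c -> torsor d c ->
  d \in [:: 1] by apply: dual_class_trivial; rewrite p17.
have [[t tE]|nt] := classic (exists t : 'F_p, t ^+ 4 = - 18).
  apply: (@rank_bound p hp [:: 1; p%:Z] [:: 1]) => // d c oddd sqd dc tor.
  case: (class_generic oddd sqd dc tor) => [->|[_ t3]|[-> _ _]|[_ _ [s sE]]].
  - by [].
  - by have [] := no_class3 (or_intror p17) t3.
  - by rewrite !inE eqxx orbT.
  by case: (not_both_quartic hp p17 tE sE).
apply: (@rank_bound p hp [:: 1; 3 * p%:Z] [:: 1]) => // d c oddd sqd dc tor.
case: (class_generic oddd sqd dc tor) => [->|[_ t3]|[_ _ /nt //]|[-> _ _]].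
- by [].
- by have [] := no_class3 (or_intror p17) t3.
by rewrite !inE eqxx orbT.
Qed.

Lemma dual_class_1 : p = 1 %[mod 24] ->
  forall d c, odd `|d| -> sqfree `|d| -> - 72 * p%:Z ^+ 2 = d * c -> torsor d c ->
  d \in [:: 1; p%:Z].
Proof.
move=> p1 d c oddd sqd dc tor.
case: (dual_class_bound hp p3 oddd sqd dc tor) => [->|[-> _]|[_]]; rewrite ?inE ?eqxx ?orbT //.
by rewrite p1.
Qed.

Lemma rank_bound_1 : p = 1 %[mod 24] -> rank_le EpQ 3.
Proof.
move=> p1; apply: (@rank_bound p hp [:: 1; 3; p%:Z; 3 * p%:Z] [:: 1; p%:Z]) => //.
  by move=> d c; apply: class_bound.
exact: dual_class_1.
Qed.

(** Either of the classes p and 3p would make 2 a fourth power modulo p; losing both halves the list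
    and lowers the bound from 3 to 2. *)
Lemma rank_bound_1_nonquartic : p = 1 %[mod 24] -> quartic_symbol2 p != 1 -> rank_le EpQ 2.
Proof.
move=> p1 nq; have nq4 : ~ (exists t : 'F_p, t ^+ 4 = 2).
  by move/(quartic_symbolP hp); apply/negP.
apply: (@rank_bound p hp [:: 1; 3] [:: 1; p%:Z]) => //; last exact: dual_class_1.
move=> d c oddd sqd dc tor.
case: (class_generic oddd sqd dc tor) => [->|[-> _]|[_ _ t18]|[_ _ t2]] //.
  by case: nq4; apply: (quartic_2 hp p1); left.
by case: nq4; apply: (quartic_2 hp p1); right.
Qed.

Lemma rank_bound_11_19 : p = 11 %[mod 24] \/ p = 19 %[mod 24] -> rank_le EpQ 2.
Proof.
move=> p24; apply: (@rank_bound p hp [:: 1; 3; p%:Z; 3 * p%:Z] [:: 1]) => //.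
  by move=> d c; apply: class_bound.
by apply: dual_class_trivial; case: p24 => ->.
Qed.

Lemma rank_bound_23 : p = 23 %[mod 24] -> rank_le EpQ 2.
Proof.
move=> p23; apply: (@rank_bound p hp [:: 1; 3] [:: 1; - p%:Z]) => // d c oddd sqd dc tor.
  case: (class_generic oddd sqd dc tor) => [->|[-> _]|[_ p8 _]|[_ p8 _]] //.
    by move: p23 p8; clear; lia.
  by move: p23 p8; clear; lia.
case: (dual_class_bound hp p3 oddd sqd dc tor) => [->|[_]|[-> _]]; rewrite ?inE ?eqxx ?orbT //.
by rewrite p23.
Qed.

Lemma prime_mod24 : (p %% 24)%N \in [:: 1; 5; 7; 11; 13; 17; 19; 23]%N.
Proof.
have nd q : prime q -> (q <= 3)%N -> ~~ (q %| p)%N.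
  by move=> pq q3; rewrite dvdn_prime2 // ltn_eqF // (leq_ltn_trans q3).
have n2 := nd 2 isT isT; have n3 := nd 3 isT isT.
move: n2 n3; rewrite /dvdn -(modn_dvdm p (isT : 2 %| 24)%N) -(modn_dvdm p (isT : 3 %| 24)%N).
by have := ltn_pmod p (isT : 0 < 24)%N; move: (p %% 24)%N; do 24?[case=> //].
Qed.

End Bounds.

Lemma has_rank0 (V : zmodType) : rank_le V 0 -> has_rank V 0.
Proof. by case=> r; rewrite leqn0 => /eqP ->. Qed.

Theorem theorem0p1 (p : nat) (hp : prime p) :
  let EpQ := ec_point (Ep hp) in
  let case1 := p = 2%N \/ p = 3%N \/ p = 7 %[mod 24] in
  let case2 := p = 5 %[mod 24] \/ p = 13 %[mod 24] \/ p = 17 %[mod 24] in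
  let case3 := p = 1 %[mod 24] /\ quartic_symbol2 p = 1 in
  [/\ case1 -> has_rank EpQ 0,
      case2 -> rank_le EpQ 1,
      case3 -> rank_le EpQ 3 &
      ~ case1 -> ~ case2 -> ~ case3 -> rank_le EpQ 2].
Proof.
move=> EpQ case1 case2 case3.
have small : (p == 2%N) || (p == 3%N) \/ (3 < p)%N by move: (prime_gt1 hp); clear; lia.
have big (r : nat) : (p = r %[mod 24])%N -> (r != 2)%N -> (r != 3)%N -> (r < 24)%N -> (3 < p)%N.
  by case: small => //; clear; lia.
split.
- case=> [p2|[p3|p7]]; apply: has_rank0.
  + by apply: rank_bound_small; rewrite p2.
  + by apply: rank_bound_small; rewrite p3.
  + exact: rank_bound_7 (big _ p7 isT isT isT) p7.
- case=> [p24|[p24|p24]].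
  + by apply: rank_bound_5_13 (big _ p24 isT isT isT) _; left.
  + by apply: rank_bound_5_13 (big _ p24 isT isT isT) _; right.
  + exact: rank_bound_17 (big _ p24 isT isT isT) p24.
- by case=> p1 _; apply: rank_bound_1 (big _ p1 isT isT isT) p1.
move=> n1 n2 n3; case: small => [/orP[/eqP p2|/eqP p3]|p3].
- by case: n1; left.
- by case: n1; right; left.
have := prime_mod24 hp p3; rewrite !inE.
(* Outside the first three cases only the residues 11, 19 and 23 remain, and 1 with 2 not a fourth
   power. *)
case/or4P => [|||/or4P[|||/orP[]]] /eqP p24.
- apply: rank_bound_1_nonquartic => //; apply/eqP => q1; by case: n3.
- by case: n2; left.
- by case: n1; right; right.
- by apply: rank_bound_11_19 => //; left.
- by case: n2; right; left.
- by case: n2; right; right.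
- by apply: rank_bound_11_19 => //; right.
exact: rank_bound_23.
Qed.
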